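(* For every $N$ and every block size $B=\Omega(\log N)$ (i.e. $B$ large enough to store an address), there exists a 3-server Oblivious RAM scheme for a logical memory of $N$ blocks of $B$ bits each that is perfectly correct, is perfectly secure with respect to a semi-honest adversary corrupting any single server, and achieves (amortized) bandwidth $O(\log^2 N)$ blocks per logical memory access. Moreover, the scheme does not rely on server-side computation (it is a passive-server scheme).
   Context: **Model.** A trusted client $\mathbf{C}$ interacts with three servers $\mathbf{S}_0,\mathbf{S}_1,\mathbf{S}_2$. All parties are probabilistic random access machines whose memories consist of blocks of $B$ bits. The client has private memory of $O(1)$ blocks; each server has memory of $O(N)$ blocks. In a *passive-server* scheme each server only answers memory read requests (address) and memory write requests (address, value) from the client; servers perform no computation and do not communicate with each other. Time proceeds in rounds; in each round at most one block can be exchanged between each pair of parties. The client can sample, at unit cost, a uniformly random block and a uniformly random element of $\{1,\dots,m\}$ for any $m=O(N)$ (so a uniformly random permutation of $n=O(N)$ items can be generated in $O(n)$ time by Fisher–Yates). **Ideal logical memory.** An array of $N$ blocks with addresses $0,\dots,N-1$, all initially $0$. On $(\mathtt{read},\mathsf{addr})$, the block at $\mathsf{addr}$ is returned. On $(\mathtt{write},\mathsf{addr},\mathsf{data})$, the block at $\mathsf{addr}$ is overwritten by $\mathsf{data}$ and its old value is returned. **3-server ORAM.** A protocol between the client and the servers proceeding in iterations: in each iteration the client receives one request $(\mathtt{read},\mathsf{addr})$ or $(\mathtt{write},\mathsf{addr},\mathsf{data})$, runs a (possibly randomized) interaction with the servers, and produces an output. A request sequence is a finite sequence of such requests. *Perfect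 correctness:* for every request sequence, with probability $1$ all outputs of the client equal those of the ideal logical memory on the same request sequence. *View.* For a corrupt server $\mathbf{S}_b$ and request sequence $\mathbf{R}$, $\mathsf{view}^b(\mathbf{R})$ is the random variable consisting of the input of $\mathbf{S}_b$, all randomness used by $\mathbf{S}_b$, the ordered sequence of all messages received by $\mathbf{S}_b$ together with senders and the rounds in which they are received, and the honest communication pattern (which pairs of honest parties, including the client, exchange messages in which rounds). The corrupt server follows the protocol (semi-honest). *Perfect security with respect to a semi-honest adversary corrupting any single server:* for every $b\in\{0,1,2\}$ and every two request sequences $\mathbf{R}_0,\mathbf{R}_1$ of equal length, $\mathsf{view}^b(\mathbf{R}_0)$ and $\mathsf{view}^b(\mathbf{R}_1)$ are identically distributed. **Bandwidth.** The number of blocks transferred between the client and the servers; the amortized bandwidth per access is the total number of blocks transferred while serving a request sequence of length $T$, divided by $T$. *)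

(* Defs.v *)
From HB Require Import structures.
From mathcomp Require Import all_boot all_order all_algebra.
Set Implicit Arguments.
Unset Strict Implicit.
Unset Printing Implicit Defensive.
Import GRing.Theory.

(* Finitely supported distributions, as weighted lists; the same outcome may
   be listed several times, its weights then add up. *)

Definition dist (A : Type) := seq (rat * A).

Definition dret A (a : A) : dist A := [:: (1%R, a)].

Definition dbind A A' (d : dist A) (f : A -> dist A') : dist A' :=
  flatten [seq [seq ((u.1 * v.1)%R, v.2) | v <- f u.2] | u <- d].

Definition dmap A A' (f : A -> A') (d : dist A) : dist A' :=
  dbind d (fun a => dret (f a)).

Definition dunif (T : finType) : dist T :=
  [seq ((#|T|%:R^-1)%R, x) | x <- enum T].

Definition Pr A (d : dist A) (E : pred A) : rat :=
  (\sum_(u <- d | E u.2) u.1)%R.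

Definition almost_surely A (d : dist A) (E : pred A) : Prop := Pr d E = 1%R.

Definition identically_distributed A (d1 d2 : dist A) : Prop :=
  forall E : pred A, Pr d1 E = Pr d2 E.

(* Memories of blocks. *)

Definition block (B : nat) := B.-tuple bool.

Definition block0 B : block B := [tuple of nseq B false].

Definition memory (n B : nat) := {ffun 'I_n -> block B}.

Definition memory0 n B : memory n B := [ffun=> block0 B].

(* The same requests are made to the logical memory (n = N) and, by the client,
   to the memory of a passive server. *)
Inductive request (n B : nat) : Type :=
| Read of 'I_n
| Write of 'I_n & block B.
Arguments Read {n B}.
Arguments Write {n B}.

Definition req_addr n B (r : request n B) : 'I_n :=
  match r with Read a => a | Write a _ => a end.

Definition update n B (M : memory n B) (r : request n B) : memory n B :=
  match r with
  | Read _ => M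
  | Write a v => [ffun a' => if a' == a then v else M a']
  end.

(* A write to the logical memory returns the overwritten block. *)
Fixpoint ideal_from N B (M : memory N B) (R : seq (request N B)) :
    seq (block B) :=
  if R is r :: R' then M (req_addr r) :: ideal_from (update M r) R' else [::].

Definition ideal N B (R : seq (request N B)) : seq (block B) :=
  ideal_from (memory0 N B) R.

(* A write to a passive server is not answered. *)
Definition answer n B (M : memory n B) (r : request n B) : option (block B) :=
  if r is Read a then Some (M a) else None.

Notation server := 'I_3.

(* The messages sent by the client to the three servers in one time slot. *)
Definition messages (s B : nat) := {ffun server -> option (request s B)}.

Definition silence s B : messages s B := [ffun=> None].

(* One step of the client, whose whole configuration is a tuple of k blocks:
   everything it remembers after the step is the tuple computed by the
   continuation.  [SampleBelow q] draws from a set of q + 1 <= m elements. *)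
Inductive instr (B k s m : nat) : Type :=
| SampleBlock of (block B -> k.-tuple (block B))
| SampleBelow (q : 'I_m) of ('I_q.+1 -> k.-tuple (block B))
| Talk of messages s B & ({ffun server -> option (block B)} -> k.-tuple (block B))
| Output of block B & k.-tuple (block B).

(* A passive-server scheme.  The servers have no program, no input and no
   randomness; they start with all-zero memories.  [step_bound] bounds the
   number of steps spent on one request: an iteration that exceeds it is cut
   off and produces no output. *)
Record scheme (N B : nat) : Type := Scheme {
  client_blocks : nat;
  server_blocks : nat;
  sample_bound : nat;
  step_bound : nat;
  start : client_blocks.-tuple (block B);
  receive : client_blocks.-tuple (block B) -> request N B ->
            client_blocks.-tuple (block B);
  step : client_blocks.-tuple (block B) ->
         instr B client_blocks server_blocks sample_bound
}.
Arguments client_blocks {N B}.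
Arguments server_blocks {N B}.
Arguments sample_bound {N B}.
Arguments step_bound {N B}.
Arguments start {N B} s.
Arguments receive {N B} s.
Arguments step {N B} s.

Section Execution.

Variables (N B : nat) (P : scheme N B).
Local Notation k := (client_blocks P).
Local Notation s := (server_blocks P).

(* [slots] lists the messages sent so far, one entry for each sampling or
   communication step (the client is silent while it samples). *)
Record config : Type := Config {
  client : k.-tuple (block B);
  servers : {ffun server -> memory s B};
  slots : seq (messages s B)
}.

Definition config0 : config :=
  Config (start P) [ffun=> memory0 s B] [::].

Definition sampled (c : config) (mem : k.-tuple (block B)) : config :=
  Config mem (servers c) (rcons (slots c) (silence s B)).

Definition talked (c : config) (msg : messages s B)
    (f : {ffun server -> option (block B)} -> k.-tuple (block B)) : config :=
  Config
    (f [ffun i => obind (answer (servers c i)) (msg i)])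
    [ffun i => if msg i is Some r then update (servers c i) r else servers c i]
    (rcons (slots c) msg).

Fixpoint serve (fuel : nat) (c : config) : dist (config * option (block B)) :=
  if fuel is fuel'.+1 then
    match step P (client c) with
    | SampleBlock f =>
        dbind (dunif (block B)) (fun x => serve fuel' (sampled c (f x)))
    | SampleBelow q f =>
        dbind (dunif 'I_q.+1) (fun x => serve fuel' (sampled c (f x)))
    | Talk msg f => serve fuel' (talked c msg f)
    | Output out mem => dret (Config mem (servers c) (slots c), Some out)
    end
  else dret (c, None).

Definition iteration (c : config) (r : request N B) :
    dist (config * option (block B)) :=
  serve (step_bound P) (Config (receive P (client c) r) (servers c) (slots c)).

Fixpoint run_from (c : config) (R : seq (request N B)) :
    dist (seq (messages s B) * seq (option (block B))) :=
  if R is r :: R' then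
    dbind (iteration c r) (fun co =>
      dmap (fun rest => (rest.1, co.2 :: rest.2)) (run_from co.1 R'))
  else dret (slots c, [::]).

(* The joint law of the whole communication and of the client's outputs. *)
Definition run (R : seq (request N B)) :
    dist (seq (messages s B) * seq (option (block B))) :=
  run_from config0 R.

Definition perfectly_correct : Prop :=
  forall R, almost_surely (run R) (fun x => x.2 == map Some (ideal R)).

(* In a slot, the client and a server exchange an address, cut into blocks, and
   one data block (sent back by the server for a read, sent along by the client
   for a write).  A slot stands for [slot_blocks] consecutive rounds, so that at
   most one block per round is exchanged between any two parties. *)
Definition address_blocks : nat := (up_log 2 s + B.-1) %/ B.

Definition slot_blocks : nat := address_blocks.+1.

Definition transferred (tr : seq (messages s B)) : nat :=
  \sum_(msg <- tr) #|[set i | isSome (msg i)]| * slot_blocks.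

Definition timed (tr : seq (messages s B)) : seq (nat * messages s B) :=
  zip (iota 0 (size tr)) tr.

(* The view of a corrupt server [b]: the messages it receives (their sender is
   always the client) with the times at which they arrive, and the times at
   which the client exchanges messages with each of the two other servers (the
   servers never talk to each other).  The input and the randomness of a passive
   server are empty. *)
Definition view_of (b : server) (tr : seq (messages s B)) :
    seq (nat * request s B) * seq (nat * server) :=
  (pmap (fun tm : nat * messages s B => omap (pair tm.1) (tm.2 b)) (timed tr),
   flatten [seq [seq (tm.1, i) | i <- enum server & (i != b) && isSome (tm.2 i)]
           | tm : nat * messages s B <- timed tr]).

Definition view (b : server) (R : seq (request N B)) :
    dist (seq (nat * request s B) * seq (nat * server)) :=
  dmap (fun x => view_of b x.1) (run R).

Definition perfectly_secure : Prop :=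
  forall (b : server) (R0 R1 : seq (request N B)), size R0 = size R1 ->
  identically_distributed (view b R0) (view b R1).

(* Total bandwidth at most [w] times the number of requests, for every length
   of the request sequence. *)
Definition amortized_bandwidth_le (w : nat) : Prop :=
  forall R, almost_surely (run R) (fun x => transferred x.1 <= w * size R).

End Execution.

(* Main.v *)
(* The memory is a binary trie of height O(log N), updated by path copying: every
   access recreates the nodes of one path, names them by its time, and stores in
   each node the positions of its children.  The nodes of recent accesses are kept
   in levels of sizes 2^j, level j being rebuilt in a fresh random order every 2^j
   accesses; one extra access per request visits all paths in turn, so that old
   nodes can be dropped.  An access probes each level once at each depth, and the
   rebuilding of a level costs O(1) per access and depth: O(log^2 N) in total.
   The order of a rebuilt structure is the composition of two Fisher-Yates
   shuffles.  The first shuffle, the second shuffle and the probes are each carried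
   out on the two servers other than 0, 1 and 2 respectively, on xor-shared data.
   Since no name is probed twice in the same order, replacing the names probed by
   others is undone, for server 0 or 1, by composing the shuffle it does not see
   with a permutation; server 2 does not see the probes. *)

(* Nothing may fail even with small probability, so pointers hold exact positions, and moving a node
   means rewriting its parent. A parent is never older than its child, and a merge concerns the most
   recent window of its level, so the parents to be rewritten lie in the merged window itself.

   The coupling fixes a shuffle when it is drawn, before the lookups that it has to hide. This is
   possible because the names looked up depend on the request sequence only, later requests
   included, and on no shuffle. They are distinct: an access supersedes the node it finds, and a
   merge reaches a live node from its only live parent. The [5 * 2 ^ j] lookups in a structure are
   the [2 ^ j] accesses of its lifetime and, when it is merged, the two slots of each of the
   [2 ^ j.+1] merged parents.

   One structure for each depth, parity and level makes about [log N * 2 ^ D] cells for [2 ^ D]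
   paths. To stay in [O(N)], only about [N / log N] paths are used, each continued below the
   branching depths by a chain of about [log N] nodes holding the data. *)
From HB Require Import structures.
Require Import Defs.
From mathcomp Require Import all_boot all_order all_algebra zify.

Set Implicit Arguments.
Unset Strict Implicit.
Unset Printing Implicit Defensive.
Import GRing.Theory.

(** * Expectations and straight-line clients *)

(* Distributions are only ever compared through expectations, which commute with [dbind]. *)
Definition Ex A (d : dist A) (f : A -> rat) : rat := (\sum_(u <- d) u.1 * f u.2)%R.

Lemma eq_Ex A (d : dist A) f g : f =1 g -> Ex d f = Ex d g.
Proof. by move=> fg; apply: eq_bigr => u _; rewrite fg. Qed.

Lemma Ex_ret A (a : A) f : Ex (dret a) f = f a.
Proof. by rewrite /Ex big_seq1 mul1r. Qed.

Lemma Ex_bind A A' (d : dist A) (h : A -> dist A') f :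
  Ex (dbind d h) f = Ex d (fun a => Ex (h a) f).
Proof.
rewrite /Ex /dbind big_flatten big_map; apply: eq_bigr => u _ /=.
by rewrite big_map big_distrr; apply: eq_bigr => v _; rewrite /= mulrA.
Qed.

Lemma Ex_map A A' (h : A -> A') (d : dist A) f :
  Ex (dmap h d) f = Ex d (fun a => f (h a)).
Proof. by rewrite Ex_bind; apply: eq_Ex => a; rewrite Ex_ret. Qed.

Lemma Ex_unif (T : finType) f :
  Ex (dunif T) f = (#|T|%:R^-1 * \sum_(x : T) f x)%R.
Proof.
by rewrite /Ex /dunif big_map big_distrr /= big_enum.
Qed.

Lemma PrE A (d : dist A) E : Pr d E = Ex d (fun x => (E x)%:R%R).
Proof.
rewrite /Pr /Ex [RHS](bigID (fun u : rat * A => E u.2)) /=.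
rewrite [X in (_ = _ + X)%R]big1 ?addr0; last by move=> u /negbTE ->; rewrite mulr0.
by apply: eq_bigr => u ->; rewrite mulr1.
Qed.

Lemma dbind_ret A A' (a : A) (h : A -> dist A') : dbind (dret a) h = h a.
Proof.
rewrite /dbind /dret /= cats0; elim: (h a) => //= [[w x]] e ->.
by rewrite mul1r.
Qed.

Lemma eq_dbind A A' (d : dist A) (h h' : A -> dist A') :
  h =1 h' -> dbind d h = dbind d h'.
Proof. by move=> hh; congr flatten; apply: eq_map => u; rewrite hh. Qed.

Lemma dbind_cat A A' (d e : dist A) (h : A -> dist A') :
  dbind (d ++ e) h = dbind d h ++ dbind e h.
Proof. by rewrite /dbind map_cat flatten_cat. Qed.

Lemma dbind_cons A A' u (d : dist A) (h : A -> dist A') :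
  dbind (u :: d) h = [seq ((u.1 * v.1)%R, v.2) | v <- h u.2] ++ dbind d h.
Proof. by []. Qed.

Lemma dbindA A A' A'' (d : dist A) (h : A -> dist A') (h' : A' -> dist A'') :
  dbind (dbind d h) h' = dbind d (fun a => dbind (h a) h').
Proof.
elim: d => // u d IH; rewrite !dbind_cons dbind_cat IH; congr (_ ++ _).
elim: (h u.2) => // v e IHe; rewrite map_cons !dbind_cons map_cat IHe; congr (_ ++ _).
by rewrite -map_comp; apply: eq_map => x /=; rewrite mulrA.
Qed.

Lemma uniform_ne0 (T : finType) : T -> (#|T|%:R != 0 :> rat)%R.
Proof. by move=> x; rewrite Num.Theory.pnatr_eq0 -lt0n; apply/card_gt0P; exists x. Qed.

Lemma Ex_unif1 (T : finType) : T -> Ex (dunif T) (fun _ => 1%R) = 1%R.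
Proof.
move=> x; rewrite Ex_unif sumr_const cardT -cardE -mulr_natl mulr1.
by rewrite mulVf // uniform_ne0.
Qed.

Section Embedding.
Variables (T U : finType) (x0 : T).
Hypothesis card_TU : #|T| <= #|U|.

(** Any injection will do: a step of the client is an arbitrary function on its blocks, so only the
    cardinality of the decoded state matters. *)
Definition embed (x : T) : U := enum_val (widen_ord card_TU (enum_rank x)).
Definition unembed (y : U) : T := odflt x0 [pick x | embed x == y].

Lemma embedK : cancel embed unembed.
Proof.
move=> x; rewrite /unembed; case: pickP => [y /eqP|/(_ x)]; last by rewrite eqxx.
by move=> /enum_val_inj/(congr1 val)/= /ord_inj/enum_rank_inj ->.
Qed.

End Embedding.

Section StraightLine.

Variables (N B s m : nat) (S : finType).
Notation msgs := (messages s B).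

(* The instructions of the client on its decoded state: draw a number, draw a
   block, talk to the servers. *)
Inductive mop : Type :=
| MN (q : 'I_m) of (S -> nat -> S)
| MB of (S -> block B -> S)
| MT of (S -> msgs) & (S -> {ffun server -> option (block B)} -> S).

Definition mcfg : Type := S * {ffun server -> memory s B} * seq msgs.

Definition mtalk (g : S -> msgs) (f : S -> {ffun server -> option (block B)} -> S)
    (c : mcfg) : mcfg :=
  (f c.1.1 [ffun i => obind (answer (c.1.2 i)) (g c.1.1 i)],
   [ffun i => if g c.1.1 i is Some r then update (c.1.2 i) r else c.1.2 i],
   rcons c.2 (g c.1.1)).

Fixpoint mrun (ops : seq mop) (c : mcfg) : dist mcfg :=
  match ops with
  | [::] => dret c
  | MN q f :: ops' => dbind (dunif 'I_q.+1)
      (fun k => mrun ops' (f c.1.1 k, c.1.2, rcons c.2 (silence s B)))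
  | MB f :: ops' => dbind (dunif (block B))
      (fun x => mrun ops' (f c.1.1 x, c.1.2, rcons c.2 (silence s B)))
  | MT g f :: ops' => mrun ops' (mtalk g f c)
  end.

Lemma mrun_cat ops1 ops2 c : mrun (ops1 ++ ops2) c = dbind (mrun ops1 c) (mrun ops2).
Proof.
elim: ops1 c => [|[q f|f|g f] ops IH] c /=; first by rewrite dbind_ret.
- by rewrite dbindA; apply: eq_dbind => k; rewrite IH.
- by rewrite dbindA; apply: eq_dbind => k; rewrite IH.
- exact: IH.
Qed.

(* The time index [t] selects the straight-line program of an iteration; it
   evolves by [nxt], so that the client only keeps a bounded index. *)
Variables (T PC k : nat) (nxt : nat -> nat) (code : nat -> seq mop) (x0 : S).
Variables (recv : S -> request N B -> S) (out : S -> block B).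

Definition full : finType := ('I_T.+1 * 'I_PC.+1 * S)%type.
Notation mem := (k.-tuple (block B)).

Hypothesis card_full : #|full| <= #|{: mem}|.

Notation cenc := (embed card_full).
Notation cdec := (unembed (ord0, ord0, x0) card_full).

Definition cstate (t pc : nat) (x : S) : mem := cenc (inord t, inord pc, x).

Definition sl_step (y : mem) : instr B k s m :=
  let: (t, pc, x) := cdec y in
  match drop pc (code t) with
  | MN q f :: _ => @SampleBelow B k s m q (fun i : 'I_q.+1 => cstate t pc.+1 (f x i))
  | MB f :: _ => @SampleBlock B k s m (fun b => cstate t pc.+1 (f x b))
  | MT g f :: _ => @Talk B k s m (g x) (fun a => cstate t pc.+1 (f x a))
  | [::] => @Output B k s m (out x) (cstate (nxt t) 0 x)
  end.

Definition sl_scheme : scheme N B := {|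
  client_blocks := k; server_blocks := s; sample_bound := m; step_bound := PC.+1;
  start := cstate 0 0 x0;
  receive := fun y r => let: (t, pc, x) := cdec y in cstate t pc (recv x r);
  step := sl_step |}.

(** Each instruction costs one unit of fuel and the final [Output] one more, hence the step bound
    [PC.+1]. The time index advances only at that output. *)
Lemma serveE fuel t pc x sv tr : t <= T -> size (code t) <= PC ->
  pc <= size (code t) -> size (code t) - pc < fuel ->
  @serve N B sl_scheme fuel (@Config N B sl_scheme (cstate t pc x) sv tr) =
  dbind (mrun (drop pc (code t)) (x, sv, tr))
    (fun c => dret (@Config N B sl_scheme (cstate (nxt t) 0 c.1.1) c.1.2 c.2,
                    Some (out c.1.1))).
Proof.
move=> tT sizeT; elim: fuel pc x sv tr => // fuel IH pc x sv tr pcT ltf.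
rewrite /= /sl_step /cstate embedK !inordK ?ltnS ?(leq_trans pcT) //.
have [pcs|pcs] := boolP (pc < size (code t)); last first.
  rewrite drop_oversize; last by rewrite leqNgt.
  by rewrite /= dbind_ret.
case E: (drop pc (code t)) => [|o l].
  by move/(congr1 size): E; rewrite size_drop /=; lia.
have El : drop pc.+1 (code t) = l by rewrite -addn1 addnC -drop_drop E /= drop0.
rewrite -El; case: o {E} => [q f|f|g f] /=.
- by rewrite dbindA; apply: eq_dbind => i; rewrite /sampled /= -/(cstate _ _ _) IH //; lia.
- by rewrite dbindA; apply: eq_dbind => i; rewrite /sampled /= -/(cstate _ _ _) IH //; lia.
- by rewrite /talked /= -/(cstate _ _ _) IH //; lia.
Qed.

Lemma sl_iterationE t x sv tr r : t <= T -> size (code t) <= PC ->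
  @iteration N B sl_scheme (@Config N B sl_scheme (cstate t 0 x) sv tr) r =
  dbind (mrun (code t) (recv x r, sv, tr))
    (fun c => dret (@Config N B sl_scheme (cstate (nxt t) 0 c.1.1) c.1.2 c.2,
                    Some (out c.1.1))).
Proof.
move=> tT sizeT; rewrite /iteration /= {1}/cstate embedK /= !inordK ?ltnS //.
have := @serveE PC.+1 t 0 (recv x r) sv tr tT sizeT (leq0n _); rewrite drop0 subn0 ltnS => /(_ sizeT) H. exact: H.
Qed.

End StraightLine.

(** * Secret-shared memory *)

Lemma Ex_const A (d : dist A) c (f : A -> rat) :
  Ex d (fun _ => 1%R) = 1%R -> (forall a, f a = c) -> Ex d f = c.
Proof.
move=> d1 fc; rewrite -[RHS]mulr1 -[in RHS]d1 /Ex big_distrr /=; apply: eq_bigr => u _.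
by rewrite fc mulr1 mulrC.
Qed.

Section Xor.
Variable B : nat.

Definition bxor (x y : block B) : block B := [tuple tnth x i (+) tnth y i | i < B].

Lemma bxorKr (y : block B) : involutive (bxor^~ y).
Proof.
by move=> x; apply: eq_from_tnth => i; rewrite !tnth_mktuple -addbA addbb addbF.
Qed.

Lemma bxorKl (x y : block B) : bxor x (bxor x y) = y.
Proof.
by apply: eq_from_tnth => i; rewrite !tnth_mktuple addbA addbb addFb.
Qed.

Fixpoint bavg n (g : seq (block B) -> rat) : rat :=
  if n is n'.+1 then Ex (dunif (block B)) (fun r => bavg n' (fun l => g (r :: l)))
  else g [::].

Lemma eq_bavg n g g' : g =1 g' -> bavg n g = bavg n g'.
Proof.
by elim: n g g' => [|n IH] g g' gg /=; rewrite ?gg //; apply: eq_Ex => r; apply: IH.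
Qed.

Lemma bavg_const n g c : (forall l, size l = n -> g l = c) -> bavg n g = c.
Proof.
elim: n g => [|n IH] g gc /=; first exact: gc.
apply: Ex_const => [|r]; first exact: (Ex_unif1 (block0 B)).
by apply: IH => l sl; apply: gc; rewrite /= sl.
Qed.

(** The one-time pad, which alone hides the contents of the shared cells. *)
Lemma Ex_bxor (w : block B) f :
  Ex (dunif (block B)) (fun r => f (bxor r w)) = Ex (dunif (block B)) f.
Proof. by rewrite !Ex_unif [in RHS](reindex_inj (inv_inj (bxorKr w))). Qed.

End Xor.

(** * Programs on abstract cells, which leak only the cells they access *)

Section Abstract.

Variables (Env : Type) (Tmp Wd : Type) (Cell : eqType).

(* One operation draws a number [k <= oq] and exchanges the contents of one cell;
   the colour of a cell is the server that does not see its address. *)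
Record op := Op {
  oq : nat;
  ocol : server;
  ocell : Env -> Tmp -> nat -> Cell;
  oval : Env -> Tmp -> nat -> Wd -> Wd;
  oupd : Env -> Tmp -> nat -> Wd -> Tmp }.

Definition astate : Type := Tmp * (Cell -> Wd).

Definition ostep e o k (st : astate) : astate :=
  let c := ocell o e st.1 k in
  (oupd o e st.1 k (st.2 c),
   fun c' => if c' == c then oval o e st.1 k (st.2 c) else st.2 c').

Fixpoint aex e (ops : seq op) (st : astate) (F : astate -> seq Cell -> rat) : rat :=
  if ops is o :: ops' then
    Ex (dunif 'I_(oq o).+1)
      (fun k => aex e ops' (ostep e o k st) (fun st' l => F st' (ocell o e st.1 k :: l)))
  else F st [::].

Lemma eq_aex e ops st F G : (forall st' l, F st' l = G st' l) ->
  aex e ops st F = aex e ops st G.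
Proof.
elim: ops st F G => [|o ops IH] st F G FG /=; first exact: FG.
by apply: eq_Ex => k; apply: IH => st' l; apply: FG.
Qed.

Lemma aex_cat e ops1 ops2 st F :
  aex e (ops1 ++ ops2) st F =
  aex e ops1 st (fun st1 l1 => aex e ops2 st1 (fun st2 l2 => F st2 (l1 ++ l2))).
Proof.
by elim: ops1 st F => [|o ops1 IH] st F //=; apply: eq_Ex => k; rewrite IH.
Qed.

Lemma Ex_exchange A A' (d : dist A) (d' : dist A') f :
  Ex d (fun x => Ex d' (f x)) = Ex d' (fun y => Ex d (fun x => f x y)).
Proof.
rewrite /Ex; under eq_bigr => u _ do rewrite big_distrr /=.
rewrite exchange_big /=; apply: eq_bigr => v _; rewrite big_distrr /=.
by apply: eq_bigr => u _; rewrite !mulrA [(u.1 * _)%R]mulrC.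
Qed.

Lemma Ex_bavg B A (d : dist A) n (f : A -> seq (block B) -> rat) :
  Ex d (fun x => bavg n (f x)) = bavg n (fun l => Ex d (fun x => f x l)).
Proof.
elim: n f => [|n IH] f //=; rewrite Ex_exchange; apply: eq_Ex => r.
by rewrite (IH (fun x l => f x (r :: l))).
Qed.

(** The masks never influence the abstract run, so the average over them can be moved behind it,
    where only the addresses are left. *)
Lemma aex_bavg B e ops st n (F : seq (block B) -> astate -> seq Cell -> rat) :
  bavg n (fun ms => aex e ops st (F ms)) =
  aex e ops st (fun st' l => bavg n (fun ms => F ms st' l)).
Proof.
elim: ops st F => [|o ops IH] st F //=; rewrite -Ex_bavg.
by apply: eq_Ex => k; rewrite (IH _ (fun ms st' l => F ms st' (_ :: l))).
Qed.

Lemma aex_const e ops (st : astate) F (c : rat) :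
  (forall st' l, size l = size ops -> F st' l = c) -> aex e ops st F = c.
Proof.
elim: ops st F => [|o ops IH] st F Fc /=; first exact: Fc.
apply: Ex_const => [|k]; first exact: (Ex_unif1 (@ord0 _)).
by apply: IH => st' l sl; apply: Fc; rewrite /= sl.
Qed.

End Abstract.

(** * Compilation to xor-shared blocks and simulation of the view of one server *)

Section Concrete.

Variables (N B K s' m' : nat) (Tmp Wd : finType) (Cell : eqType).
Notation s := s'.+1.
Notation m := m'.+1.
Notation Env := ('I_N * option (block B))%type.
Notation op := (op Env Tmp Wd Cell).
Notation share := {ffun 'I_K -> block B}.
Variables (enc : Wd -> share) (dec : share -> Wd).
Hypothesis encK : cancel enc dec.
Variables (colf : Cell -> server) (wfc : pred Cell) (adr : Cell -> nat).
Hypothesis adr_lt : forall x i, wfc x -> i < K -> adr x * K + i < s.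
Hypothesis adr_inj : {in wfc &, injective adr}.

(* A cell of colour [c] is xor-shared by the two servers other than [c]. Every
   operation reads its [K] blocks and writes them back under fresh masks, so that
   the contents are hidden from these two servers and the address from [c]. *)
Definition h1 (c : server) : server := inord ((c + 1) %% 3).
Definition h2 (c : server) : server := inord ((c + 2) %% 3).

Lemma h1v c : (h1 c : nat) = (c + 1) %% 3.
Proof. by rewrite inordK // ltn_mod. Qed.
Lemma h2v c : (h2 c : nat) = (c + 2) %% 3.
Proof. by rewrite inordK // ltn_mod. Qed.

Lemma h1_neq c : (h1 c == c) = false.
Proof. by rewrite -val_eqE /= h1v; case: c => [[|[|[]]]]. Qed.
Lemma h2_neq c : (h2 c == c) = false.
Proof. by rewrite -val_eqE /= h2v; case: c => [[|[|[]]]]. Qed.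
Lemma h21_neq c : (h2 c == h1 c) = false.
Proof. by rewrite -val_eqE /= h2v h1v; case: c => [[|[|[]]]]. Qed.

Definition wfop (o : op) : Prop := oq o < m /\
  forall e t k, k <= oq o -> wfc (ocell o e t k) /\ colf (ocell o e t k) = ocol o.

Definition mst : finType := (Env * Tmp * 'I_m * share * block B)%type.
Definition sreq (x : mst) := x.1.1.1.1.
Definition stmp (x : mst) := x.1.1.1.2.
Definition sk (x : mst) := x.1.1.2.
Definition sold (x : mst) := x.1.2.
Definition smask (x : mst) := x.2.

Definition ad (x : Cell) (i : nat) : 'I_s := inord (adr x * K + i).

Notation msgs := (messages s B).

Definition rdmsg (c : server) (x : Cell) (i : nat) : msgs :=
  [ffun b => if b == c then None else Some (Read (ad x i))].

Definition wrmsg (c : server) (x : Cell) (i : nat) (r w : block B) : msgs :=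
  [ffun b => if b == c then None else
    Some (Write (ad x i) (if b == h1 c then r else bxor r w))].

Definition blk (f : share) (i : nat) : block B :=
  if insub i is Some j then f j else block0 B.

Section OneOp.
Variable o : op.
Notation c := (ocol o).

Definition curcell (x : mst) := ocell o (sreq x) (stmp x) (sk x).
Definition newword (x : mst) := oval o (sreq x) (stmp x) (sk x) (dec (sold x)).

Definition draw_k : mop B s m mst :=
  @MN B s m mst (inord (oq o)) (fun x k => (x.1.1.1, inord k, sold x, smask x)).
Definition read_blk (i : nat) : mop B s m mst :=
  @MT B s m mst (fun x => rdmsg c (curcell x) i)
    (fun x a => (x.1.1, [ffun i' : 'I_K => if i' == i :> nat then
        bxor (odflt (block0 B) (a (h1 c))) (odflt (block0 B) (a (h2 c)))
        else sold x i'], smask x)).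
Definition write_blk (i : nat) : seq (mop B s m mst) :=
  [:: @MB B s m mst (fun x r => (x.1, r));
      @MT B s m mst (fun x => wrmsg c (curcell x) i (smask x) (blk (enc (newword x)) i))
        (fun x _ => x)].
(** A draw from a one-element set is a step that updates the decoded state without talking to a
    server. In all, an operation takes [3 * K + 2] steps: two draws, [K] reads, and [K] masks each
    followed by a write. *)
Definition finish : mop B s m mst :=
  @MN B s m mst ord0 (fun x _ =>
   (sreq x, oupd o (sreq x) (stmp x) (sk x) (dec (sold x)), sk x, sold x, smask x)).

Definition micro : seq (mop B s m mst) :=
  draw_k :: map read_blk (iota 0 K) ++ flatten (map write_blk (iota 0 K)) ++ [:: finish].

End OneOp.

Definition shares (sv : {ffun server -> memory s B}) (x : Cell) : share :=
  [ffun i : 'I_K => bxor (sv (h1 (colf x)) (ad x i)) (sv (h2 (colf x)) (ad x i))].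

(** Related through [dec] and not through [enc]: the zero-filled servers of the start need not hold
    an encoding, but they do represent some abstract memory, namely [amem0]. *)
Definition REL (mem : Cell -> Wd) (sv : {ffun server -> memory s B}) : Prop :=
  forall x, wfc x -> dec (shares sv x) = mem x.

(** Both the view of [b] and the number of blocks transferred are functions of this projection of
    the slots. *)
Definition pj (b : server) (msg : msgs) := (msg b, [ffun i => isSome (msg i)] : {ffun server -> bool}).

Notation sil := (silence s B).

Definition vis (b : server) (x : Cell) : option Cell :=
  if colf x == b then None else Some x.

Definition vrd (c : server) (v : option Cell) i :=
  (omap (fun x => Read (ad x i)) v : option (request s B), [ffun i => i != c] : {ffun server -> bool}).
Definition vwr (c : server) (v : option Cell) i r :=
  (omap (fun x => Write (ad x i) r) v : option (request s B), [ffun i => i != c] : {ffun server -> bool}).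

Fixpoint vwrs b c v i (l : seq (block B)) :=
  if l is r :: l' then [:: pj b sil, vwr c v i r & vwrs b c v i.+1 l'] else [::].

Definition osim b (c : server) (v : option Cell) (ms : seq (block B)) :=
  pj b sil :: [seq vrd c v i | i <- iota 0 K] ++ vwrs b c v 0 ms ++ [:: pj b sil].

(* The view of [b] is sampled from the visible addresses alone. *)
Fixpoint Sim b (ops : seq op) (l : seq (option Cell)) (G : _ -> rat) : rat :=
  match ops, l with
  | o :: ops', v :: l' =>
      bavg K (fun ms => Sim b ops' l' (fun z => G (osim b (ocol o) v ms ++ z)))
  | _, _ => G [::]
  end.

Lemma pj_rd b c x i : pj b (rdmsg c x i) = vrd c (if c == b then None else Some x) i.
Proof.
rewrite /pj /vrd /rdmsg ffunE eq_sym; congr pair; first by case: eqP.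
by apply/ffunP => j; rewrite !ffunE; case: eqP.
Qed.

Lemma pj_wr b c x i r w : pj b (wrmsg c x i r w) =
  vwr c (if c == b then None else Some x) i (if b == h1 c then r else bxor r w).
Proof.
rewrite /pj /vwr /wrmsg ffunE [c == b]eq_sym; congr pair; first by case: (b =P c).
by apply/ffunP => j; rewrite !ffunE; case: (j =P c).
Qed.

Lemma run_reads o rest x sv tr i n (shr : share) : wfc (curcell o x) -> colf (curcell o x) = ocol o ->
  i + n = K -> (forall j : 'I_K, i <= j -> shr j = shares sv (curcell o x) j) ->
  (forall j : 'I_K, j < i -> shr j = sold x j) ->
  mrun (map (read_blk o) (iota i n) ++ rest) (x, sv, tr) =
  mrun rest ((x.1.1, shr, smask x), sv, tr ++ [seq rdmsg (ocol o) (curcell o x) j | j <- iota i n]).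
Proof.
move=> wfx cx; elim: n i x wfx cx tr => [|n IH] i x wfx cx tr iK Hi Hlt /=.
  rewrite cats0; congr (mrun rest (_, _, _)); case: x wfx cx Hi Hlt => [[? old] ?] /= _ _ _ Hlt.
  by congr (_, _, _); apply/ffunP => j; rewrite -Hlt //; have := ltn_ord j; lia.
rewrite /mtalk /=.
have -> : [ffun i0 => match rdmsg (ocol o) (curcell o x) i i0 with
    Some r => update (sv i0) r | None => sv i0 end] = sv.
  by apply/ffunP => b; rewrite ffunE /rdmsg ffunE; case: eqP.
rewrite (IH i.+1) //= ?cat_rcons //; first by lia.
- by move=> j ij; apply: (Hi j); apply: ltnW.
- move=> j; rewrite ltnS leq_eqVlt /sold /= ffunE => /orP[/eqP ji|ji].
    rewrite ji eqxx Hi ?ji // /shares /rdmsg !ffunE cx h1_neq h2_neq /= ji.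
    by [].
  by rewrite ltn_eqF // Hlt.
Qed.

Definition wsv (sv : {ffun server -> memory s B}) c x i r w : {ffun server -> memory s B} :=
  [ffun b => if wrmsg c x i r w b is Some q then update (sv b) q else sv b].

Lemma ad_eq x y i j : wfc x -> wfc y -> i < K -> j < K -> (ad x i == ad y j) = (x == y) && (i == j).
Proof.
move=> wx wy iK jK; apply/eqP/andP => [|[/eqP -> /eqP ->] //].
move/(congr1 val); rewrite /= !inordK ?adr_lt // => E.
have K0 : 0 < K by lia.
have Ei := congr1 (modn^~ K) E; rewrite !modnMDl !modn_small // in Ei.
have Ea := congr1 (divn^~ K) E; rewrite /= !divnMDl // !divn_small // !addn0 in Ea.
by split; apply/eqP => //; apply: adr_inj.
Qed.

Lemma shares_wsv sv x i r w y (j : 'I_K) : wfc x -> wfc y -> i < K ->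
  shares (wsv sv (colf x) x i r w) y j =
  if (y == x) && (j == i :> nat) then w else shares sv y j.
Proof.
move=> wx wy iK; rewrite /shares /wsv /wrmsg !ffunE.
have [-> /=|ne /=] := eqVneq y x; last first.
  by congr bxor; case: eqP => // _; rewrite /= ffunE ad_eq // (negbTE ne).
rewrite h1_neq h2_neq eqxx h21_neq /= !ffunE ad_eq // eqxx /=.
by case: eqP => // _; rewrite bxorKl.
Qed.

(** While the blocks of [X] are being replaced one by one, its shares mix two words. The relation
    with the abstract memory is therefore kept for the other cells only, and block by block for
    [X]. *)
Lemma write_loop o b rest F G x sv tr i n X W mem :
  wfc X -> colf X = ocol o -> curcell o x = X -> enc (newword o x) = W ->
  i + n = K ->
  (forall y, wfc y -> y != X -> dec (shares sv y) = mem y) ->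
  (forall j : 'I_K, j < i -> shares sv X j = W j) ->
  (forall x' sv' tr', x'.1 = x.1 ->
    (forall y, wfc y -> y != X -> dec (shares sv' y) = mem y) ->
    shares sv' X = W -> Ex (mrun rest (x', sv', tr')) F = G (map (pj b) tr')) ->
  Ex (mrun (flatten (map (write_blk o) (iota i n)) ++ rest) (x, sv, tr)) F =
  bavg n (fun ms => G (map (pj b) tr ++ vwrs b (ocol o) (vis b X) i ms)).
Proof.
move=> wX cX; elim: n i x sv tr => [|n IH] i x sv tr xX xW iK Ho HX HG.
  rewrite /= cats0; apply: HG => //; apply/ffunP => j; rewrite HX //.
  by have := ltn_ord j; lia.
rewrite /= Ex_bind.
have iltK : i < K by lia.
set w := blk (enc (newword o x)) i.
have step r : Ex (mrun (flatten (map (write_blk o) (iota i.+1 n)) ++ rest)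
    (mtalk (fun x => wrmsg (ocol o) (curcell o x) i (smask x) (blk (enc (newword o x)) i))
      (fun x _ => x) (x.1, r, sv, rcons tr sil))) F =
   bavg n (fun ms => G (map (pj b) tr ++ [:: pj b sil,
      vwr (ocol o) (vis b X) i (if b == h1 (ocol o) then r else bxor r w)
      & vwrs b (ocol o) (vis b X) i.+1 ms])).
  have wK : W (Ordinal iltK) = w by rewrite /w xW /blk insubT.
  rewrite /mtalk /= -/(wsv sv (ocol o) _ i r w).
  have -> : curcell o (x.1, r) = X by [].
  rewrite (IH i.+1); first last.
  - move=> x' sv' tr' Ex' H1 H2; apply: HG => //.
  - move=> j; rewrite ltnS -cX shares_wsv // eqxx /= leq_eqVlt => /orP[/eqP ji|ji].
      by rewrite ji eqxx -wK; congr (W _); apply: val_inj.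
    by rewrite ltn_eqF // HX.
  - move=> y wy yX; rewrite -(Ho y wy yX); congr dec; apply/ffunP => j.
    by rewrite -cX shares_wsv // (negbTE yX).
  - by lia.
  - by [].
  - by [].
  apply: eq_bavg => ms; rewrite !map_rcons pj_wr -!cats1 -!catA /= /vis cX.
  by rewrite -/w.
rewrite (eq_Ex _ step).
(* Server [h1] receives the mask itself; [h2] receives the mask xor the block, which is equally
   uniform. Server [ocol o] receives nothing, and its term does not depend on [r]. *)
have [bh|bh] := eqVneq b (h1 (ocol o)); first by apply: eq_Ex => r.
exact: (@Ex_bxor B w (fun r => bavg n (fun ms => G (map (pj b) tr ++ [:: pj b sil,
      vwr (ocol o) (vis b X) i r & vwrs b (ocol o) (vis b X) i.+1 ms])))).
Qed.

Lemma bridge1 o b F G x sv tr st : wfop o ->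
  stmp x = st.1 -> REL st.2 sv ->
  (forall x' sv' tr' st', sreq x' = sreq x -> stmp x' = st'.1 -> REL st'.2 sv' ->
     F (x', sv', tr') = G st' (map (pj b) tr')) ->
  Ex (mrun (micro o) (x, sv, tr)) F =
  Ex (dunif 'I_(oq o).+1) (fun k => bavg K (fun ms =>
    G (ostep (sreq x) o k st)
      (map (pj b) tr ++ osim b (ocol o) (vis b (ocell o (sreq x) st.1 k)) ms))).
Proof.
move=> [om wo] xt R HF; rewrite /micro /= Ex_bind.
have -> : (@inord m' (oq o) : nat) = oq o by rewrite inordK.
apply: eq_Ex => k; set x1 := (x.1.1.1, inord k, sold x, smask x).
have km : k < m by apply: leq_trans om; rewrite ltnS -ltnS.
have sk1 : sk x1 = k :> nat by rewrite /sk /= inordK.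
set X := ocell o (sreq x) st.1 k.
have cX : curcell o x1 = X by rewrite /curcell sk1 -/(sreq x) /X -xt.
have [wX colX] : wfc X /\ colf X = ocol o by apply: wo; rewrite -ltnS.
rewrite (@run_reads o _ x1 sv _ 0 K (shares sv X)) ?cX //.
set x2 := (x1.1.1, shares sv X, smask x1).
set st' := ostep (sreq x) o k st.
have dX : dec (sold x2) = st.2 X by rewrite /sold /= R.
have skx2 : sk x2 = k :> nat by [].
pose tr2 := (rcons tr sil ++ [seq rdmsg (ocol o) X j | j <- iota 0 K]).
rewrite (@write_loop o b [:: finish o] F
  (fun z => G st' (z ++ [:: pj b sil])) x2 sv tr2 0 K X (enc (newword o x2)) st.2) //.
- apply: eq_bavg => ms; rewrite /tr2 /osim map_cat map_rcons -cats1 -!catA /= -map_comp.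
  congr (G st' (_ ++ _ :: _ ++ _)); apply: eq_map => j.
  by rewrite /= pj_rd /vis colX.
- by move=> y wy _; apply: R.
- move=> x' sv' tr' Ex' H1 H2 /=.
  have EE : (sreq x' = sreq x) * (stmp x' = st.1) * (sk x' = k :> nat) * (dec (sold x') = st.2 X).
    by rewrite /sreq /stmp /sk /sold Ex' -xt; do !split.
  rewrite Ex_bind Ex_unif (big_ord1) card_ord invr1 mul1r Ex_ret.
  rewrite (HF _ _ _ st') ?map_rcons ?cats1 //.
  + by rewrite /sreq /= -/(sreq x') EE.
  + rewrite {1}/stmp /=; case: EE => [[[-> ->] ->] ->].
    by [].
  + move=> y wy; rewrite /st' /ostep /= -/X; have [->|yX] := eqVneq y X.
      rewrite H2 encK /newword dX.
      by rewrite /stmp /sreq /= -/(sreq x) -/(stmp x) xt skx2.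
    by rewrite H1.
Qed.

Lemma eq_Sim b ops l G G' : G =1 G' -> Sim b ops l G = Sim b ops l G'.
Proof.
elim: ops l G G' => [|o ops IH] [|v l] G G' GG //=.
by apply: eq_bavg => ms; apply: IH.
Qed.

(** From here on the view of [b] is sampled from the visible addresses, so security is reduced to
    the joint law of these addresses. *)
Lemma bridge b ops F G x sv tr st : (forall o, List.In o ops -> wfop o) ->
  stmp x = st.1 -> REL st.2 sv ->
  (forall x' sv' tr' st', sreq x' = sreq x -> stmp x' = st'.1 -> REL st'.2 sv' ->
     F (x', sv', tr') = G st' (map (pj b) tr')) ->
  Ex (mrun (flatten (map micro ops)) (x, sv, tr)) F =
  aex (sreq x) ops st (fun st' l =>
    Sim b ops (map (vis b) l) (fun z => G st' (map (pj b) tr ++ z))).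
Proof.
elim: ops F G x sv tr st => [|o ops IH] F G x sv tr st wo xt R HF.
  by rewrite /= Ex_ret cats0; apply: HF.
rewrite map_cons -cat1s flatten_cat [flatten [:: _]]cats0 mrun_cat Ex_bind.
rewrite (@bridge1 o b _ (fun st' z => aex (sreq x) ops st' (fun st'' l =>
    Sim b ops (map (vis b) l) (fun z' => G st'' (z ++ z')))) x sv tr st) //.
- rewrite [RHS]/=; apply: eq_Ex => k; rewrite aex_bavg; apply: eq_aex => st' l /=.
  apply: eq_bavg => ms; by apply: eq_Sim => z; rewrite -catA.
- by apply: wo; left.
move=> x' sv' tr' st' E1 E2 R'; rewrite -E1; apply: IH => //.
- by move=> o' Ho; apply: wo; right.
- by move=> x2 sv2 tr2 st2 E3 *; apply: HF => //; rewrite E3.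
Qed.

Variables (tmp0 : Tmp) (tout : Tmp -> block B) (prog : nat -> seq op).

Definition env (r : request N B) : Env :=
  match r with Read a => (a, None) | Write a v => (a, Some v) end.

Fixpoint ARun b t (mem : Cell -> Wd) (R : seq (request N B))
    (g : _ -> seq (option (block B)) -> rat) : rat :=
  if R is r :: R' then
    aex (env r) (prog t) (tmp0, mem) (fun st' l =>
      Sim b (prog t) (map (vis b) l) (fun z =>
        ARun b t.+1 st'.2 R' (fun z' outs => g (z ++ z') (Some (tout st'.1) :: outs))))
  else g [::] [::].

Lemma eq_ARun b t mem R g g' : (forall z outs, g z outs = g' z outs) ->
  ARun b t mem R g = ARun b t mem R g'.
Proof.
elim: R t mem g g' => [|r R IH] t mem g g' gg /=; first exact: gg.
by apply: eq_aex => st' l; apply: eq_Sim => z; apply: IH => z' outs; apply: gg.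
Qed.

Definition amem0 : Cell -> Wd := fun _ => dec [ffun=> bxor (block0 B) (block0 B)].

Lemma Sim_const b ops l g c :
  (forall z, (size l = size ops -> size z = size ops * (3 * K + 2)) -> g z = c) ->
  Sim b ops l g = c.
Proof.
elim: ops l g => [|o ops IH] [|v l] g gc /=; try by apply: gc.
apply: bavg_const => ms sm; apply: IH => z sz; apply: gc => -[/sz {}sz].
rewrite /osim /= !size_cat size_map size_iota sz /=.
have -> : forall i, size (vwrs b (ocol o) v i ms) = 2 * K.
  by rewrite -sm; elim: (ms) => //= r ms' IHm i; rewrite IHm; lia.
by lia.
Qed.

Lemma ARun_size b t mem R g c :
  (forall z outs, size z = \sum_(t <= i < t + size R) size (prog i) * (3 * K + 2) -> g z outs = c) ->
  ARun b t mem R g = c.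
Proof.
elim: R t mem g => [|r R IH] t mem g gc /=; first by apply: gc; rewrite big_geq // addn0.
apply: aex_const => st' l sl; apply: Sim_const => z sz; apply: IH => z' outs sz'; apply: gc.
by rewrite /= size_cat sz ?size_map // sz' [in RHS]big_ltn ?addnS // ltnS leq_addr.
Qed.

Lemma ARun_correct (J : nat -> (Cell -> Wd) -> Prop) R outs b :
  size outs = size R -> J 0 amem0 ->
  (forall t r mem (F : astate Tmp Wd Cell -> seq (option Cell) -> rat) c, t < size R -> J t mem ->
     (forall st l, J t.+1 st.2 -> tout st.1 = nth (block0 B) outs t -> F st l = c) ->
     aex (env (nth r R t)) (prog t) (tmp0, mem) (fun st l => F st (map (vis b) l)) = c) ->
  ARun b 0 amem0 R (fun _ o => ((o == map Some outs)%:R)%R) = 1%R.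
Proof.
move=> so J0 HJ.
have gen n t mem : t + n = size R -> J t mem ->
    ARun b t mem (drop t R) (fun _ o => ((o == map Some (drop t outs))%:R)%R) = 1%R.
  elim: n t mem => [|n IH] t mem tn Jt.
    by rewrite !drop_oversize // -?tn ?so -?tn addn0.
  have tR : t < size R by lia.
  case ER: (drop t R) => [|r R'] /=; first by move/(congr1 size): ER; rewrite size_drop /=; lia.
  have Er : nth r R t = r by rewrite -[t]addn0 -nth_drop ER.
  have ER' : R' = drop t.+1 R by rewrite -add1n -drop_drop ER /= drop0.
  rewrite -{1}Er; apply: (HJ t r mem (fun st l => Sim b (prog t) l (fun z =>
    ARun b t.+1 st.2 R' (fun z' o => ((Some (tout st.1) :: o == map Some (drop t outs))%:R)%R)))) => //.
  move=> st l J' E'; apply: Sim_const => z _.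
  rewrite (drop_nth (block0 B)) ?so // E' ER'.
  rewrite -[RHS](IH t.+1 _ _ J'); last by lia.
  by apply: eq_ARun => z' o; rewrite /= eqseq_cons eqxx.
by rewrite -[RHS](gen (size R) 0 amem0) // ?add0n // !drop0.
Qed.

Lemma ARun_rel (Phi : nat -> (Cell -> Wd) -> (Cell -> Wd) -> Prop) b R0 R1 (g : _ -> rat) :
  size R0 = size R1 -> Phi 0 amem0 amem0 ->
  (forall t r m0 m1, t < size R0 -> Phi t m0 m1 ->
    forall F0 F1 : astate Tmp Wd Cell -> seq (option Cell) -> rat,
    (forall st0 st1 l, Phi t.+1 st0.2 st1.2 -> F0 st0 l = F1 st1 l) ->
    aex (env (nth r R0 t)) (prog t) (tmp0, m0) (fun st l => F0 st (map (vis b) l)) =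
    aex (env (nth r R1 t)) (prog t) (tmp0, m1) (fun st l => F1 st (map (vis b) l))) ->
  ARun b 0 amem0 R0 (fun z _ => g z) = ARun b 0 amem0 R1 (fun z _ => g z).
Proof.
move=> sR P0 HP.
have gen n t m0 m1 h : t + n = size R0 -> Phi t m0 m1 ->
    ARun b t m0 (drop t R0) (fun z _ => h z) = ARun b t m1 (drop t R1) (fun z _ => h z).
  elim: n t m0 m1 h => [|n IH] t m0 m1 h tn Pt.
    by rewrite !drop_oversize // -?sR -?tn addn0.
  have tR : t < size R0 by lia.
  case ER0: (drop t R0) => [|r0 R0']; first by move/(congr1 size): ER0; rewrite size_drop /=; lia.
  case ER1: (drop t R1) => [|r1 R1']; first by move/(congr1 size): ER1; rewrite size_drop /=; lia.
  have E0 : nth r0 R0 t = r0 by rewrite -[t]addn0 -nth_drop ER0.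
  have E1 : nth r0 R1 t = r1 by rewrite -[t]addn0 -nth_drop ER1.
  have ER0' : R0' = drop t.+1 R0 by rewrite -add1n -drop_drop ER0 /= drop0.
  have ER1' : R1' = drop t.+1 R1 by rewrite -add1n -drop_drop ER1 /= drop0.
  rewrite /= -{1}E0 -{1}E1.
  apply: (HP t r0 m0 m1 tR Pt
    (fun st l => Sim b (prog t) l (fun z => ARun b t.+1 st.2 R0' (fun z' _ => h (z ++ z'))))
    (fun st l => Sim b (prog t) l (fun z => ARun b t.+1 st.2 R1' (fun z' _ => h (z ++ z'))))).
  move=> st0 st1 l P'; apply: eq_Sim => z; rewrite ER0' ER1'.
  by apply: (IH t.+1 st0.2 st1.2 (fun z' => h (z ++ z'))) => //; lia.
by have := gen (size R0) 0 amem0 amem0 g; rewrite !drop0 add0n; apply.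
Qed.

Variables (red nxt : nat -> nat) (T PC k : nat).
Hypothesis red_le : forall t, red t <= T.
Hypothesis red0 : red 0 = 0.
Hypothesis nxt_red : forall t, nxt (red t) = red t.+1.
Hypothesis prog_red : forall t, prog (red t) = prog t.
Hypothesis prog_wf : forall t o, List.In o (prog t) -> wfop o.

Definition code (t : nat) : seq (mop B s m mst) := flatten (map micro (prog t)).

Hypothesis code_size : forall t, size (code t) <= PC.
Hypothesis card_full : #|full mst T PC| <= #|{: k.-tuple (block B)}|.

Variable a0 : 'I_N.
Definition mst0 : mst := (a0, None, tmp0, ord0, [ffun=> block0 B], block0 B).

Definition mrecv (x : mst) (r : request N B) : mst :=
  (env r, tmp0, sk x, sold x, smask x).

Definition oscheme : scheme N B :=
  sl_scheme nxt code mst0 mrecv (fun x => tout (stmp x)) card_full.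

Lemma run_bridge b t x sv tr mem R g : REL mem sv ->
  Ex (@run_from N B oscheme (@Config N B oscheme
        (cstate (T := T) (PC := PC) card_full (red t) 0 x) sv tr) R)
    (fun y => g (map (pj b) y.1) y.2) =
  ARun b t mem R (fun z outs => g (map (pj b) tr ++ z) outs).
Proof.
elim: R t x sv tr mem g => [|r R IH] t x sv tr mem g HR.
  by rewrite /= Ex_ret cats0.
rewrite [run_from _ _]/= Ex_bind sl_iterationE; [|exact: red_le|exact: code_size].
rewrite Ex_bind {1}/code prog_red.
rewrite (@bridge b (prog t) _ (fun st' z => ARun b t.+1 st'.2 R
  (fun z' outs => g (z ++ z') (Some (tout st'.1) :: outs))) _ _ _ (tmp0, mem)) //.
- rewrite /=; apply: eq_aex => st' l; apply: eq_Sim => z; apply: eq_ARun => z' outs.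
  by rewrite catA.
- exact: prog_wf.
move=> x' sv' tr' st' Ereq Etmp R'; rewrite Ex_ret Ex_map /= nxt_red Etmp.
by rewrite (IH t.+1 x' sv' tr' st'.2 (fun z outs => g z (Some (tout st'.1) :: outs))).
Qed.

Lemma run_ARun b R g :
  Ex (@run N B oscheme R) (fun y => g (map (pj b) y.1) y.2) = ARun b 0 amem0 R g.
Proof.
have R0 : REL amem0 [ffun=> memory0 s B].
  by move=> x _; congr dec; apply/ffunP => i; rewrite !ffunE.
by have := run_bridge b 0 mst0 [::] R g R0; rewrite red0.
Qed.

Notation pmsg := (option (request s B) * {ffun server -> bool})%type.

Definition pview (b : server) (tr : seq pmsg) :=
  let tt := zip (iota 0 (size tr)) tr in
  (pmap (fun tm : nat * pmsg => omap (pair tm.1) tm.2.1) tt,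
   flatten [seq [seq (tm.1, i) | i <- enum server & (i != b) && tm.2.2 i]
           | tm : nat * pmsg <- tt]).

Lemma view_pj b (tr : seq msgs) : @view_of N B oscheme b tr = pview b (map (pj b) tr).
Proof.
rewrite /view_of /pview /timed size_map; move: (iota 0 _) => l.
elim: l tr => [|n l IH] [|x tr] //=; case: (IH tr) => -> ->.
congr pair; congr (_ ++ _); congr map; apply: eq_filter => i.
by rewrite ffunE.
Qed.

Lemma oscheme_secure :
  (forall b R0 R1 (g : _ -> rat), size R0 = size R1 ->
     ARun b 0 amem0 R0 (fun z _ => g z) = ARun b 0 amem0 R1 (fun z _ => g z)) ->
  perfectly_secure oscheme.
Proof.
move=> H b R0 R1 sR E; rewrite !PrE /view !Ex_map.
have HR R : Ex (run oscheme R) (fun a => ((E (@view_of N B oscheme b a.1))%:R)%R) =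
    ARun b 0 amem0 R (fun z _ => ((E (pview b z))%:R)%R).
  rewrite -(@run_ARun b R (fun z _ => ((E (pview b z))%:R)%R)).
  by apply: eq_Ex => y; rewrite view_pj.
by rewrite !HR; apply: H.
Qed.

Lemma oscheme_correct :
  (forall R, ARun ord0 0 amem0 R (fun _ outs => ((outs == map Some (ideal R))%:R)%R) = 1%R) ->
  perfectly_correct oscheme.
Proof.
move=> H R; rewrite /almost_surely PrE -[RHS](H R).
have <- := @run_ARun ord0 R (fun _ outs => ((outs == map Some (ideal R))%:R)%R).
by apply: eq_Ex.
Qed.

Lemma oscheme_bandwidth w :
  (forall n, \sum_(0 <= i < n) size (prog i) * ((3 * K + 2) * (3 * slot_blocks oscheme)) <= w * n) ->
  amortized_bandwidth_le oscheme w.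
Proof.
move=> Hw R; rewrite /almost_surely PrE.
pose tf (z : seq (option (request s B) * {ffun server -> bool})) :=
  \sum_(x <- z) #|[set i | x.2 i]| * slot_blocks oscheme.
have Etf (tr : seq msgs) : @transferred N B oscheme tr = tf (map (pj ord0) tr).
  rewrite /transferred /tf big_map; apply: eq_bigr => x _; congr (#|pred_of_set _| * _).
  by apply/setP => i; rewrite !inE ffunE.
rewrite (@eq_Ex _ _ _ (fun y => (fun z _ => ((tf z <= w * size R)%:R)%R) (map (pj ord0) y.1) y.2)); last first.
  by move=> y /=; rewrite Etf.
rewrite (@run_ARun ord0 R (fun z _ => ((tf z <= w * size R)%:R)%R)).
apply: ARun_size => z outs sz; suff -> : tf z <= w * size R by [].
apply: leq_trans (Hw (size R)); rewrite add0n in sz.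
(* Every slot is charged as if the client addressed all three servers, the silent slots included. *)
apply: (@leq_trans (size z * (3 * slot_blocks oscheme))); last first.
  by rewrite sz big_distrl /=; apply: leq_sum => i _; rewrite -!mulnA.
rewrite /tf; elim: {sz} z => [|x z IH]; first by rewrite big_nil.
rewrite big_cons /= mulSn leq_add // leq_mul2r; apply/orP; right.
by apply: leq_trans (max_card _) _; rewrite card_ord.
Qed.

End Concrete.

(** * Deterministic programs, Fisher-Yates shuffles *)

Definition loop A (n : nat) (body : nat -> seq A) : seq A :=
  flatten [seq body i | i <- iota 0 n].

Lemma loopS A n (body : nat -> seq A) : loop n.+1 body = loop n body ++ body n.
Proof. by rewrite /loop -addn1 iotaD map_cat flatten_cat /= cats0. Qed.

Lemma eq_loop A n (f g : nat -> seq A) : (forall i, i < n -> f i = g i) -> loop n f = loop n g.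
Proof.
elim: n => // n IH fg; rewrite !loopS IH ?fg // => i ilt; apply: fg; exact: ltnW.
Qed.

Lemma map_loop A A' (h : A -> A') n (body : nat -> seq A) :
  map h (loop n body) = loop n (fun i => map h (body i)).
Proof. by elim: n => // n IH; rewrite !loopS map_cat IH. Qed.

Section Det.
Variables (Env Tmp Wd : Type) (Cell : eqType).
Notation op := (op Env Tmp Wd Cell).
Notation astate := (astate Tmp Wd Cell).

Fixpoint exec0 (e : Env) (ops : seq op) (st : astate) : astate * seq Cell :=
  if ops is o :: ops' then
    let r := exec0 e ops' (ostep e o 0 st) in (r.1, ocell o e st.1 0 :: r.2)
  else (st, [::]).

Lemma exec0_cat e ops1 ops2 st :
  exec0 e (ops1 ++ ops2) st =
  let r1 := exec0 e ops1 st in let r2 := exec0 e ops2 r1.1 in (r2.1, r1.2 ++ r2.2).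
Proof.
elim: ops1 st => [|o ops1 IH] st /=; first by case: (exec0 e ops2 st).
by rewrite IH.
Qed.

Definition det (ops : seq op) : bool := all (fun o => oq o == 0) ops.

Lemma aex_det e ops st F : det ops -> aex e ops st F = F (exec0 e ops st).1 (exec0 e ops st).2.
Proof.
elim: ops st F => [|o ops IH] st F //= /andP[/eqP o0 dops].
by rewrite Ex_unif o0 (big_ord1) card_ord invr1 mul1r IH.
Qed.

(* Triples for programs that draw no number; [lk] lists the cells accessed. *)
Definition htr (e : Env) (P : Tmp -> (Cell -> Wd) -> Prop) ops lk
    (Q : Tmp -> (Cell -> Wd) -> Prop) : Prop :=
  forall t m, P t m -> (exec0 e ops (t, m)).2 = lk /\
    Q (exec0 e ops (t, m)).1.1 (exec0 e ops (t, m)).1.2.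

Lemma htr_nil e (P : Tmp -> (Cell -> Wd) -> Prop) : htr e P [::] [::] P.
Proof. by []. Qed.

Lemma htr_cat e P Q R o1 o2 l1 l2 :
  htr e P o1 l1 Q -> htr e Q o2 l2 R -> htr e P (o1 ++ o2) (l1 ++ l2) R.
Proof.
move=> H1 H2 t m Ptm; rewrite exec0_cat /=; have [E1 Q1] := H1 t m Ptm.
by move: E1 Q1; case: (exec0 e o1 (t, m)) => -[t1 m1] l /= -> /H2[-> ].
Qed.

Lemma htr_loop e (I : nat -> Tmp -> (Cell -> Wd) -> Prop) n body lk :
  (forall i, i < n -> htr e (I i) (body i) (lk i) (I i.+1)) ->
  htr e (I 0) (loop n body) (loop n lk) (I n).
Proof.
elim: n => [|n IH] H; first exact: htr_nil.
rewrite !loopS; apply: htr_cat (H n _) => //; apply: IH => i ilt; exact/H/ltnW.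
Qed.

Lemma htr_map e T (I : seq T -> Tmp -> (Cell -> Wd) -> Prop) (s : seq T) body lk :
  (forall s1 x s2, s = s1 ++ x :: s2 -> htr e (I s1) (body x) (lk x) (I (rcons s1 x))) ->
  htr e (I [::]) (flatten (map body s)) (flatten (map lk s)) (I s).
Proof.
move=> H; have gen s1 s2 : s = s1 ++ s2 ->
    htr e (I s1) (flatten (map body s2)) (flatten (map lk s2)) (I s).
  elim: s2 s1 => [|x s2 IH] s1 Es; first by rewrite Es cats0; exact: htr_nil.
  apply: htr_cat (H _ _ _ Es) (IH _ _); by rewrite cat_rcons.
exact: (gen [::]).
Qed.

End Det.

Section Swap.

Definition swp (i k x : nat) : nat := if x == i then k else if x == k then i else x.

Lemma swpK i k : involutive (swp i k).
Proof. by rewrite /swp => x; repeat (case: eqP => //=; try by move=> *; lia). Qed.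

Lemma swp_lt i k x n : i < n -> k < n -> (swp i k x < n) = (x < n).
Proof. by move=> *; rewrite /swp; repeat case: eqP => ?; lia. Qed.

(** Step [i] stores [i] at position [k] and moves the former entry [k] to position [i]. As [f i = i]
    beforehand, this is the composition of [f] with a transposition. *)
Fixpoint fyx (f : nat -> nat) i (ks : seq nat) : nat -> nat :=
  if ks is k :: ks' then fyx (f \o swp i k) i.+1 ks' else f.

(* Contents of the array produced by the inside-out shuffle with draws [ks]. *)
Definition fy ks := fyx id 0 ks.

Fixpoint fyix (g : nat -> nat) i (ks : seq nat) : nat -> nat :=
  if ks is k :: ks' then fyix (swp i k \o g) i.+1 ks' else g.

Definition fyi ks := fyix id 0 ks.

Lemma fyxK f g i ks : cancel f g -> cancel (fyx f i ks) (fyix g i ks).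
Proof.
elim: ks f g i => //= k ks IH f g i fg; apply: IH => x /=.
by rewrite fg swpK.
Qed.

Lemma fyixK f g i ks : cancel g f -> cancel (fyix g i ks) (fyx f i ks).
Proof.
elim: ks f g i => //= k ks IH f g i fg; apply: IH => x /=.
by rewrite swpK fg.
Qed.

Lemma fyK ks : cancel (fy ks) (fyi ks).
Proof. exact: fyxK. Qed.
Lemma fyiK ks : cancel (fyi ks) (fy ks).
Proof. exact: fyixK. Qed.

(* Draws [k_i <= i, ..., k_(i+n-1) <= i+n-1]. *)
Fixpoint ftp i n : seq (seq nat) :=
  if n is n'.+1 then [seq k :: ks | k <- iota 0 i.+1, ks <- ftp i.+1 n'] else [:: [::]].

Lemma ftpP i n ks :
  reflect (size ks = n /\ forall x, x < n -> nth 0 ks x <= i + x) (ks \in ftp i n).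
Proof.
elim: n i ks => [|n IH] i ks.
  rewrite inE; apply: (iffP eqP) => [-> //|[]]; by case: ks.
have -> : ftp i n.+1 = [seq k :: ks | k <- iota 0 i.+1, ks <- ftp i.+1 n] by [].
apply: (iffP allpairsP) => [[[k ks'] [ki /IH[sk Hk] ->]]|].
  rewrite mem_iota [k in (k < _)]/= in ki; rewrite /= in sk Hk *; split=> [|[|x] ltx] /=; rewrite ?sk //; first by lia.
  by have := Hk x ltx; lia.
case: ks => [[]//|k ks] [[sk] Hk]; exists (k, ks); split=> //.
  by rewrite mem_iota; have := Hk 0 isT; rewrite /=; lia.
by apply/IH; split=> // x xn; have := Hk x.+1 xn; rewrite /=; lia.
Qed.

Lemma ftp_uniq i n : uniq (ftp i n).
Proof.
elim: n i => // n IH i.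
have -> : ftp i n.+1 = [seq k :: ks | k <- iota 0 i.+1, ks <- ftp i.+1 n] by [].
apply: allpairs_uniq; rewrite ?iota_uniq ?IH //.
by move=> [k ks] [k' ks'] _ _ [-> ->].
Qed.

Lemma fyx_lt f i n ks x N : ks \in ftp i n -> i + n <= N -> (forall y, (f y < N) = (y < N)) ->
  (fyx f i ks x < N) = (x < N).
Proof.
elim: n i ks f x => [|n IH] i ks f x /ftpP[].
  by move/size0nil => -> _ _ H; rewrite /= H.
case: ks => // k ks [sk] Hk iN Hf /=; apply: (IH i.+1) => //.
- apply/ftpP; split=> // y yn; have := Hk y.+1 yn; rewrite /=; lia.
- by lia.
- move=> y; rewrite /= Hf swp_lt //; first by lia.
  by have := Hk 0 isT; rewrite /=; lia.
Qed.

Lemma fy_lt n ks x : ks \in ftp 0 n -> (fy ks x < n) = (x < n).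
Proof. by move=> H; apply: fyx_lt H _ _. Qed.

Lemma fyi_lt n ks x : ks \in ftp 0 n -> (fyi ks x < n) = (x < n).
Proof. by move=> H; rewrite -(fy_lt _ H) fyiK. Qed.

Lemma fyx_rcons f i ks k x : fyx f i (rcons ks k) x = fyx f i ks (swp (i + size ks) k x).
Proof.
elim: ks f i => [|k' ks IH] f i /=; first by rewrite addn0.
by rewrite IH addSnnS.
Qed.

Lemma fy_rcons ks k x : fy (rcons ks k) x = fy ks (swp (size ks) k x).
Proof. exact: fyx_rcons. Qed.

Lemma ftp_rcons n ks k : (rcons ks k \in ftp 0 n.+1) = (ks \in ftp 0 n) && (k <= n).
Proof.
apply/ftpP/andP => [[]|[/ftpP[sk Hk] kn]].
  rewrite size_rcons => -[sk] Hk; split.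
    apply/ftpP; split=> // x xn; have := Hk x (leqW xn).
    by rewrite nth_rcons sk xn.
  by have := Hk n (leqnn _); rewrite nth_rcons sk ltnn eqxx.
rewrite size_rcons sk; split=> // x; rewrite nth_rcons sk ltnS leq_eqVlt.
by move=> /orP[/eqP ->|xn]; rewrite ?ltnn ?eqxx // xn Hk.
Qed.

Lemma fy_id n ks x : ks \in ftp 0 n -> n <= x -> fy ks x = x.
Proof.
elim: n ks => [|n IH] ks; first by move/ftpP => [/size0nil -> _].
case/lastP: ks => [/ftpP[]//|ks k]; rewrite ftp_rcons => /andP[H kn] nx.
have sk : size ks = n by case/ftpP: H.
rewrite fy_rcons sk /swp !ifF ?(IH ks) //; try lia.
Qed.

Lemma fy_inj n ks ks' : ks \in ftp 0 n -> ks' \in ftp 0 n ->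
  (forall x, x < n -> fy ks x = fy ks' x) -> ks = ks'.
Proof.
elim: n ks ks' => [|n IH] ks ks'.
  by move=> /ftpP[/size0nil -> _] /ftpP[/size0nil -> _].
case/lastP: ks => [/ftpP[]//|ks k]; case/lastP: ks' => [_ /ftpP[]//|ks' k'].
rewrite !ftp_rcons => /andP[H kn] /andP[H' kn'] Ef.
have sk : size ks = n by case/ftpP: H.
have sk' : size ks' = n by case/ftpP: H'.
have Ef' x : x < n.+1 -> fy ks (swp n k x) = fy ks' (swp n k' x).
  by move=> /Ef; rewrite !fy_rcons sk sk'.
(* The last draw is the position at which the largest value [n] ends up, so it can be read off the
   permutation. *)
have Ek : k = k'.
  have := Ef' k kn; have -> : swp n k k = n by rewrite /swp eqxx; case: eqP.
  rewrite (fy_id H) // => E; have [//|/eqP kk'] := eqVneq k k'.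
  have : fy ks' (swp n k' k) < n.
    rewrite (fy_lt _ H') /swp; do 2?case: eqP => ?; lia.
  by rewrite -E ltnn.
rewrite -Ek in Ef' *; congr rcons; apply: IH => // x xn.
have := Ef' (swp n k x); rewrite swpK; apply; rewrite swp_lt //; lia.
Qed.

(** With [fy_inj], draw sequences correspond exactly to permutations, so a permutation of names can
    be turned into a change of the draws. The last draw has to be the preimage of [n]; composing
    with the transposition leaves a permutation of the first [n] items. *)
Lemma fy_surj n f : (forall x, x < n -> f x < n) ->
  (forall x y, x < n -> y < n -> f x = f y -> x = y) ->
  exists2 ks, ks \in ftp 0 n & forall x, x < n -> fy ks x = f x.
Proof.
elim: n f => [|n IH] f fn finj; first by exists [::].
have [k kn fk] : exists2 k, k < n.+1 & f k = n.
  have mp : size (map f (iota 0 n.+1)) = size (iota 0 n.+1) by rewrite size_map.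
  have um : uniq (map f (iota 0 n.+1)).
    rewrite map_inj_in_uniq ?iota_uniq // => x y; rewrite !mem_iota; exact: finj.
  have sm : {subset map f (iota 0 n.+1) <= iota 0 n.+1}.
    by move=> y /mapP[x]; rewrite !mem_iota => xn ->; apply: fn.
  have [_ Ei] := uniq_min_size um sm (eq_leq (esym mp)).
  have := Ei n; rewrite mem_iota ltnSn => /mapP[k]; rewrite mem_iota => kn E.
  by exists k.
have [||ks Hks Eks] := IH (f \o swp n k).
- move=> x xn /=; rewrite ltn_neqAle -ltnS fn ?swp_lt //; try lia; rewrite andbT.
  apply/eqP => E; have := finj (swp n k x) k _ kn; rewrite swp_lt // E fk.
  move=> /(_ (leqW xn) erefl)/(congr1 (swp n k)); rewrite swpK /swp eqxx.
  by case: eqP; lia.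
- move=> x y xn yn /= /finj; rewrite !swp_lt //; try lia.
  by move=> /(_ (leqW xn) (leqW yn))/(can_inj (swpK n k)).
exists (rcons ks k); first by rewrite ftp_rcons Hks -ltnS.
have sk : size ks = n by case/ftpP: Hks.
move=> x xn; rewrite fy_rcons sk; have [yn|yn] := ltnP (swp n k x) n.
  by rewrite Eks //= swpK.
have Ey : swp n k x = n by apply/eqP; rewrite eqn_leq yn andbT -ltnS swp_lt.
by rewrite Ey (fy_id Hks) // -fk -[x](swpK n k) Ey /swp eqxx.
Qed.

End Swap.

(** * Coupling of shuffles *)

Section Coupling.

(** Each family is completed, in front of the names it misses, to an enumeration of all names below
    [n]; the permutation matches the two enumerations rank by rank. *)
Lemma name_perm r n (a a' : nat -> nat) :
  (forall k, k < r -> a k < n) -> (forall k, k < r -> a' k < n) ->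
  (forall k l, k < r -> l < r -> a k = a l -> k = l) ->
  (forall k l, k < r -> l < r -> a' k = a' l -> k = l) ->
  exists s : nat -> nat, [/\ forall x, x < n -> s x < n,
    forall x y, x < n -> y < n -> s x = s y -> x = y &
    forall k, k < r -> s (a k) = a' k].
Proof.
pose ext (f : nat -> nat) := map f (iota 0 r) ++ [seq x <- iota 0 n | x \notin map f (iota 0 r)].
have extP f : (forall k, k < r -> f k < n) -> (forall k l, k < r -> l < r -> f k = f l -> k = l) ->
    perm_eq (ext f) (iota 0 n).
  move=> fn finj; have uf : uniq (map f (iota 0 r)).
    by rewrite map_inj_in_uniq ?iota_uniq // => x y; rewrite !mem_iota /= !add0n; apply: finj.
  apply: uniq_perm; rewrite ?iota_uniq // ?cat_uniq ?uf ?filter_uniq ?iota_uniq ?andbT //=.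
    by apply/hasPn => x; rewrite mem_filter => /andP[].
  move=> x; rewrite mem_cat mem_filter orb_andr orbN /=.
  apply/orP/idP => [[/mapP[k]|//]|->]; last by right.
  by rewrite !mem_iota !add0n => /fn ? ->.
move=> an a'n ai a'i; have p := extP a an ai; have p' := extP a' a'n a'i.
have s1 : size (ext a) = n by rewrite (perm_size p) size_iota.
have s2 : size (ext a') = n by rewrite (perm_size p') size_iota.
have ma x : (x \in ext a) = (x < n) by rewrite (perm_mem p) mem_iota add0n.
have ma' x : (x \in ext a') = (x < n) by rewrite (perm_mem p') mem_iota add0n.
have ua' : uniq (ext a') by rewrite (perm_uniq p') iota_uniq.
exists (fun x => nth 0 (ext a') (index x (ext a))); split.
- by move=> x xn; rewrite -ma' mem_nth // s2 -[X in _ < X]s1 index_mem ma.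
- move=> x y xn yn /eqP; rewrite nth_uniq ?s2 -?[X in _ < X]s1 ?index_mem ?ma // => /eqP E.
  by rewrite -(@nth_index _ 0 x (ext a)) ?ma // E nth_index ?ma.
move=> k kr; have ki : k = nth 0 (iota 0 r) k by rewrite nth_iota.
have -> : index (a k) (ext a) = k.
  rewrite /ext index_cat map_f ?mem_iota //.
  have -> : a k = nth 0 (map a (iota 0 r)) k by rewrite (nth_map 0) ?size_iota // -ki.
  rewrite index_uniq ?size_map ?size_iota // map_inj_in_uniq ?iota_uniq //.
  by move=> x y; rewrite !mem_iota !add0n; apply: ai.
by rewrite /ext nth_cat size_map size_iota kr (nth_map 0) ?size_iota // -ki.
Qed.

Definition fy_of n (f : nat -> nat) : seq nat :=
  head [::] [seq ks <- ftp 0 n | all (fun x => fy ks x == f x) (iota 0 n)].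

Lemma fy_ofP n f : (forall x, x < n -> f x < n) ->
  (forall x y, x < n -> y < n -> f x = f y -> x = y) ->
  fy_of n f \in ftp 0 n /\ forall x, x < n -> fy (fy_of n f) x = f x.
Proof.
move=> fn fi; have [ks Hks Ef] := fy_surj fn fi; rewrite /fy_of.
set l := filter _ _; have : ks \in l.
  by rewrite mem_filter Hks andbT; apply/allP => x; rewrite mem_iota add0n => /Ef ->.
case El : l => [//|k0 l'] _ /=; have : k0 \in l by rewrite El mem_head.
rewrite mem_filter => /andP[/allP Ha ->]; split=> // x xn; apply/eqP/Ha.
by rewrite mem_iota.
Qed.

Notation tapes := (seq nat * seq nat)%type.

(* Position of the entry named [i] in an array shuffled with [t]. *)
Definition posn (t : tapes) (i : nat) : nat := fyi t.2 (fyi t.1 i).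

Definition tok n (t : tapes) := (t.1 \in ftp 0 n) && (t.2 \in ftp 0 n).

(* What server [b] knows of the two shuffles is the same for [t] and [t'], and
   the entries [a k] are found at the same positions. *)
Definition tsim (b : nat) r (a a' : nat -> nat) (t t' : tapes) : Prop :=
  [/\ b <> 0 -> t.1 = t'.1, b <> 1 -> t.2 = t'.2 &
      b <> 2 -> forall k, k < r -> posn t (a k) = posn t' (a' k)].

Lemma posn_lt n t i : tok n t -> (posn t i < n) = (i < n).
Proof. by case/andP => t1 t2; rewrite /posn (fyi_lt _ t2) (fyi_lt _ t1). Qed.

Lemma posnK t : cancel (posn t) (fun p => fy t.1 (fy t.2 p)).
Proof. by move=> i; rewrite /posn fyiK fyiK. Qed.

Lemma posn_inj t : injective (posn t).
Proof. exact: can_inj (posnK t). Qed.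

(* The shuffle that [b] does not see absorbs the permutation taking the names
   [a] to the names [a']. *)
Lemma tape_coupling b r n (a a' : nat -> nat) : b < 3 ->
  (forall k, k < r -> a k < n) -> (forall k, k < r -> a' k < n) ->
  (forall k l, k < r -> l < r -> a k = a l -> k = l) ->
  (forall k l, k < r -> l < r -> a' k = a' l -> k = l) ->
  exists h : tapes -> tapes,
    [/\ forall t, tok n t -> tok n (h t),
        forall t t', tok n t -> tok n t' -> h t = h t' -> t = t' &
        forall t, tok n t -> tsim b r a a' t (h t)].
Proof.
move=> b3 an a'n ai a'i; have [s [sn si sa]] := name_perm an a'n ai a'i.
case: b b3 => [|[|[|]]] // _.
(* Server 0 does not see the first shuffle: composing it with [s] leaves [a' k] where [a k] was. *)
- pose h1 (t : tapes) := fy_of n (s \o fy t.1).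
  have Hh t : tok n t -> h1 t \in ftp 0 n /\ forall x, x < n -> fy (h1 t) x = s (fy t.1 x).
    case/andP => t1 _; apply: fy_ofP => x; first by move=> xn; apply: sn; rewrite (fy_lt _ t1).
    by move=> y xn yn /= /si; rewrite !(fy_lt _ t1) => /(_ xn yn)/(can_inj (fyK t.1)).
  exists (fun t => (h1 t, t.2)); split.
  + by move=> t Ht; rewrite /tok /= (Hh t Ht).1; case/andP: Ht.
  + move=> [t1 t2] [t1' t2'] Ht Ht' [E ->]; congr pair; case/andP: (Ht) => tt _.
    case/andP: (Ht') => tt' _; apply: (fy_inj tt tt') => x xn.
    apply: si; rewrite ?(fy_lt _ tt) ?(fy_lt _ tt') //.
    by rewrite -(Hh (t1, t2) Ht).2 // E (Hh (t1', t2') Ht').2.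
  + move=> t Ht; split=> // _ k kr; rewrite /posn /=; congr fyi.
    case/andP: (Ht) => t1 _; apply: (can_inj (fyK (h1 t))).
    by rewrite (Hh t Ht).2 ?(fyi_lt _ t1) ?an // !fyiK sa.
(* Server 1 sees the first shuffle, so [s] is conjugated by it and absorbed by the second one. *)
- pose h2 (t : tapes) := fy_of n (fun p => fyi t.1 (s (fy t.1 (fy t.2 p)))).
  have Hh t : tok n t -> h2 t \in ftp 0 n /\
      forall p, p < n -> fy (h2 t) p = fyi t.1 (s (fy t.1 (fy t.2 p))).
    case/andP => t1 t2; apply: fy_ofP => x.
      by move=> xn; rewrite (fyi_lt _ t1); apply: sn; rewrite (fy_lt _ t1) (fy_lt _ t2).
    move=> y xn yn /(can_inj (fyiK t.1))/si.
    rewrite !(fy_lt _ t1) !(fy_lt _ t2) => /(_ xn yn).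
    by move=> /(can_inj (fyK t.1))/(can_inj (fyK t.2)).
  exists (fun t => (t.1, h2 t)); split.
  + by move=> t Ht; rewrite /tok /= (Hh t Ht).1; case/andP: Ht => ->.
  + move=> [t1 t2] [t1' t2'] Ht Ht' [Et E]; rewrite -Et in Ht' E *; congr pair.
    case/andP: (Ht) => tt0 tt; case/andP: (Ht') => _ tt'; apply: (fy_inj tt tt') => x xn.
    apply: (can_inj (fyK t1)); apply: si; rewrite ?(fy_lt _ tt0) ?(fy_lt _ tt) ?(fy_lt _ tt') //.
    apply: (can_inj (fyiK t1)).
    by rewrite -(Hh (t1, t2) Ht).2 // E (Hh (t1, t2') Ht').2.
  + move=> t Ht; split=> // _ k kr; rewrite /posn /=; case/andP: (Ht) => t1 t2.
    apply: (can_inj (fyK (h2 t))).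
    by rewrite (Hh t Ht).2 ?(fyi_lt _ t2) ?(fyi_lt _ t1) ?an // !fyiK sa.
(* Server 2 sees both shuffles but no probe, so the tapes stay as they are. *)
- by exists id; split=> // t _; split.
Qed.

Definition tpairs n : seq tapes := [seq (t1, t2) | t1 <- ftp 0 n, t2 <- ftp 0 n].

Lemma tpairsP n t : (t \in tpairs n) = tok n t.
Proof.
apply/allpairsP/andP => [[[t1 t2] [? ? ->]] //|[? ?]].
by exists t; split=> //; exact: surjective_pairing.
Qed.

Lemma tpairs_sum n (h : tapes -> tapes) (f g : tapes -> rat) :
  (forall t, tok n t -> tok n (h t)) ->
  (forall t t', tok n t -> tok n t' -> h t = h t' -> t = t') ->
  (forall t, tok n t -> f t = g (h t)) ->
  (\sum_(t <- tpairs n) f t = \sum_(t <- tpairs n) g t)%R.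
Proof.
move=> hok hi fg; have un : uniq (tpairs n).
  by apply: allpairs_uniq; rewrite ?ftp_uniq // => -[? ?] [? ?] _ _ [-> ->].
have uh : uniq (map h (tpairs n)).
  by rewrite map_inj_in_uniq // => t t'; rewrite !tpairsP; apply: hi.
have sub : {subset map h (tpairs n) <= tpairs n}.
  by move=> t /mapP[t']; rewrite tpairsP => Ht' ->; rewrite tpairsP; apply: hok.
have [_ Ei] := uniq_min_size uh sub (eq_leq (esym (size_map h (tpairs n)))).
transitivity (\sum_(t <- map h (tpairs n)) g t)%R; last exact: perm_big (uniq_perm uh un Ei).
rewrite big_map.
by apply: eq_big_seq => t; rewrite tpairsP => /fg.
Qed.

End Coupling.

(** * Levels, trie and names *)

Section Levels.

Variable D : nat.
Notation E := D.+1.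

(* The accesses are cut into aligned windows of length [2 ^ j]; access [s] lies in
   the window number [q j s]. *)
Definition q (j s : nat) : nat := s %/ 2 ^ j.

Lemma q0 s : q 0 s = s. Proof. by rewrite /q expn0 divn1. Qed.
Lemma qS j s : q j.+1 s = q j s %/ 2.
Proof. by rewrite /q expnSr divnMA. Qed.
Lemma q_le j s t : s <= t -> q j s <= q j t.
Proof. exact: leq_div2r. Qed.
Lemma q_up i j s t : i <= j -> q i s = q i t -> q j s = q j t.
Proof. by move=> /subnK <-; elim: (j - i) => // n IH /IH E; rewrite addSn !qS E. Qed.
Lemma q_geq j s a : (a <= q j s) = (a * 2 ^ j <= s).
Proof. by rewrite /q leq_divRL ?expn_gt0. Qed.
Lemma q_lt j s a : (q j s < a) = (s < a * 2 ^ j).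
Proof. by rewrite /q ltn_divLR ?expn_gt0. Qed.
Lemma qM j a i : i < 2 ^ j -> q j (a * 2 ^ j + i) = a.
Proof. by move=> ij; rewrite /q divnMDl ?expn_gt0 // divn_small ?addn0. Qed.
Lemma q_eq j s : s = q j s * 2 ^ j + s %% 2 ^ j.
Proof. exact: divn_eq. Qed.
Lemma mod_lt j s : s %% 2 ^ j < 2 ^ j.
Proof. by rewrite ltn_mod expn_gt0. Qed.

(* Just before access [t], the nodes created by access [s] are stored at level
   [lv s t], in the structure of the window [q (lv s t) s]. *)
Definition lv (s t : nat) : nat := find (fun j => q j.+1 s == q j.+1 t) (iota 0 E).

Lemma lv_le s t : lv s t <= E.
Proof. by rewrite -[X in _ <= X](size_iota 0 E) find_size. Qed.

Lemma lv_hi s t : lv s t < E -> q (lv s t).+1 s = q (lv s t).+1 t.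
Proof.
move=> lt; have Hh : has (fun j => q j.+1 s == q j.+1 t) (iota 0 E).
  by rewrite has_find size_iota.
by have /eqP := nth_find 0 Hh; rewrite nth_iota -?/(lv s t).
Qed.

Lemma lv_lo s t : s < t -> q (lv s t) s <> q (lv s t) t.
Proof.
move=> st; case El : (lv s t) => [|l]; first by rewrite !q0; lia.
apply/eqP; have ltl : l < lv s t by rewrite El.
have := before_find 0 ltl; rewrite nth_iota ?add0n ?(leq_trans ltl) ?lv_le //.
by move=> ->.
Qed.

Lemma lv_eq s t j : s < t -> j <= E -> q j s <> q j t -> (j < E -> q j.+1 s = q j.+1 t) ->
  lv s t = j.
Proof.
move=> st jE lo hi; have := lv_lo st; have := @lv_hi s t; have := lv_le s t.
move: (lv s t) => l lE lhi llo; have [lj|jl|//] := ltngtP l j.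
  by case: lo; apply: q_up (lhi _); rewrite ?(leq_trans lj).
by case: llo; apply: q_up (hi _); rewrite ?(leq_trans jl).
Qed.

(** The levels behave like a binary counter: below the top, level [j] is occupied when the binary
    digit [j] of [t] is 1. The top level is occupied from its first complete window on. *)
Definition active j t := ((j < E) && odd (q j t)) || ((j == E) && (2 ^ E <= t)).
(* Older nodes are dead: the sweeps have copied whatever is still reachable. *)
Definition lo t := 2 ^ E * (q E t).-1.

Lemma lo_le t s : (lo t <= s) = ((q E t).-1 <= q E s).
Proof. by rewrite q_geq mulnC. Qed.

Lemma active_gt0 j t : active j t -> 0 < q j t.
Proof.
case/orP=> [/andP[_]|/andP[/eqP -> tE]]; last by rewrite q_geq mul1n.
by case: (q j t).
Qed.

Lemma lv_active s t : s < t -> lo t <= s ->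
  active (lv s t) t /\ (q (lv s t) s).+1 = q (lv s t) t.
Proof.
move=> st; rewrite lo_le => al; have lE := lv_le s t; have Hlo := lv_lo st.
have Hhi := @lv_hi s t; have Hle := q_le (lv s t) (ltnW st).
move: (lv s t) lE Hlo Hhi Hle => l; rewrite leq_eqVlt => /orP[/eqP ->|lE] Hlo Hhi Hle.
  split; last by lia.
  by rewrite /active ltnn eqxx /= -[2 ^ _]mul1n -q_geq; lia.
have := Hhi lE; rewrite /active lE !qS; move: Hlo Hle; move: (q l s) (q l t) => a b *.
by split; lia.
Qed.

Lemma lv_iff s t j : s < t -> lo t <= s -> active j t ->
  (q j s == (q j t).-1) = (lv s t == j).
Proof.
move=> st al act; apply/eqP/eqP => [Ej|<-]; last by have [_ <-] := lv_active st al.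
have g0 := active_gt0 act; apply: lv_eq => //; try by lia.
  by case/orP: act => /andP[]; [move/ltnW | move/eqP ->].
move=> jE; move: act; rewrite /active jE /= => /orP[od|]; last by case: eqP => //; lia.
by rewrite !qS Ej; lia.
Qed.

Lemma active_parity j t : active j t -> j < E -> ~~ odd (q j t).-1.
Proof.
by move=> act jE; have := active_gt0 act; case/orP: act => /andP[]; [|move/eqP]; lia.
Qed.

(* Access [t] ends with the merge of the levels below [lvl t.+1] into it. *)
Definition lvl (t : nat) : nat := find (fun j => ~~ (2 ^ j.+1 %| t)) (iota 0 E).

Lemma lvl_le t : lvl t <= E.
Proof. by rewrite -[X in _ <= X](size_iota 0 E) find_size. Qed.

Lemma lvl_dvd t j : j <= lvl t -> 2 ^ j %| t.
Proof.
case: j => [|j] jl; first by rewrite expn0 dvd1n.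
have := before_find 0 jl; rewrite nth_iota ?(leq_trans jl) ?lvl_le //.
by move/negbT; rewrite negbK.
Qed.

Lemma lvl_ndvd t : lvl t < E -> ~~ (2 ^ (lvl t).+1 %| t).
Proof.
move=> lt; have Hh : has (fun j => ~~ (2 ^ j.+1 %| t)) (iota 0 E).
  by rewrite has_find size_iota.
by have := nth_find 0 Hh; rewrite nth_iota -?/(lvl t).
Qed.

Lemma lvl_q t j : j <= lvl t.+1 -> q j t.+1 = (q j t).+1.
Proof. by move=> /lvl_dvd H; rewrite /q divnS ?expn_gt0 // H. Qed.

Lemma lvl_qhi t j : lvl t.+1 < j -> lvl t.+1 < E -> q j t.+1 = q j t.
Proof.
move=> lj lE; rewrite /q divnS ?expn_gt0 //.
have -> // : (2 ^ j %| t.+1) = false.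
apply: contraNF (lvl_ndvd lE) => H; apply: dvdn_trans H.
by rewrite dvdn_exp2l.
Qed.

Lemma lvl_mul t j : j <= lvl t -> t = q j t * 2 ^ j.
Proof. by move=> /lvl_dvd H; rewrite divnK. Qed.

Lemma lvl_odd t : lvl t < E -> odd (q (lvl t) t).
Proof.
move=> lE; have := lvl_ndvd lE; rewrite {2}(@lvl_mul t (lvl t)) // expnS dvdn_pmul2r ?expn_gt0 //.
by rewrite dvdn2 negbK.
Qed.

Lemma win_q t j s : j <= lvl t -> s < t -> t - 2 ^ j <= s -> (q j s).+1 = q j t.
Proof.
move=> jl st ts; have Et := lvl_mul jl; apply/eqP; rewrite eqn_leq q_lt -Et st /=.
have g0 : 0 < q j t by rewrite lt0n; apply/eqP => E0; move: st; rewrite Et E0.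
by rewrite -(prednK g0) ltnS q_geq -subn1 mulnBl -Et mul1n.
Qed.

Lemma win_out t j s : j <= lvl t -> s < t - 2 ^ j -> (q j s).+1 < q j t.
Proof.
move=> jl ts; have Et := lvl_mul jl; rewrite -ltn_predRL q_lt -subn1 mulnBl -Et mul1n //.
Qed.

(** The carry of the counter: the new nodes and the levels emptied by the carry cover exactly the
    last [2 ^ lvl t.+1] accesses, and no other recent node moves. *)
Lemma lv_next t s : s < t.+1 -> lo t.+1 <= s ->
  lv s t.+1 = if t.+1 - 2 ^ lvl t.+1 <= s then lvl t.+1 else lv s t.
Proof.
move=> st al; have JE := lvl_le t.+1; set J := lvl t.+1 in JE *.
case: leqP => ts.
  have Eq := win_q (leqnn J : J <= lvl t.+1) st ts; apply: lv_eq => //; first by lia.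
  by move=> lE; have := lvl_odd lE; rewrite -/J !qS -Eq; lia.
have Eq := win_out (leqnn J : J <= lvl t.+1) ts; have EJ := @lvl_q t J (leqnn _).
have stt : s < t by have := expn_gt0 2 J; lia.
have JltE : J < E.
  rewrite ltn_neqAle JE andbT; apply/eqP => JEe.
  by move: al; rewrite lo_le -JEe; lia.
have lJ : J <= lv s t.
  rewrite leqNgt; apply/negP => ltJ.
  have /(q_up ltJ) := lv_hi (ltn_trans ltJ JltE); lia.
have lE := lv_le s t; have Hlo := lv_lo stt; have Hhi := @lv_hi s t.
move: (lv s t) lJ lE Hlo Hhi => l; rewrite leq_eqVlt => /orP[/eqP <-|lJ] lE Hlo Hhi.
  by have := Hhi JltE; have := lvl_odd JltE; rewrite -/J !qS; lia.
apply: lv_eq => //; first by rewrite lvl_qhi.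
by move=> ltE; rewrite lvl_qhi ?Hhi // ltnW.
Qed.

Lemma lo_next t : lo t <= lo t.+1.
Proof. by rewrite leq_mul2l -!subn1 leq_sub2r ?orbT // q_le. Qed.

Lemma lv_merge t j s : j < lvl t.+1 -> t.+1 - 2 ^ j.+1 <= s -> s < t.+1 - 2 ^ j -> lv s t = j.
Proof.
move=> jl s1 s2; have jE := leq_trans jl (lvl_le _).
have := win_out (ltnW jl) s2; have := @lvl_q t j (ltnW jl) => E1 E2.
have stt : s < t by have := expn_gt0 2 j; lia.
have Es := win_q jl (leqW stt : s < t.+1) s1; have Et := @lvl_q t j.+1 jl.
apply: lv_eq => //; [by exact: ltnW | by lia | by lia].
Qed.

(** The window in place at level [j] and the one about to be built are consecutive, so their
    parities differ. Two buffers per level are thus enough. *)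
Lemma buf_free t j s : j <= lvl t.+1 -> s < t -> lo t <= s -> lv s t = j ->
  odd (q j s) <> odd (q j t.+1).-1.
Proof.
move=> jl st al Ej; have [act Eq] := lv_active st al; rewrite Ej in act Eq.
have E1 := lvl_q jl; rewrite E1 /= -Eq /=; by case: (odd _).
Qed.

End Levels.

(** * The trie, and the freshness of the names looked up in a structure *)

Section Trie.

Variables (D : nat) (v : nat -> nat).
Notation E := D.+1.

(* The tree is the binary trie on the numbers [v s], lowest bit first; access [s]
   recreates the nodes of the path [v s], one for each depth. *)
Definition dir (d x : nat) : bool := odd (q d x).
Definition pre (d x : nat) : seq bool := mkseq (dir^~ x) d.

Fixpoint lst (t : nat) (P : pred nat) : option nat :=
  if t is t'.+1 then if P (v t') then Some t' else lst t' P else None.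

Lemma lstP t (P : pred nat) s : lst t P = Some s <->
  [/\ s < t, P (v s) & forall s', s < s' -> s' < t -> ~~ P (v s')].
Proof.
elim: t => [|t IH] /=; first by split=> // -[].
case Pt: (P (v t)).
  split=> [[<-]|[st Ps H]]; first by split=> // s' ? ?; lia.
  have [ts|ts|-> //] := ltngtP s t; last by lia.
  by have := H t ts (ltnSn t); rewrite Pt.
rewrite IH; split=> -[st Ps H]; split=> //; try by lia.
- move=> s' ss' s't; have [->|ne] := eqVneq s' t; [by rewrite Pt | apply: H => //; lia].
- by have [ets|] := eqVneq s t; [rewrite -ets Ps in Pt | lia].
- by move=> s' ss' s't; apply: H => //; lia.
Qed.

Lemma lst_None t (P : pred nat) s : lst t P = None -> s < t -> P (v s) = false.
Proof.
elim: t => //= t IH; case Pt: (P (v t)) => // /IH H; rewrite ltnS leq_eqVlt.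
by case/orP => [/eqP ->|/H].
Qed.

Lemma lst_ge t (P : pred nat) s : s < t -> P (v s) -> exists2 s', lst t P = Some s' & s <= s'.
Proof.
elim: t => //= t IH st Ps; case Pt: (P (v t)); first by exists t.
by apply: IH => //; have [ets|] := eqVneq s t; [rewrite -ets Ps in Pt | lia].
Qed.

Lemma eq_lst t (P Q : pred nat) : P =1 Q -> lst t P = lst t Q.
Proof. by move=> PQ; elim: t => //= t ->; rewrite PQ. Qed.

Definition pn d x y := pre d y == pre d x.
Definition ps d x c y := (pre d y == pre d x) && (dir d y == c).

(* The last access that created the node of depth [d] on the path [x], or its child
   in the direction [c]: nodes are named by creation times. *)
Definition lastn t d x := lst t (pn d x).
Definition slotn t d x c := lst t (ps d x c).

Lemma preS d x y : (pre d.+1 x == pre d.+1 y) = (pre d x == pre d y) && (dir d x == dir d y).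
Proof.
rewrite /pre /mkseq -addn1 iotaD !map_cat /= !cats1 eqseq_rcons; congr (_ && _).
Qed.

Lemma slot_child t d x : slotn t d x (dir d x) = lastn t d.+1 x.
Proof. by apply: eq_lst => y; rewrite /ps /pn preS. Qed.

Lemma eq_lastn t d x y : pre d x = pre d y -> lastn t d x = lastn t d y.
Proof. by move=> xy; apply: eq_lst => z; rewrite /pn xy. Qed.

Lemma eq_slotn t d x y c : pre d x = pre d y -> slotn t d x c = slotn t d y c.
Proof. by move=> xy; apply: eq_lst => z; rewrite /ps xy. Qed.

Lemma lastn_pre t d x s : lastn t d x = Some s -> pre d (v s) = pre d x.
Proof. by case/lstP => _ /eqP. Qed.

Lemma slotn_pre t d x c s : slotn t d x c = Some s -> pre d (v s) = pre d x /\ dir d (v s) = c.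
Proof. by case/lstP => _ /andP[/eqP ? /eqP]. Qed.

Lemma slotn_lastn t d x c s : slotn t d x c = Some s -> lastn t d.+1 (v s) = Some s.
Proof.
move=> H; have [Ep Ed] := slotn_pre H; rewrite -slot_child Ed -H.
exact: eq_slotn.
Qed.

(** An access that creates a node also recreates all its ancestors. Consequently a node older than a
    merged window has no child in it, and its pointers survive the merge. *)
Lemma slotn_le t d x c s s' : slotn t d x c = Some s -> lastn t d x = Some s' -> s <= s'.
Proof.
case/lstP => st /andP[Hs _] _ /lstP[s't _ H]; rewrite leqNgt; apply/negP => lt.
by have := H s lt st; rewrite /pn Hs.
Qed.

Lemma lastn_None_slotn t d x c : lastn t d x = None -> slotn t d x c = None.
Proof.
move=> H; case E: (slotn t d x c) => [s|//]; case/lstP: E => st /andP[Hs _] _.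
by have := lst_None H st; rewrite /pn Hs.
Qed.

(* Names looked up in the window [w] of level [j] at depth [d]: first during its
   life, then, when it is merged, once for each slot of the parent entries. *)
Definition hitlife d j w k : option nat :=
  let t := w.+1 * 2 ^ j + k in
  if (j < E) && odd w then None
  else if lastn t d (v t) is Some s then (if q j s == w then Some s else None) else None.

(** The merge lookup number [k] serves the slot [odd k] of the entry number [k %/ 2] of the merged
    window. The test on [lastn] discards a superseded parent, whose word has been erased. Odd
    windows below the top have merge lookups only, as they are merged as soon as they are
    complete. *)
Definition hitren d j w k : option nat :=
  let sp := q 1 w * 2 ^ j.+1 + q 1 k in
  let t := (q 1 w).+1 * 2 ^ j.+1 in
  if [&& j < E, 0 < d & lastn t d.-1 (v sp) == Some sp] then
    if slotn t d.-1 (v sp) (odd k) is Some s then (if q j s == w then Some s else None) else None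
  else None.

Definition hit d j w k : option nat :=
  if k < 2 ^ j then hitlife d j w k else hitren d j w (k - 2 ^ j).

Definition nm d j w k : nat :=
  if hit d j w k is Some s then s %% 2 ^ j else 2 ^ j + k.

Lemma hit_q d j w k s : hit d j w k = Some s -> q j s = w.
Proof.
rewrite /hit /hitlife /hitren; case: ltnP => _.
  case: ifP => // _; case: (lastn _ _ _) => // s'; case: eqP => // Ew [<-] //.
case: ifP => // _; case: (slotn _ _ _ _) => // s'; case: eqP => // Ew [<-] //.
Qed.

Lemma nm_lt d j w k : k < 5 * 2 ^ j -> nm d j w k < 6 * 2 ^ j.
Proof.
rewrite /nm; case: (hit _ _ _ _) => [s|] kj; last by lia.
by have := mod_lt j s; lia.
Qed.

(** The access of the first hit recreates the node, so [s] is no longer the last one at the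
    second. *)
Lemma life_fresh d j w k k' s : k < k' -> hitlife d j w k = Some s -> hitlife d j w k' = Some s -> False.
Proof.
rewrite /hitlife; case: ifP => // _ kk.
case E1: (lastn _ _ _) => [s1|//]; case: ifP => // _ [Es1]; subst s1.
case E2: (lastn _ _ _) => [s2|//]; case: ifP => // _ [Es2]; subst s2.
have [st1 _ _] := (lstP _ _ _).1 E1; have [_ _ H] := (lstP _ _ _).1 E2.
by have /negP := H _ st1 (ltac:(lia)); apply; rewrite /pn -(lastn_pre E1) (lastn_pre E2).
Qed.

(** The access of the ordinary hit creates a newer child in the same slot. It precedes the merge
    because [w] is even: the sibling window, during which [w] is in place, ends where the merged
    window ends. *)
Lemma life_ren d j w k k' s : k < 2 ^ j ->
  hitlife d j w k = Some s -> hitren d j w k' = Some s -> False.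
Proof.
case: d => [|d] kj; rewrite /hitlife /hitren ?andbF //=; case: (j < E) => //=; case: ifP => // ow.
case E1: (lastn _ _ _) => [s1|//]; case: ifP => // _ [Es1]; subst s1.
case: ifP => // _; case E2: (slotn _ _ _ _) => [s2|//]; case: ifP => // _ [Es2]; subst s2.
have [st1 _ _] := (lstP _ _ _).1 E1; have [_ _ H] := (lstP _ _ _).1 E2.
have [Ep Ed] := slotn_pre E2; move/eqP: (lastn_pre E1); rewrite preS => /andP[/eqP Ep' /eqP Ed'].
have lt : w.+1 * 2 ^ j + k < (q 1 w).+1 * 2 ^ j.+1.
  have : w = 2 * q 1 w by rewrite /q expn1; move/negbT: ow => ow; lia.
  by rewrite expnS; nia.
by have /negP := H _ st1 lt; apply; rewrite /ps -Ep' Ep -Ed' Ed !eqxx.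
Qed.

(** Both parents have the prefix of [s] and are live, so they are the same entry; the direction of
    [s] then determines the slot. *)
Lemma ren_fresh d j w k k' s : hitren d j w k = Some s -> hitren d j w k' = Some s -> k = k'.
Proof.
rewrite /hitren; case: (j < E) => //=; case: d => //= d.
case: eqP => // L1; case E1: (slotn _ _ _ _) => [s1|//]; case: ifP => // _ [Es1]; subst s1.
case: eqP => // L2; case E2: (slotn _ _ _ _) => [s2|//]; case: ifP => // _ [Es2]; subst s2.
have [Ep Ed] := slotn_pre E1; have [Ep' Ed'] := slotn_pre E2.
have [] : Some (q 1 w * 2 ^ j.+1 + q 1 k) = Some (q 1 w * 2 ^ j.+1 + q 1 k').
  by rewrite -L1 -L2; apply: eq_lastn; rewrite -Ep -Ep'.
rewrite /q !expn1; move: Ed'; rewrite Ed => Eo Ek; lia.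
Qed.

Lemma nm_inj d j w k l : k < 5 * 2 ^ j -> l < 5 * 2 ^ j ->
  nm d j w k = nm d j w l -> k = l.
Proof.
move=> kj lj; rewrite /nm.
case Ek: (hit d j w k) => [s|]; case El: (hit d j w l) => [s'|]; first last.
- by move/addnI.
- by have := mod_lt j s'; lia.
- by have := mod_lt j s; lia.
move=> Em; have Es : s = s'.
  by rewrite (q_eq j s) (q_eq j s') (hit_q Ek) (hit_q El) Em.
subst s'; move: Ek El; rewrite /hit; case: ltnP => k2; case: ltnP => l2 Hk Hl.
- have [kl|kl|//] := ltngtP k l; [by case: (life_fresh kl Hk Hl) | by case: (life_fresh kl Hl Hk)].
- by case: (life_ren k2 Hk Hl).
- by case: (life_ren l2 Hl Hk).
- have := ren_fresh Hk Hl; lia.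
Qed.

End Trie.

(** * Arrays *)

Section Blocks.

Variables (Env : Type) (D B : nat).
Notation E := D.+1.

(* A structure of level [j] holds [2 ^ j] nodes and [5 * 2 ^ j] dummies, one for
   each lookup made in its lifetime. *)
Definition nn (j : nat) : nat := 6 * 2 ^ j.
Definition Q : nat := nn E.
Definition ptr : finType := ('I_E.+1 * bool * 'I_Q.+1)%type.
Definition Wd : finType := (option ptr * option ptr * block B * 'I_Q.+1)%type.
Definition Tmp : finType := (option ptr * 'I_Q.+1 * Wd * block B)%type.

Definition arr : eqType := (nat * bool * nat * nat)%type.
Definition Cell : eqType := (arr * nat)%type.
Notation mem := (Cell -> Wd).
Notation op := (op Env Tmp Wd Cell).

(* Structure of parity [b], depth [d] and level [j]: with the shuffles [k1] and
   [k2] kept in [K1] and [K2], the entry of name [k1 (k2 p)] of [V] is entry [k2 p]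
   of [U] and entry [p] of [X]; [P] lists the positions in [X] of all names. [O]
   receives the answer to a request. *)
Definition K1 (b : bool) (d j : nat) : arr := (0, b, d, j).
Definition V (b : bool) (d j : nat) : arr := (1, b, d, j).
Definition P (b : bool) (d j : nat) : arr := (2, b, d, j).
Definition K2 (b : bool) (d j : nat) : arr := (3, b, d, j).
Definition U (b : bool) (d j : nat) : arr := (4, b, d, j).
Definition X (b : bool) (d j : nat) : arr := (5, b, d, j).
Definition O : arr := (6, false, 0, 0).

Definition tagA (A : arr) : nat := A.1.1.1.
Definition colA (A : arr) : server := inord (nth 0 [:: 0; 0; 0; 1; 1; 2; 2] (tagA A)).
Definition colf (c : Cell) : server := colA c.1.

Definition num (w : Wd) : nat := w.2.
Definition wnull : Wd := (None, None, block0 B, ord0).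
Definition wnum (n : nat) : Wd := (None, None, block0 B, inord n).

Lemma num_wnum n : n <= Q -> num (wnum n) = n.
Proof. by move=> nQ; rewrite /num /= inordK. Qed.

Definition tptr (t : Tmp) := t.1.1.1.
Definition tnum (t : Tmp) : nat := t.1.1.2.
Definition twd (t : Tmp) := t.1.2.
Definition tout (t : Tmp) := t.2.
Definition settnum (t : Tmp) (w : Wd) : Tmp := (tptr t, w.2, twd t, tout t).
Definition settwd (t : Tmp) (w : Wd) : Tmp := (t.1.1, w, tout t).

Definition mk (A : arr) (idx : Tmp -> nat) (val : Env -> Tmp -> Wd -> Wd)
    (f : Env -> Tmp -> Wd -> Tmp) : op :=
  @Op Env Tmp Wd Cell 0 (colA A) (fun _ t _ => (A, idx t)) (fun e t _ w => val e t w)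
    (fun e t _ w => f e t w).

Definition rd A i f := mk A (fun _ => i) (fun _ _ w => w) (fun _ t w => f t w).
Definition rdI A idx f := mk A idx (fun _ _ w => w) (fun _ t w => f t w).
Definition wr A idx val := mk A idx (fun _ t _ => val t) (fun _ t _ => t).

Lemma nn_gt0 j : 0 < nn j. Proof. by rewrite muln_gt0 expn_gt0. Qed.
Lemma nn_le j : j <= E -> nn j <= Q.
Proof. by move=> jE; rewrite leq_mul2l leq_exp2l. Qed.

(** The reductions modulo the array size, here and in [get], [look] and [ren], keep the addresses
    legal in every state, as [wfop] demands. In the states that occur they change nothing. *)
Definition put K S T n : seq op := loop n (fun p =>
  [:: rd K p settnum; rd S p settwd; wr T (fun t => tnum t %% n) twd]).
Definition get K S T n : seq op := loop n (fun p =>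
  [:: rd K p settnum; rdI S (fun t => tnum t %% n) settwd; wr T (fun _ => p) twd]).
Definition copy S o T o' n : seq op := loop n (fun i =>
  [:: rd S (o + i) settwd; wr T (fun _ => o' + i) twd]).
Definition fill T n : seq op := loop n (fun i => [:: wr T (fun _ => i) (fun _ => wnum i)]).

Definition lput (K S T : arr) f n : seq Cell := loop n (fun p => [:: (K, p); (S, p); (T, f p)]).
Definition lget (K S T : arr) f n : seq Cell := loop n (fun p => [:: (K, p); (S, f p); (T, p)]).
Definition lcopy (S : arr) o (T : arr) o' n : seq Cell := loop n (fun i => [:: (S, o + i); (T, o' + i)]).
Definition lfill (T : arr) n : seq Cell := loop n (fun i => [:: (T, i)]).

Lemma wbE (c c' : Cell) (m : mem) : (if c' == c then m c else m c') = m c'.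
Proof. by case: eqP => [->|]. Qed.

Section Moves.
Variables (e : Env) (t0 : Tmp) (m : mem).

Lemma put_exec (K S T : arr) n f g :
  (forall p, p < n -> num (m (K, p)) = f p) -> (forall x, (f x < n) = (x < n)) ->
  cancel f g -> cancel g f -> (S == T) = false -> (K == T) = false ->
  (exec0 e (put K S T n) (t0, m)).2 = lput K S T f n /\
  forall c, (exec0 e (put K S T n) (t0, m)).1.2 c =
    if (c.1 == T) && (c.2 < n) then m (S, g c.2) else m c.
Proof.
move=> Hf fl fg gf ST KT.
have gl x : (g x < n) = (x < n) by rewrite -fl gf.
pose I p (_ : Tmp) (m' : mem) :=
  forall c, m' c = if [&& c.1 == T, c.2 < n & g c.2 < p] then m (S, g c.2) else m c.
have H : htr e (I 0) (put K S T n) (lput K S T f n) (I n).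
  apply: htr_loop => p pn t m' Im; rewrite /= /tnum /settnum /=.
  have Ep : (m' (K, p)).2 %% n = f p.
    by rewrite Im /= KT /= -/(num _) Hf // modn_small // fl.
  rewrite !wbE Ep; split=> // -[A i]; rewrite !wbE xpair_eqE !Im /= ST /=.
  have [->|AT] //= := eqVneq A T.
  have [->|ne] := eqVneq i (f p); first by rewrite fl pn fg ltnS leqnn.
  rewrite [g i < p.+1]ltnS [g i <= p]leq_eqVlt (_ : (g i == p) = false) //.
  by apply/eqP => gi; move/eqP: ne; case; rewrite -gi gf.
case: (H t0 m) => [c|-> HI]; first by rewrite ltn0 !andbF.
split=> // c; rewrite HI gl; case: (c.1 == T) => //=; by case: (c.2 < n).
Qed.

Lemma get_exec (K S T : arr) n f :
  (forall p, p < n -> num (m (K, p)) = f p) -> (forall x, (f x < n) = (x < n)) ->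
  (S == T) = false -> (K == T) = false ->
  (exec0 e (get K S T n) (t0, m)).2 = lget K S T f n /\
  forall c, (exec0 e (get K S T n) (t0, m)).1.2 c =
    if (c.1 == T) && (c.2 < n) then m (S, f c.2) else m c.
Proof.
move=> Hf fl ST KT.
pose I p (_ : Tmp) (m' : mem) :=
  forall c, m' c = if (c.1 == T) && (c.2 < p) then m (S, f c.2) else m c.
have H : htr e (I 0) (get K S T n) (lget K S T f n) (I n).
  apply: htr_loop => p pn t m' Im; rewrite /= /tnum /settnum /=.
  have Ep : (m' (K, p)).2 %% n = f p.
    by rewrite Im /= KT /= -/(num _) Hf // modn_small // fl.
  rewrite !wbE Ep; split=> // -[A i]; rewrite !wbE xpair_eqE !Im /= ST /=.
  have [->|AT] //= := eqVneq A T; rewrite [i < p.+1]ltnS [i <= p]leq_eqVlt.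
  by have [->|] := eqVneq i p.
case: (H t0 m) => [c|-> HI]; first by rewrite ltn0 andbF.
by split.
Qed.

Lemma copy_exec (S T : arr) o o' n : (S == T) = false ->
  (exec0 e (copy S o T o' n) (t0, m)).2 = lcopy S o T o' n /\
  forall c, (exec0 e (copy S o T o' n) (t0, m)).1.2 c =
    if [&& c.1 == T, o' <= c.2 & c.2 < o' + n] then m (S, o + (c.2 - o')) else m c.
Proof.
move=> ST.
pose I p (_ : Tmp) (m' : mem) := forall c, m' c =
    if [&& c.1 == T, o' <= c.2 & c.2 < o' + p] then m (S, o + (c.2 - o')) else m c.
have H : htr e (I 0) (copy S o T o' n) (lcopy S o T o' n) (I n).
  apply: htr_loop => p pn t m' Im; split=> // -[A i]; rewrite /= !wbE xpair_eqE !Im /= ST /=.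
  have [->|AT] //= := eqVneq A T; have [->|ne] /= := eqVneq i (o' + p).
    by rewrite leq_addr addKn addnS ltnSn.
  by rewrite (_ : (i < o' + p.+1) = (i < o' + p)) //; lia.
case: (H t0 m) => [c|-> HI]; last by split.
by rewrite addn0; case: ifP => // /and3P[_ ? ?]; lia.
Qed.

Lemma fill_exec (T : arr) n :
  (exec0 e (fill T n) (t0, m)).2 = lfill T n /\
  forall c, (exec0 e (fill T n) (t0, m)).1.2 c =
    if (c.1 == T) && (c.2 < n) then wnum c.2 else m c.
Proof.
pose I p (_ : Tmp) (m' : mem) := forall c, m' c =
    if (c.1 == T) && (c.2 < p) then wnum c.2 else m c.
have H : htr e (I 0) (fill T n) (lfill T n) (I n).
  apply: htr_loop => p pn t m' Im; split=> // -[A i]; rewrite /= !xpair_eqE Im /=.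
  have [->|AT] //= := eqVneq A T.
  by rewrite [i < p.+1]ltnS [i <= p]leq_eqVlt; have [->|] := eqVneq i p.
case: (H t0 m) => [c|-> HI]; last by split.
by rewrite ltn0 andbF.
Qed.

End Moves.

Lemma loop_det n body : (forall i, det (body i : seq op)) -> det (loop n body).
Proof. by move=> H; elim: n => // n IH; rewrite loopS /det all_cat [all _ _]IH [all _ _]H. Qed.

Lemma det_cat (o1 o2 : seq op) : det (o1 ++ o2) = det o1 && det o2.
Proof. exact: all_cat. Qed.

Lemma put_det K S T n : det (put K S T n). Proof. exact: loop_det. Qed.
Lemma get_det K S T n : det (get K S T n). Proof. exact: loop_det. Qed.
Lemma copy_det S o T o' n : det (copy S o T o' n). Proof. exact: loop_det. Qed.
Lemma fill_det T n : det (fill T n). Proof. exact: loop_det. Qed.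

End Blocks.

(** * Shuffled structures *)

Section Shuffles.

Variables (Env : Type) (D B : nat).
Notation E := D.+1.
Notation Wd := (Wd D B).
Notation Tmp := (Tmp D B).
Notation mem := (Cell -> Wd).
Notation op := (op Env Tmp Wd Cell).
Notation Q := (Q D).
Notation st := (Tmp * mem)%type.
Notation tapes := (seq nat * seq nat)%type.

(** An inside-out step as two cell operations: [i] replaces entry [k], whose former content goes to
    entry [i]. For [k = i] the cell has no meaningful content yet, and [i] itself is kept. *)
Definition fy_body (K : arr) (i : nat) : seq op :=
  [:: @Op Env Tmp Wd Cell i (colA K) (fun _ _ k => (K, k)) (fun _ _ _ _ => wnum D B i)
        (fun _ t k w => settnum t (if k == i then wnum D B i else w));
      wr Env K (fun _ => i) (fun t => wnum D B (tnum t))].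

Definition fyl K i n : seq op := flatten [seq fy_body K x | x <- iota i n].

Definition fy_step e (K : arr) (i k : nat) (s : st) : st :=
  match fy_body K i with
  | [:: o1; o2] => ostep e o2 0 (ostep e o1 k s)
  | _ => s
  end.

Fixpoint fy_st e (K : arr) i (ks : seq nat) (s : st) : st :=
  if ks is k :: ks' then fy_st e K i.+1 ks' (fy_step e K i k s) else s.

Fixpoint lfy (K : arr) i (ks : seq nat) : seq Cell :=
  if ks is k :: ks' then [:: (K, k), (K, i) & lfy K i.+1 ks'] else [::].

(** Probability of each single draw sequence, [1 / n!] for [i = 0]. Being the same for all
    sequences, it is preserved by every bijection between them. *)
Fixpoint fyw i n : rat := if n is n'.+1 then ((i.+1)%:R^-1 * fyw i.+1 n')%R else 1%R.

Lemma fy_aex e K i n s F :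
  aex e (fyl K i n) s F =
  (fyw i n * \sum_(ks <- ftp i n) F (fy_st e K i ks s) (lfy K i ks))%R.
Proof.
elim: n i s F => [|n IH] i s F; first by rewrite /= big_seq1 mul1r.
rewrite [aex _ _ _ _]/= Ex_unif card_ord -mulrA; congr (_ * _)%R.
pose G k := (fyw i.+1 n * \sum_(ks <- ftp i.+1 n) F (fy_st e K i (k :: ks) s) (lfy K i (k :: ks)))%R.
transitivity (\sum_(k < i.+1) G k)%R.
  by apply: eq_bigr => k _ /=; rewrite Ex_unif (big_ord1) card_ord invr1 mul1r IH.
have -> : ftp i n.+1 = [seq k :: ks | k <- iota 0 i.+1, ks <- ftp i.+1 n] by [].
by rewrite big_allpairs_dep big_distrr /= -(big_mkord xpredT G) /index_iota subn0.
Qed.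

Lemma fy_step_mem e K i k s f : i < Q.+1 -> k <= i ->
  (forall x, x < i -> num (s.2 (K, x)) = f x) -> (forall x, x < i -> f x < i) -> f i = i ->
  (forall x, x < i.+1 -> num ((fy_step e K i k s).2 (K, x)) = f (swp i k x)) /\
  (forall c, c.1 <> K -> (fy_step e K i k s).2 c = s.2 c).
Proof.
move=> iQ ki Hf fl fi; rewrite /fy_step /=; split; last first.
  by move=> [A x] /= /eqP AK; rewrite !xpair_eqE (negbTE AK).
move=> x xi; rewrite !xpair_eqE eqxx /= /swp /tnum /settnum /=.
have [_|xni] := eqVneq x i.
  have [->|kni] := eqVneq k i; first by rewrite fi num_wnum -/(num _) num_wnum.
  have kli : k < i by rewrite ltn_neqAle kni.
  by rewrite num_wnum -/(num _) Hf // (leq_trans (ltnW (fl _ kli))).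
have [_|xk] := eqVneq x k; first by rewrite num_wnum ?fi.
by rewrite Hf // ltn_neqAle xni -ltnS.
Qed.

Lemma fy_st_mem e K i n ks s f : ks \in ftp i n -> i + n <= Q.+1 ->
  (forall x, x < i -> num (s.2 (K, x)) = f x) -> (forall x, x < i -> f x < i) ->
  (forall x, i <= x -> f x = x) ->
  (forall x, x < i + n -> num ((fy_st e K i ks s).2 (K, x)) = fyx f i ks x) /\
  (forall c, c.1 <> K -> (fy_st e K i ks s).2 c = s.2 c).
Proof.
elim: n i ks s f => [|n IH] i ks s f.
  by move=> /ftpP[/size0nil -> _] _ Hf _ _; split=> // x; rewrite addn0; apply: Hf.
case: ks => [/ftpP[]//|k ks] /ftpP[/= [sk] Hk] iQ Hf fl fi.
have ki : k <= i by have := Hk 0 isT; rewrite /= addn0.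
have [||Hs Ho] := @fy_step_mem e K i k s f _ ki Hf fl; first by lia.
  exact: fi.
have [|||||H1 H2] := IH i.+1 ks (fy_step e K i k s) (f \o swp i k).
- by apply/ftpP; split=> // x xn; have := Hk x.+1 xn; rewrite /=; lia.
- by lia.
- exact: Hs.
- move=> x xi /=; have si : swp i k x < i.+1 by rewrite swp_lt.
  have [lt|le] := ltnP (swp i k x) i; first by apply: leq_trans (fl _ lt) _.
  by rewrite fi.
- by move=> x xi /=; rewrite /swp !ifF ?fi //; lia.
split=> [x xn|c cK]; last by rewrite H2 ?Ho.
by apply: H1; lia.
Qed.

Definition permOK (m : mem) (t : tapes) b d j : Prop :=
  [/\ forall p, p < nn j -> num (m (K1 b d j, p)) = fy t.1 p,
      forall p, p < nn j -> num (m (K2 b d j, p)) = fy t.2 p &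
      forall i, i < nn j -> num (m (P b d j, i)) = posn t i].

Definition setup_tl b d j : seq op :=
  fill Env D B (X b d j) (nn j) ++ put Env D B (K2 b d j) (X b d j) (U b d j) (nn j) ++
  put Env D B (K1 b d j) (U b d j) (P b d j) (nn j).

(* [P] is obtained by carrying the identity array through both shuffles. *)
Definition setup b d j : seq op :=
  fyl (K1 b d j) 0 (nn j) ++ fyl (K2 b d j) 0 (nn j) ++ setup_tl b d j.

Definition lsetup b d j (t : tapes) : seq Cell :=
  lfy (K1 b d j) 0 t.1 ++ lfy (K2 b d j) 0 t.2 ++ lfill (X b d j) (nn j) ++
  lput (K2 b d j) (X b d j) (U b d j) (fy t.2) (nn j) ++
  lput (K1 b d j) (U b d j) (P b d j) (fy t.1) (nn j).

Definition setup_st e b d j (t : tapes) (s : st) : st :=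
  (exec0 e (setup_tl b d j)
     (fy_st e (K2 b d j) 0 t.2 (fy_st e (K1 b d j) 0 t.1 s))).1.

Lemma setup_spec e b d j t s : j <= E -> tok (nn j) t ->
  let r := exec0 e (setup_tl b d j) (fy_st e (K2 b d j) 0 t.2 (fy_st e (K1 b d j) 0 t.1 s)) in
  [/\ r.2 = lfill (X b d j) (nn j) ++
        lput (K2 b d j) (X b d j) (U b d j) (fy t.2) (nn j) ++
        lput (K1 b d j) (U b d j) (P b d j) (fy t.1) (nn j),
      permOK r.1.2 t b d j &
      forall c, c.1.1.1.2 <> b \/ c.1.1.2 <> d \/ c.1.2 <> j -> r.1.2 c = s.2 c].
Proof.
move=> jE /andP[t1 t2] r; have nQ := nn_le jE.
have [|||| H1 F1] := @fy_st_mem e (K1 b d j) 0 (nn j) t.1 s id t1; rewrite ?add0n // ?leqW //.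
set s1 := fy_st e (K1 b d j) 0 t.1 s in H1 F1 r *.
have [|||| H2 F2] := @fy_st_mem e (K2 b d j) 0 (nn j) t.2 s1 id t2; rewrite ?add0n // ?leqW //.
set s2 := fy_st e (K2 b d j) 0 t.2 s1 in H2 F2 r *.
rewrite {}/r /setup_tl exec0_cat /= exec0_cat /=.
have [tt [m2 E2]] : exists tt m2, s2 = (tt, m2) by exists s2.1, s2.2; case: (s2).
have em2 : m2 = s2.2 by rewrite E2.
rewrite E2; have [-> G1] := fill_exec e tt m2 (X b d j) (nn j).
case E3 : (exec0 e (fill _ _ _ _ _) _).1 G1 => [tt3 m3] /= G1.
have K2ok p : p < nn j -> num (m3 (K2 b d j, p)) = fy t.2 p.
  by move=> pn; rewrite G1 /= em2 H2 ?add0n.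
have [||-> G2] := put_exec e tt3 (S := X b d j) (T := U b d j) K2ok (fun x => fy_lt x t2) (fyK _) (fyiK _) _ _;
  rewrite ?xpair_eqE //.
case E4 : (exec0 e (put _ _ _ _ _ _ _) _).1 G2 => [tt4 m4] /= G2.
have K1ok p : p < nn j -> num (m4 (K1 b d j, p)) = fy t.1 p.
  by move=> pn; rewrite G2 /= G1 /= em2 F2 // H1 ?add0n.
have [||-> G3] := put_exec e tt4 (S := U b d j) (T := P b d j) K1ok (fun x => fy_lt x t1) (fyK _) (fyiK _) _ _;
  rewrite ?xpair_eqE //.
split=> //; first split.
- by move=> p pn; rewrite G3 /= -K1ok.
- by move=> p pn; rewrite G3 /= G2 /= K2ok.
- move=> i ilt; have i1 : fyi t.1 i < nn j by rewrite (fyi_lt _ t1).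
  have i2 : fyi t.2 (fyi t.1 i) < nn j by rewrite (fyi_lt _ t2).
  rewrite G3 /= eqxx ilt /= G2 /= eqxx i1 /= G1 /= eqxx i2 num_wnum //.
  exact: leq_trans (ltnW i2) nQ.
- move=> [A i] /= HA.
  have ne T : A == (T, b, d, j) = false.
    by apply/eqP => EA; move: HA; rewrite EA /=; case=> [|[|]].
  rewrite G3 /= ne /= G2 /= ne /= G1 /= ne /=.
  by rewrite em2 F2 ?F1 //=; apply/eqP; rewrite ne.
Qed.

Lemma setup_aex e b d j s F : j <= E ->
  aex e (setup b d j) s F =
  (fyw 0 (nn j) * fyw 0 (nn j) *
   \sum_(t <- tpairs (nn j)) F (setup_st e b d j t s) (lsetup b d j t))%R.
Proof.
move=> jE; rewrite /setup aex_cat fy_aex -mulrA; congr (_ * _)%R.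
rewrite /tpairs big_allpairs_dep big_distrr /= big_seq [RHS]big_seq.
apply: eq_bigr => t1 Ht1; rewrite aex_cat fy_aex; congr (_ * _)%R.
rewrite big_seq [RHS]big_seq; apply: eq_bigr => t2 Ht2.
rewrite aex_det; last by rewrite !det_cat fill_det !put_det.
have [|-> _ _] := @setup_spec e b d j (t1, t2) s jE; first by rewrite /tok Ht1 Ht2.
by rewrite /lsetup !catA.
Qed.

Definition scatter b d j : seq op :=
  put Env D B (K2 b d j) (X b d j) (U b d j) (nn j) ++
  put Env D B (K1 b d j) (U b d j) (V b d j) (nn j).

Definition lscatter b d j (t : tapes) : seq Cell :=
  lput (K2 b d j) (X b d j) (U b d j) (fy t.2) (nn j) ++
  lput (K1 b d j) (U b d j) (V b d j) (fy t.1) (nn j).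

Definition gather b d j : seq op :=
  get Env D B (K1 b d j) (V b d j) (U b d j) (nn j) ++
  get Env D B (K2 b d j) (U b d j) (X b d j) (nn j).

Definition lgather b d j (t : tapes) : seq Cell :=
  lget (K1 b d j) (V b d j) (U b d j) (fy t.1) (nn j) ++
  lget (K2 b d j) (U b d j) (X b d j) (fy t.2) (nn j).

Lemma scatter_exec e tt (m : mem) t b d j : permOK m t b d j -> tok (nn j) t ->
  let r := exec0 e (scatter b d j) (tt, m) in
  [/\ r.2 = lscatter b d j t,
      forall i, i < nn j -> r.1.2 (V b d j, i) = m (X b d j, posn t i) &
      forall c, c.1 <> V b d j -> c.1 <> U b d j -> r.1.2 c = m c].
Proof.
move=> [k1 k2 _] /andP[t1 t2] r; rewrite {}/r /scatter exec0_cat /=.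
have [||-> G2] := put_exec e tt (S := X b d j) (T := U b d j) k2 (fun x => fy_lt x t2) (fyK _) (fyiK _) _ _;
  rewrite ?xpair_eqE //.
case E4 : (exec0 e (put _ _ _ _ _ _ _) _).1 G2 => [tt4 m4] /= G2.
have k1' p : p < nn j -> num (m4 (K1 b d j, p)) = fy t.1 p.
  by move=> pn; rewrite G2 /= k1.
have [||-> G3] := put_exec e tt4 (S := U b d j) (T := V b d j) k1' (fun x => fy_lt x t1) (fyK _) (fyiK _) _ _;
  rewrite ?xpair_eqE //.
split=> // [i ilt|[A i] /= /eqP/negbTE AV /eqP/negbTE AU].
  by rewrite G3 /= eqxx ilt G2 /= eqxx (fyi_lt _ t1) ilt.
by rewrite G3 /= AV /= G2 /= AU.
Qed.

Lemma gather_exec e tt (m : mem) t b d j : permOK m t b d j -> tok (nn j) t ->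
  let r := exec0 e (gather b d j) (tt, m) in
  [/\ r.2 = lgather b d j t,
      forall i, i < nn j -> r.1.2 (X b d j, posn t i) = m (V b d j, i) &
      forall c, c.1 <> X b d j -> c.1 <> U b d j -> r.1.2 c = m c].
Proof.
move=> [k1 k2 _] Ht r; rewrite {}/r /gather exec0_cat /=; have /andP[t1 t2] := Ht.
have [||-> G2] := get_exec e tt (S := V b d j) (T := U b d j) k1 (fun x => fy_lt x t1) _ _;
  rewrite ?xpair_eqE //.
case E4 : (exec0 e (get _ _ _ _ _ _ _) _).1 G2 => [tt4 m4] /= G2.
have k2' p : p < nn j -> num (m4 (K2 b d j, p)) = fy t.2 p.
  by move=> pn; rewrite G2 /= k2.
have [||-> G3] := get_exec e tt4 (S := U b d j) (T := X b d j) k2' (fun x => fy_lt x t2) _ _;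
  rewrite ?xpair_eqE //.
split=> // [i ilt|[A i] /= /eqP/negbTE AX /eqP/negbTE AU].
  rewrite G3 /= eqxx posn_lt // ilt G2 /= eqxx (fy_lt _ t2) posn_lt // ilt /=.
  by rewrite /posn fyiK fyiK.
by rewrite G3 /= AX /= G2 /= AU.
Qed.

Lemma scatter_det b d j : det (scatter b d j).
Proof. by rewrite det_cat !put_det. Qed.
Lemma gather_det b d j : det (gather b d j).
Proof. by rewrite det_cat !get_det. Qed.

End Shuffles.

(** * Accesses *)

Section Programs.

Variables (Env : Type) (D B H : nat).
Notation E := D.+1.
Notation Wd := (Wd D B).
Notation Tmp := (Tmp D B).
Notation ptr := (ptr D).
Notation op := (op Env Tmp Wd Cell).
Notation access := (nat * nat * option (block B))%type.
Notation wnull := (wnull D B).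
Notation lvl := (lvl D).
Notation active := (active D).

Definition slot (c : bool) (w : Wd) : option ptr := if c then w.1.1.2 else w.1.1.1.
Definition wdat (w : Wd) : block B := w.1.2.
Definition setslot (c : bool) (p : option ptr) (w : Wd) : Wd :=
  if c then (w.1.1.1, p, w.1.2, w.2) else (p, w.1.1.2, w.1.2, w.2).

(* A pointer is a level, a parity and a position; it is followed at its level only,
   the other active levels being searched for a dummy. *)
Definition phit (j : nat) (b : bool) (p : option ptr) : option nat :=
  if p is Some (j', b', pos) then if ((j' : nat) == j) && (b' == b) then Some (pos : nat) else None
  else None.

Definition setptr (t : Tmp) (p : option ptr) : Tmp := (p, t.1.1.2, wnull, tout t).

(* Every node found is erased: a copy with updated pointers is created. *)
Definition look t d j : seq op :=
  let b := odd (q j t).-1 in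
  [:: rd Env (P b d j) (2 ^ j + t %% 2 ^ j) (@settnum D B);
      mk (X b d j) (fun u => odflt (tnum u) (phit j b (tptr u)) %% nn j)
        (fun _ u w => if phit j b (tptr u) is Some _ then wnull else w)
        (fun _ u w => if phit j b (tptr u) is Some _ then settwd u w else u)].

Definition act t := [seq j <- iota 0 E.+1 | active j t].

(* [a] is the path, the depth of the datum and the value to write, if any. *)
Definition newnode (a : access) t d (u : Tmp) : Wd :=
  let w := twd u in
  let c := dir d a.1.1 in
  let np : option ptr := if d.+1 < H then Some (ord0, odd t, u.1.1.2) else None in
  (if c then slot false w else np, if c then np else slot true w,
   if a.1.2 == d then odflt (wdat w) a.2 else wdat w, ord0).

(** The new node points to a child that the next step will create. The position of this child is
    known beforehand: it has name 0 in the already shuffled structure of level 0. *)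
Definition walkstep (sel : Env -> access) t d : seq op :=
  flatten [seq look t d j | j <- act t] ++
  [:: rd Env (P (odd t) d.+1 0) 0 (@settnum D B);
      mk O (fun _ => 0)
        (fun e u w => if (sel e).1.2 == d then (None, None, wdat (twd u), ord0) else w)
        (fun _ u _ => u);
      mk (V (odd t) d 0) (fun _ => 0) (fun e u _ => newnode (sel e) t d u)
        (fun e u _ => setptr u (slot (dir d (sel e).1.1) (twd u)))].

(** No pointer to the root has to be kept. Every access recreates it, so the current root belongs to
    access [t.-1], the last one of the window just built at level [lvl t], where its name is
    [(2 ^ J).-1]. *)
Definition root t : seq op :=
  if t is 0 then [:: rd Env O 0 (fun u _ => setptr u None)]
  else let J := lvl t in let b := odd (q J t).-1 in
    [:: rd Env (P b 0 J) (2 ^ J).-1 (fun u w => setptr u (Some (inord J, b, w.2)))].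

(* The nodes are moved to the new structure, and their positions in it are left
   in the old one for the parents to look up. *)
Definition mergeA t1 j d : seq op :=
  let b' := odd (q j.+1 t1).-1 in
  flatten [seq scatter Env D B b d j ++
    copy Env D B (V b d j) 0 (V b' d j.+1) (b * 2 ^ j) (2 ^ j) ++
    copy Env D B (P b' d j.+1) (b * 2 ^ j) (V b d j) 0 (2 ^ j) ++
    gather Env D B b d j | b <- [:: false; true]].

Definition ren t1 j d i (cb : bool * bool) : seq op :=
  let b' := odd (q j.+1 t1).-1 in let: (c, b) := cb in
  [:: rd Env (P b d.+1 j) (2 ^ j + (2 ^ j + (2 * i + c))) (@settnum D B);
      mk (X b d.+1 j) (fun u => odflt (tnum u) (phit j b (slot c (twd u))) %% nn j)
        (fun _ u w => w)
        (fun _ u w => if phit j b (slot c (twd u)) is Some _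
           then settwd u (setslot c (Some (inord j.+1, b', w.2)) (twd u)) else u)].

Definition cbs : seq (bool * bool) :=
  [:: (false, false); (false, true); (true, false); (true, true)].

Definition mergeB t1 j d : seq op :=
  if d.+1 < H then
    let b' := odd (q j.+1 t1).-1 in
    loop (2 ^ j.+1) (fun i =>
      rd Env (V b' d j.+1) i (@settwd D B) :: flatten [seq ren t1 j d i cb | cb <- cbs] ++
      [:: wr Env (V b' d j.+1) (fun _ => i) (@twd D B)])
  else [::].

Definition merge t1 j : seq op :=
  loop H (mergeA t1 j) ++ loop H (mergeB t1 j) ++
  loop H (fun d => gather Env D B (odd (q j.+1 t1).-1) d j.+1).

(** These are the structures of the windows that end at [t1]. They are shuffled before the access
    because their positions are stored in pointers before the structures are filled. *)
Definition setups t1 : seq op :=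
  loop (lvl t1).+1 (fun j => loop H (fun d => setup Env D B (odd (q j t1).-1) d j)).

Definition body (sel : Env -> access) t : seq op :=
  root t ++ loop H (walkstep sel t) ++
  loop H (fun d => gather Env D B (odd t) d 0) ++ loop (lvl t.+1) (merge t.+1).

Definition accessp (sel : Env -> access) t : seq op := setups t.+1 ++ body sel t.

End Programs.

(** * Invariant of the layout and correctness of a single access *)

Section Logic.

Variables (Env : Type) (D B H : nat).
Notation E := D.+1.
Notation Wd := (Wd D B).
Notation Tmp := (Tmp D B).
Notation ptr := (ptr D).
Notation mem := (Cell -> Wd).
Notation access := (nat * nat * option (block B))%type.
Notation wnull := (wnull D B).
Notation lv := (lv D).
Notation lvl := (lvl D).
Notation lo := (lo D).
Notation active := (active D).
Notation tapes := (seq nat * seq nat)%type.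

Variables (v dd : nat -> nat) (ww : nat -> option (block B)).
Hypothesis v_lt : forall t, v t < 2 ^ D.
Hypothesis dd_ge : forall t, D <= dd t.
Hypothesis sweep : forall p x, x < 2 ^ D -> exists s, [/\ p * 2 ^ E <= s, s < p.+1 * 2 ^ E & v s = x].

Notation lastn := (lastn v).
Notation slotn := (slotn v).

(* The datum of depth [d] on the path [x] before access [t]. *)
Fixpoint mm t d x : block B :=
  if t is t'.+1 then
    if (v t' == x) && (dd t' == d) then odflt (mm t' d x) (ww t') else mm t' d x
  else block0 B.

(** During the last complete window of the top level the sweep has visited the path of [s],
    recreating every node on it. *)
Lemma recent t d x s : lastn t d x = Some s -> lo t <= s.
Proof.
move=> Hs; rewrite /lo; case Eq : (q E t) => [|p]; first by rewrite muln0.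
have [s' [s1 s2 Es']] := sweep p (v_lt s).
have s't : s' < t by apply: leq_trans s2 _; rewrite -q_geq Eq.
have ps' : pn d x (v s') by rewrite /pn Es' (lastn_pre Hs).
have [s''] := lst_ge s't ps'; rewrite [lst _ _ _]Hs => -[<-] le.
by apply: leq_trans le; rewrite mulnC.
Qed.

Lemma recent_slot t d x c s : slotn t d x c = Some s -> lo t <= s.
Proof. by move/slotn_lastn/recent. Qed.

Lemma pre_inj x y : x < 2 ^ D -> y < 2 ^ D -> pre D x = pre D y -> x = y.
Proof.
have gen d : pre d x = pre d y -> x %% 2 ^ d = y %% 2 ^ d.
  elim: d => [|d IH]; first by rewrite expn0 !modn1.
  move/eqP; rewrite preS => /andP[/eqP/IH Em /eqP].
  rewrite /dir /q => Eo.
  have step z : z %% 2 ^ d.+1 = (odd (z %/ 2 ^ d)) * 2 ^ d + z %% 2 ^ d.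
    rewrite {1}(divn_eq z (2 ^ d)) {1}(divn_eq (z %/ 2 ^ d) 2) mulnDl -mulnA -expnS.
    rewrite -addnA modnMDl modn_small ?modn2 //.
    have := mod_lt d z; rewrite expnS; case: (odd _) => /=; lia.
  by rewrite !step Em Eo.
by move=> xD yD /gen; rewrite !modn_small.
Qed.

Lemma pre_le d d' x y : d <= d' -> pre d' x = pre d' y -> pre d x = pre d y.
Proof.
move=> dd'; have tk z : pre d z = take d (pre d' z).
  by rewrite /pre /mkseq -map_take take_iota; congr map; congr iota; lia.
by rewrite !tk => ->.
Qed.

(** Data are stored at depths at least [D], where the prefix determines the whole path; above them
    every datum is zero. *)
Lemma mm_pre t d x y : x < 2 ^ D -> y < 2 ^ D -> pre d x = pre d y -> mm t d x = mm t d y.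
Proof.
move=> xD yD Exy; have [dD|Dd] := ltnP d D; last by rewrite (pre_inj xD yD (pre_le Dd Exy)).
suff E0 z : mm t d z = block0 B by rewrite !E0.
elim: t => //= t ->; rewrite ifF //; have := dd_ge t => ?.
by apply/andP => -[_ /eqP]; lia.
Qed.

Lemma mm_fresh t d x : lastn t d x = None -> mm t d x = block0 B.
Proof.
elim: t => //= t IH; rewrite /lastn /=; case: ifP => // Hp /IH ->.
rewrite ifF //; apply/negP => /andP[/eqP Ev _]; move: Hp; rewrite /pn Ev.
by rewrite eqxx.
Qed.

Section Layout.
Variable Pi : nat -> nat -> nat -> tapes.

Definition ptrc (lvf : nat -> nat) d s : ptr :=
  (inord (lvf s), odd (q (lvf s) s), inord (posn (Pi d (lvf s) (q (lvf s) s)) (s %% 2 ^ lvf s))).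

Definition slotp lvf t d x c : option ptr :=
  if d.+1 < H then omap (ptrc lvf d.+1) (slotn t d x c) else None.

Definition node lvf t d x : Wd := (slotp lvf t d x false, slotp lvf t d x true, mm t d x, ord0).

Definition sbuf (lvf : nat -> nat) s := odd (q (lvf s) s).
Definition stp (lvf : nat -> nat) d s := Pi d (lvf s) (q (lvf s) s).
Definition cellc (lvf : nat -> nat) d s : Cell :=
  (X (sbuf lvf s) d (lvf s), posn (stp lvf d s) (s %% 2 ^ lvf s)).

(* Every live node stands at the position given by its name, unless it has been
   superseded by a copy. *)
Definition Inv (lvf : nat -> nat) l t (m : mem) : Prop :=
  forall d s, d < H -> l <= s -> s < t ->
    [/\ permOK m (stp lvf d s) (sbuf lvf s) d (lvf s), tok (nn (lvf s)) (stp lvf d s) &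
        m (cellc lvf d s) = if lastn t d (v s) == Some s then node lvf t d (v s) else wnull].

Lemma node_lvf lvf lvf' t d x : (forall s c, slotn t d x c = Some s -> lvf s = lvf' s) ->
  node lvf t d x = node lvf' t d x.
Proof.
move=> Hl; have Hs c : slotp lvf t d x c = slotp lvf' t d x c.
  rewrite /slotp; case: ifP => // _; case Es : (slotn t d x c) => [s|] //=.
  by rewrite /ptrc (Hl _ _ Es).
by rewrite /node !Hs.
Qed.

Lemma node_pre lvf t d x y : x < 2 ^ D -> y < 2 ^ D -> pre d x = pre d y ->
  node lvf t d x = node lvf t d y.
Proof.
move=> xD yD Exy; rewrite /node /slotp (mm_pre t xD yD Exy).
by rewrite !(eq_slotn _ _ _ Exy).
Qed.

Lemma node_fresh lvf t d x : lastn t d x = None -> node lvf t d x = wnull.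
Proof.
move=> Hn; rewrite /node /slotp !(lastn_None_slotn _ Hn) (mm_fresh Hn) /=.
by rewrite /wnull; case: ifP.
Qed.

Lemma mod_name j s : s %% 2 ^ j < nn j.
Proof. by have := mod_lt j s; rewrite /nn; lia. Qed.

Lemma slot_lt t d x c s : slotn t d x c = Some s -> s < t.
Proof. by case/lstP. Qed.

Section Access.
Variables (t : nat) (e : Env) (sel : Env -> access).
Hypothesis sel_e : sel e = (v t, dd t, ww t).
Hypothesis H_gt0 : 0 < H.

Definition lt0 s := lv s t.

Lemma phit_ptrc d s j b : s < t -> lo t <= s -> active j t -> b = odd (q j t).-1 ->
  tok (nn (lv s t)) (stp lt0 d s) ->
  phit j b (Some (ptrc lt0 d s)) =
  if lv s t == j then Some (posn (stp lt0 d s) (s %% 2 ^ lv s t)) else None.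
Proof.
move=> st al ac -> Ht; rewrite /phit /ptrc inordK; last by rewrite ltnS lv_le.
case: eqP => [Ej|//]; have [_ Eq] := lv_active st al.
rewrite -Ej /lt0 -Eq eqxx inordK //.
have : posn (stp lt0 d s) (s %% 2 ^ lv s t) < nn (lv s t) by rewrite posn_lt // mod_name.
by move=> Hp; exact: leq_trans Hp (leqW (nn_le (lv_le D s t))).
Qed.

Definition llook d j : seq Cell :=
  let w := (q j t).-1 in
  [:: (P (odd w) d j, 2 ^ j + t %% 2 ^ j);
      (X (odd w) d j, posn (Pi d j w) (nm D v d j w (t %% 2 ^ j)))].

Lemma active_time j : active j t -> (q j t).-1.+1 * 2 ^ j + t %% 2 ^ j = t.
Proof. by move=> /active_gt0 g; rewrite prednK // -q_eq. Qed.

Lemma hitlife_lv d j : active j t ->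
  hitlife D v d j (q j t).-1 (t %% 2 ^ j) =
  if lastn t d (v t) is Some s then if lv s t == j then Some s else None else None.
Proof.
move=> ac; rewrite /hitlife active_time // ifF; last first.
  by apply/andP => -[jE]; apply/negP/(active_parity ac jE).
by case El : (lastn t d (v t)) => [s|] //; rewrite (lv_iff _ (recent El) ac) //; case/lstP: El.
Qed.

(** The invariant speaks of nodes only, so the shuffle of an active level is reached through some
    access of its window. The first one serves. *)
Lemma active_rep j : active j t -> exists s, [/\ lo t <= s, s < t, lv s t = j & q j s = (q j t).-1].
Proof.
move=> ac; have g0 := active_gt0 ac; pose s := (q j t).-1 * 2 ^ j.
have jE : j <= E by case/orP: ac => /andP[]; [move/ltnW | move/eqP ->].
have Eq : q j s = (q j t).-1 by rewrite -[s]addn0 qM ?expn_gt0.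
have st : s < t.
  have : q j t * 2 ^ j <= t by rewrite -q_geq.
  by rewrite -{1}(prednK g0) mulSn /s; have := expn_gt0 2 j; lia.
have al : lo t <= s.
  rewrite lo_le; case/orP: (ac) => /andP[]; last by move/eqP => Ej _; rewrite -Ej Eq.
  move=> ltj od; have : q j.+1 s = q j.+1 t by rewrite !qS Eq; lia.
  by move/(q_up ltj) => ->; lia.
exists s; split=> //; apply/eqP; rewrite -lv_iff // Eq; exact: eqxx.
Qed.

Lemma active_perm (m0 : mem) d j : Inv lt0 (lo t) t m0 -> d < H -> active j t ->
  permOK m0 (Pi d j (q j t).-1) (odd (q j t).-1) d j /\ tok (nn j) (Pi d j (q j t).-1).
Proof.
move=> I0 dH ac; have [s [al st <- Eq]] := active_rep ac.
by have [H1 H2 _] := I0 d s dH al st; move: H1 H2; rewrite /stp /sbuf /lt0 Eq.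
Qed.

Definition hitc d : option Cell := omap (cellc lt0 d) (lastn t d (v t)).

Definition found d (l : seq nat) : bool :=
  if lastn t d (v t) is Some s then lv s t \in l else false.

Definition lookI d (m1 : mem) (l : seq nat) (u : Tmp) (m : mem) : Prop :=
  [/\ tptr u = omap (ptrc lt0 d) (lastn t d (v t)),
      twd u = (if found d l then node lt0 t d (v t) else wnull) &
      forall c, m c = if found d l && (hitc d == Some c) then wnull else m1 c].

Lemma hitc_tag d c : hitc d = Some c -> exists b j, c.1 = X b d j.
Proof. by rewrite /hitc; case: lastn => //= s [<-]; exists (sbuf lt0 s), (lt0 s). Qed.

(** The node sought lies in at most one of the active levels, its pointer telling which. Each of the
    others is probed at the dummy reserved for this access, in agreement with [nm]. *)
Lemma look_htr d j (m0 m1 : mem) l : Inv lt0 (lo t) t m0 -> d < H -> active j t -> j \notin l ->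
  (forall c : Cell, tagA c.1 = 2 -> m1 c = m0 c) -> (forall b j i, m1 (X b d j, i) = m0 (X b d j, i)) ->
  htr e (lookI d m1 l) (look Env D B t d j) (llook d j) (lookI d m1 (rcons l j)).
Proof.
move=> I0 dH ac jl mP mX u m [Iptr Iwd Im].
have [[_ _ p3] tk] := active_perm I0 dH ac.
set w := (q j t).-1 in p3 tk *; set k := t %% 2 ^ j.
have kj : k < 2 ^ j by rewrite ltn_mod expn_gt0.
have kn : 2 ^ j + k < nn j by rewrite /nn; lia.
have rP : num (m (P (odd w) d j, 2 ^ j + k)) = posn (Pi d j w) (2 ^ j + k).
  rewrite Im ifF ?mP ?p3 //; apply/negP => /andP[_ /eqP/hitc_tag[b [j' //]]].
rewrite /look -/w -/k /= /llook -/w -/k /tnum /= -/(num _) rP.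
rewrite -/(tptr u).
have Hh := hitlife_lv d ac; rewrite -/w -/k in Hh.
have Ephit : phit j (odd w) (tptr u) =
    omap (fun s => posn (Pi d j w) (s %% 2 ^ j)) (hitlife D v d j w k).
  rewrite Iptr Hh; case El : (lastn t d (v t)) => [s|]; last by [].
  have [st _ _] := (lstP _ _ _ _).1 El; have al := recent El.
  have [_ Ht _] := I0 d s dH al st.
  rewrite [omap (ptrc lt0 d) _]/= (@phit_ptrc d s j (odd w) st al ac erefl Ht); case: eqP => //= Ej.
  have [_ Eq] := lv_active st al.
  by rewrite /stp /lt0 Ej /w -Ej -Eq Ej.
rewrite Ephit.
have Enm : nm D v d j w k = if hitlife D v d j w k is Some s then s %% 2 ^ j else 2 ^ j + k.
  by rewrite /nm /hit kj.
have Eidx : odflt (posn (Pi d j w) (2 ^ j + k))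
   (omap (fun s => posn (Pi d j w) (s %% 2 ^ j)) (hitlife D v d j w k)) %% nn j =
   posn (Pi d j w) (nm D v d j w k).
  rewrite Enm; case: (hitlife D v d j w k) => [s|] /=; rewrite modn_small // posn_lt //.
  exact: mod_name.
rewrite Eidx; split=> //.
have Efound : found d (rcons l j) = found d l || (hitlife D v d j w k != None).
  rewrite /found Hh; case: (lastn t d (v t)) => [s|] //.
  by rewrite mem_rcons inE orbC; case: eqP.
rewrite /lookI Efound; case El : (hitlife D v d j w k) Hh => [s|] /=; last first.
  by move=> _; rewrite orbF; split=> [||c]; [exact: Iptr | exact: Iwd | rewrite /= !wbE Im].
case Els : (lastn t d (v t)) => [s'|] //; case: eqP => // Ej [Es]; subst s'.
have nf : found d l = false by rewrite /found Els Ej (negbTE jl).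
have [st _ _] := (lstP _ _ _ _).1 Els; have al := recent Els.
have [_ Ht Hm] := I0 d s dH al st.
have Ec : cellc lt0 d s = (X (odd w) d j, posn (Pi d j w) (nm D v d j w k)).
  rewrite /cellc /sbuf /stp /lt0 Enm El Ej; have [_ Eq] := lv_active st al.
  by rewrite Ej in Eq; rewrite /w -Eq.
have Eh c : (hitc d == Some c) = (c == (X (odd w) d j, posn (Pi d j w) (nm D v d j w k))).
  by rewrite /hitc Els [omap _ _]/= Ec; apply/eqP/eqP => [[<-]|->].
rewrite nf /=; split=> [||c].
- by have := Iptr; rewrite Els.
- rewrite /twd /= Im nf /= mX -Ec Hm (eq_lastn v t (lastn_pre Els)) Els eqxx.
  exact: node_pre (lastn_pre Els).
- by rewrite wbE Im nf Eh.
Qed.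

(* Level of the nodes of access [s] once the levels below [J] have been merged. *)
Definition LV J s := if t.+1 - 2 ^ J <= s then J else lv s t.

Lemma LV0 s : s < t -> LV 0 s = lv s t.
Proof. by move=> st; rewrite /LV expn0 subn1 leqNgt /= st. Qed.

Lemma LV0t : LV 0 t = 0.
Proof. by rewrite /LV expn0 subn1 leqnn. Qed.

Definition walkI (m0 : mem) d (u : Tmp) (m : mem) : Prop :=
  [/\ d < H -> tptr u = omap (ptrc lt0 d) (lastn t d (v t)), twd u = wnull,
     forall c : Cell, tagA c.1 \notin [:: 1; 5; 6] -> m c = m0 c &
   [/\ forall b d' j i, m (X b d' j, i) =
         if (d' < d) && (hitc d' == Some (X b d' j, i)) then wnull else m0 (X b d' j, i),
      forall d', d' < d -> m (V (odd t) d' 0, 0) = node (LV 0) t.+1 d' (v t) &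
      dd t < d -> wdat (m (O, 0)) = mm t (dd t) (v t)]].

Definition lwalk d : seq Cell :=
  flatten [seq llook d j | j <- act D t] ++
  [:: (P (odd t) d.+1 0, 0); (O, 0); (V (odd t) d 0, 0)].

Lemma new_node d (u : Tmp) : d < H -> twd u = node lt0 t d (v t) ->
  (d.+1 < H -> tnum u = posn (Pi d.+1 0 t) 0) ->
  newnode H (v t, dd t, ww t) t d u = node (LV 0) t.+1 d (v t).
Proof.
move=> dH Ew En; rewrite /newnode Ew /node /=.
have Es c : slotp (LV 0) t.+1 d (v t) c =
    if dir d (v t) == c then (if d.+1 < H then Some (ptrc (LV 0) d.+1 t) else None)
    else slotp lt0 t d (v t) c.
  rewrite /slotp /slotn /= {1}/ps eqxx /=; case: ifP => [d1|_]; last by case: ifP.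
  case: ifP => //= _; case El : (lst v t _) => [s|] //=; congr Some; rewrite /ptrc LV0 //.
  by case/lstP: El.
have Ep : d.+1 < H -> Some (ptrc (LV 0) d.+1 t) = Some (ord0, odd t, u.1.1.2) :> option ptr.
  move=> d1; rewrite /ptrc LV0t q0 expn0 modn1 -En // /tnum inord_val; congr (Some (_, _, _)).
  by apply: val_inj; rewrite /= inordK.
rewrite !Es; case: (d.+1 < H) Ep => [/(_ isT) ->|_]; case: (dir d (v t)) => //=.
all: by rewrite /mm -/mm eqxx /=.
Qed.

Lemma walk_htr (m0 : mem) d : Inv lt0 (lo t) t m0 -> d < H ->
  (d.+1 < H -> permOK m0 (Pi d.+1 0 t) (odd t) d.+1 0) ->
  htr e (walkI m0 d) (walkstep D H sel t d) (lwalk d) (walkI m0 d.+1).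
Proof.
move=> I0 dH pOK u m [Iptr Iwd Im [IX IV IO]].
have look_all : htr e (lookI d m [::]) (flatten [seq look Env D B t d j | j <- act D t])
    (flatten [seq llook d j | j <- act D t]) (lookI d m (act D t)).
  apply: (htr_map (I := lookI d m)) => l1 j l2 El; apply: (@look_htr d j m0 m l1) => //.
  - by have : j \in act D t by [rewrite El mem_cat mem_head orbT]; rewrite /act mem_filter => /andP[].
  - have : uniq (act D t) by rewrite /act filter_uniq ?iota_uniq.
    by rewrite El cat_uniq /= negb_or => /and3P[_ /andP[? _] _].
  - by move=> c Ec; apply: Im; rewrite Ec.
  - by move=> b j' i; rewrite IX ltnn.
have Ist : lookI d m [::] u m.
  have nf : found d [::] = false by rewrite /found; case: (lastn _ _ _).
  by split=> [||c]; rewrite ?nf //; exact: Iptr.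
have := look_all u m Ist; rewrite /walkstep exec0_cat /=.
case: (exec0 e (flatten _) (u, m)) => -[u1 m1] l1 /= [-> [I1ptr I1wd I1m]].
have Efull : twd u1 = node lt0 t d (v t).
  rewrite I1wd; case: ifP => // nf; rewrite node_fresh //.
  move: nf; rewrite /found; case El : (lastn t d (v t)) => [s|] // /negP[].
  have [st _ _] := (lstP _ _ _ _).1 El; have [ac _] := lv_active st (recent El).
  by rewrite /act mem_filter ac mem_iota ltnS lv_le.
rewrite !sel_e /=; split=> //.
set u2 := settnum u1 _.
have Eu2 : twd u2 = node lt0 t d (v t) by [].
have nX c : tagA c.1 != 5 -> m1 c = m c.
  move=> nt; rewrite I1m ifF //; apply/negP => /andP[_ /eqP/hitc_tag[b [j Ec]]].
  by rewrite Ec in nt.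
have Enew : newnode H (v t, dd t, ww t) t d u2 = node (LV 0) t.+1 d (v t).
  apply: new_node => // d1; have [_ _ p3] := pOK d1.
  by rewrite /u2 /tnum /= -/(num _) nX // Im // p3 // nn_gt0.
split=> //=.
- by move=> d1; rewrite Eu2 -slot_child; case: (dir d (v t)); rewrite /= /slotp d1.
- move=> c; rewrite !inE !negb_or => /and3P[n1 n5 n6].
  rewrite ifF; last by apply/eqP => Ec; rewrite Ec in n1.
  rewrite ifF; last by apply/eqP => Ec; rewrite Ec in n6.
  by rewrite wbE nX // Im // !inE !negb_or n1 n5.
split.
- move=> b d' j i; rewrite I1m IX [d' < d.+1]ltnS [d' <= d]leq_eqVlt.
  have [->|ne] /= := eqVneq d' d.
    rewrite ltnn /found /hitc; case El : (lastn t d (v t)) => [s|] //=.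
    have [st _ _] := (lstP _ _ _ _).1 El; have [ac _] := lv_active st (recent El).
    by rewrite /act mem_filter ac mem_iota ltnS lv_le /=.
  rewrite (_ : (hitc d == Some (X b d' j, i)) = false) ?andbF //.
  apply/eqP; rewrite /hitc; case: (lastn t d (v t)) => //= s [_ Ed _ _].
  by move: ne; rewrite Ed eqxx.
- move=> d'; rewrite ltnS leq_eqVlt => /orP[/eqP ->|lt]; first by rewrite eqxx -Enew.
  rewrite ifF ?nX ?IV //.
  by apply/eqP => -[Ed]; rewrite Ed ltnn in lt.
- rewrite ltnS leq_eqVlt => /orP[/eqP Ed|lt]; first by rewrite Ed eqxx Eu2.
  by rewrite (ltn_eqF lt) ?nX // IO.
Qed.

Definition newP (m : mem) : Prop := forall d j, d < H -> j <= lvl t.+1 ->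
  permOK m (Pi d j (q j t.+1).-1) (odd (q j t.+1).-1) d j /\ tok (nn j) (Pi d j (q j t.+1).-1).

Lemma permOK_frame (m m' : mem) tp b d j :
  (forall c : Cell, c.1 \in [:: K1 b d j; K2 b d j; P b d j] -> m' c = m c) ->
  permOK m tp b d j -> permOK m' tp b d j.
Proof.
by move=> Em [p1 p2 p3]; split=> i ilt; rewrite Em ?p1 ?p2 ?p3 // !inE eqxx ?orbT.
Qed.

Lemma permOK_tag (m m' : mem) tp b d j :
  (forall c : Cell, tagA c.1 \in [:: 0; 2; 3] -> m' c = m c) ->
  permOK m tp b d j -> permOK m' tp b d j.
Proof.
by move=> Em; apply: permOK_frame => c; rewrite !inE => /or3P[] /eqP Ec; apply: Em; rewrite Ec.
Qed.

Definition lroot : seq Cell :=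
  if t is 0 then [:: (O, 0)] else
    let J := lvl t in [:: (P (odd (q J t).-1) 0 J, (2 ^ J).-1)].

Lemma root_htr (m0 : mem) : Inv lt0 (lo t) t m0 ->
  htr e (fun _ m => forall c, m c = m0 c) (root Env D B t) lroot (walkI m0 0).
Proof.
move=> I0 u m Em; rewrite /root /lroot; case Et : t => [|t'] /=.
  split=> //; split=> [_|//|c _ /=|]; [by rewrite Et | by rewrite wbE Em |].
  by split=> [b d' j i /=|//|//]; rewrite ?wbE Em.
rewrite -Et; set J := lvl t; set w := (q J t).-1.
split=> //; split=> [_|//|c _ /=|]; first last.
- by split=> [b d' j i /=|//|//]; rewrite ?wbE Em.
- by rewrite wbE Em.
have El : lastn t 0 (v t) = Some t' by rewrite {1}Et.
have al := recent El; have st : t' < t by rewrite Et.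
have Elv : lv t' t = J.
  have := @lv_next D t' t'; rewrite -Et => /(_ (leqnn _) al) ->.
  by rewrite /J ifT //; have := expn_gt0 2 (lvl t); lia.
have [[_ _ p3] _ _] := I0 0 t' H_gt0 al st.
have [_ Eq] := lv_active st al; rewrite Elv in Eq.
have Em1 : t' %% 2 ^ J = (2 ^ J).-1.
  have := lvl_mul (leqnn J : J <= lvl t); rewrite -Eq mulSn => Ett.
  have Et' : t' = q J t' * 2 ^ J + (2 ^ J).-1 by have := expn_gt0 2 J; lia.
  by rewrite {1}Et' modnMDl modn_small // prednK ?expn_gt0.
rewrite El /= /ptrc /lt0 Elv; congr (Some (_, _, _)); first by rewrite /w -Eq.
rewrite -Em1 Em; have := p3 (t' %% 2 ^ J); rewrite /sbuf /stp /lt0 Elv /w -Eq /=.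
by move=> <-; rewrite ?mod_name // inord_val.
Qed.

Lemma gathers_htr b j (Pd : nat -> tapes) (m1 : mem) :
  (forall d, d < H -> permOK m1 (Pd d) b d j /\ tok (nn j) (Pd d)) ->
  htr e (fun _ m => forall c, m c = m1 c) (loop H (fun d => gather Env D B b d j))
    (loop H (fun d => lgather b d j (Pd d)))
    (fun _ m => (forall d i, d < H -> i < nn j -> m (X b d j, posn (Pd d) i) = m1 (V b d j, i)) /\
       forall c : Cell, (forall d, d < H -> c.1 <> X b d j /\ c.1 <> U b d j) -> m c = m1 c).
Proof.
move=> HP.
pose I n (_ : Tmp) (m : mem) :=
  (forall d i, d < n -> i < nn j -> m (X b d j, posn (Pd d) i) = m1 (V b d j, i)) /\
  forall c : Cell, (forall d, d < n -> c.1 <> X b d j /\ c.1 <> U b d j) -> m c = m1 c.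
have Hl : htr e (I 0) (loop H (fun d => gather Env D B b d j))
    (loop H (fun d => lgather b d j (Pd d))) (I H).
  apply: htr_loop => d dH u m [IX IF]; have [p1 tk] := HP d dH.
  have p2 : permOK m (Pd d) b d j.
    apply: permOK_frame p1 => c; rewrite !inE => /or3P[] /eqP Ec; apply: IF => d' _; by rewrite Ec.
  have [-> GX GF] := gather_exec e u p2 tk; split=> //; split.
    move=> d' i; rewrite ltnS leq_eqVlt => /orP[/eqP ->|lt] ilt.
      by rewrite GX // IF.
    by rewrite GF ?IX //= => -[Ed]; rewrite Ed ltnn in lt.
  move=> c Hc; rewrite GF ?IF //; try by have [] := Hc d (ltnSn d).
  by move=> d' lt; apply: Hc; apply: leqW.
by move=> u m Em; apply: Hl; split=> // c _; apply: Em.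
Qed.

Definition afterI J (m : mem) : Prop :=
  [/\ Inv (LV J) (lo t.+1) t.+1 m, newP m & dd t < H -> wdat (m (O, 0)) = mm t (dd t) (v t)].

Lemma node_next d s : s < t -> pre d (v s) <> pre d (v t) ->
  node (LV 0) t.+1 d (v s) = node lt0 t d (v s).
Proof.
move=> st ne; have Hs c : slotn t.+1 d (v s) c = slotn t d (v s) c.
  by rewrite /slotn /= {1}/ps; case: eqP => [Ep|_] /=; first by case: ne.
rewrite (@node_lvf (LV 0) lt0); last first.
  by move=> s' c; rewrite Hs => /slot_lt s't; rewrite LV0.
have Em : mm t.+1 d (v s) = mm t d (v s).
  by rewrite /= ifF //; apply/andP => -[/eqP Ev _]; case: ne; rewrite Ev.
by rewrite /node /slotp !Hs Em.
Qed.

(** Nodes off the path of [t] are unchanged; the live ones on it have been erased and are superseded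
    by those of access [t]. *)
Lemma walk_after (m0 m1 m : mem) u : Inv lt0 (lo t) t m0 -> newP m0 -> walkI m0 H u m1 ->
  (forall d i, d < H -> i < nn 0 -> m (X (odd t) d 0, posn (Pi d 0 t) i) = m1 (V (odd t) d 0, i)) ->
  (forall c : Cell, (forall d, d < H -> c.1 <> X (odd t) d 0 /\ c.1 <> U (odd t) d 0) -> m c = m1 c) ->
  afterI 0 m.
Proof.
move=> I0 N0 [_ _ F1 [FX FV FO]] GX GF.
have Fp c : tagA c.1 \in [:: 0; 2; 3] -> m c = m0 c.
  move=> Ht; rewrite GF ?F1 //; first by move: Ht; case: (tagA c.1) => [|[|[|[|]]]].
  by move=> d _; split=> Ec; rewrite Ec in Ht.
have N1 : newP m.
  by move=> d j dH jl; have [? ?] := N0 d j dH jl; split=> //; apply: permOK_tag Fp _.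
split=> //; last by move=> lt; rewrite GF // FO.
move=> d s dH al; rewrite ltnS leq_eqVlt => /orP[/eqP Es|st].
  rewrite Es /cellc /sbuf /stp LV0t !q0 expn0 modn1.
  have := N1 d 0 dH (leq0n _); rewrite q0 /= => -[p tk]; split=> //.
  by rewrite GX // FV // /lastn /= {1}/pn eqxx eqxx.
have alt := leq_trans (lo_next D t) al.
have [p tk Hm] := I0 d s dH alt st.
have Ecell : cellc (LV 0) d s = cellc lt0 d s by rewrite /cellc /sbuf /stp LV0.
rewrite {1 2}/stp {1}/sbuf LV0 // Ecell; split=> //; first exact: permOK_tag Fp _.
rewrite GF; last first.
  move=> d' _; split=> //= -[Eb Ed El].
  by have := @buf_free D t 0 s (leq0n _) st alt El; rewrite /= !q0 -Eb /sbuf El q0.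
rewrite FX dH /=; case: eqP => [Eh|nh].
  move: Eh; rewrite /hitc; case Els : (lastn t d (v t)) => [s0|] //= [Eb El Ep].
  have [s0t _ _] := (lstP _ _ _ _).1 Els; have al0 := recent Els.
  (* The erased cell belongs to [s0]. Equal cells have the same level, recent nodes of one level lie
     in one window, and [posn] is injective on its names. *)
  suff Es : s0 = s.
    rewrite Es in Els; rewrite /lastn /= {1}/pn -(lastn_pre Els) eqxx.
    by case: eqP => // -[Et]; rewrite Et ltnn in st.
  have [_ E1] := lv_active st alt; have [_ E2] := lv_active s0t al0.
  rewrite /lt0 in El; rewrite El in E2; rewrite (q_eq (lv s t) s) (q_eq (lv s t) s0).
  have -> : q (lv s t) s0 = q (lv s t) s by lia.
  congr (_ + _); apply: (@posn_inj (stp lt0 d s)); rewrite -Ep /stp /lt0 El.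
  by congr (posn (Pi _ _ _) _); lia.
rewrite Hm /lastn /= {2}/pn; case: (pre d (v t) =P pre d (v s)) => [Ep|nep].
  have -> : (Some t == Some s) = false by apply/eqP => -[Et]; rewrite Et ltnn in st.
  case: eqP => // Els; case: nh; rewrite /hitc (eq_lastn v t Ep).
  by rewrite /lastn Els.
by case: eqP => // _; rewrite node_next // => Ep; apply: nep.
Qed.

Lemma twd_settwd (u : Tmp) w : twd (settwd u w) = w. Proof. by []. Qed.

Section Merge.
Variable j : nat.
Hypothesis jl : j < lvl t.+1.
Notation w' := (q j.+1 t.+1).-1.
Notation b' := (odd w').
Notation start := (t.+1 - 2 ^ j.+1).

Lemma mj_E : j < E. Proof. exact: leq_trans jl (lvl_le _ _). Qed.

Lemma mw_t : t.+1 = w'.+1 * 2 ^ j.+1.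
Proof.
have := lvl_mul (jl : j.+1 <= lvl t.+1); have := @lvl_q D t j.+1 jl => -> /=.
by rewrite mulSn.
Qed.

Lemma mstart : start = w' * 2 ^ j.+1.
Proof. by rewrite {1}mw_t mulSn addKn. Qed.

Lemma mlo : lo t.+1 <= start.
Proof.
rewrite lo_le mstart -[_ * _]addn0; have := qM (j := j.+1) (i := 0) w'; rewrite expn_gt0 => /(_ isT) Eq.
have Et : q j.+1 t.+1 = (q j.+1 (w' * 2 ^ j.+1 + 0)).+1 by rewrite Eq {1}mw_t -[_ * _]addn0 qM ?expn_gt0.
move: (_ + 0) Et {Eq} => x Et; have := mj_E; rewrite leq_eqVlt => /orP[/eqP Ej|lt].
  by rewrite -Ej Et.
rewrite -subn1 leq_subLR add1n.
rewrite -(subnKC lt); elim: (E - j.+2) => [|n IH].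
  by rewrite addn0 [q j.+2 t.+1]qS [q j.+2 x]qS Et; lia.
by rewrite addnS [q (j.+2 + n).+1 t.+1]qS [q (j.+2 + n).+1 x]qS; lia.
Qed.

Lemma mwin_ge s (b : bool) : start <= s -> s < t.+1 ->
  (q j s == 2 * w' + b) = (odd (q j s) == b).
Proof.
move=> s1 s2; have Ew := win_q jl s2 s1; have : q j.+1 s = w' by rewrite -Ew.
by rewrite qS => E1; apply/eqP/eqP => E2; move: E1 E2; case: b; lia.
Qed.

Lemma mwin_lt s (b : bool) : s < start -> (q j s == 2 * w' + (b : bool)) = false.
Proof.
move=> s1; have := win_out jl s1; rewrite qS => ?; apply/eqP => E2; move: E2; case: b; lia.
Qed.

Lemma mname s : start <= s -> s < t.+1 ->
  s %% 2 ^ j.+1 = odd (q j s) * 2 ^ j + s %% 2 ^ j /\ s = w' * 2 ^ j.+1 + s %% 2 ^ j.+1.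
Proof.
move=> s1 s2; have Ew := win_q jl s2 s1; have Eq : q j.+1 s = w' by rewrite -Ew.
have E1 := q_eq j.+1 s; rewrite Eq in E1; split=> //.
have E2 := q_eq j s; have := mwin_ge (odd (q j s)) s1 s2; rewrite eqxx => /eqP E3.
rewrite E3 in E2; apply: (@addnI (w' * 2 ^ j.+1)); rewrite -E1 {1}E2 expnS; lia.
Qed.

Lemma LVwin s : start <= s -> s < t.+1 -> LV j s = j /\ LV j.+1 s = j.+1.
Proof.
move=> s1 s2; rewrite /LV s1; split=> //; case: leqP => // lt.
exact: lv_merge.
Qed.

Lemma LVout s : s < start -> LV j s = lv s t /\ LV j.+1 s = lv s t.
Proof.
move=> s1; rewrite /LV [start <= s]leqNgt s1 /=; split=> //.
by rewrite ifF // leqNgt; apply/negbF; apply: leq_trans s1 _; rewrite leq_sub2l // leq_exp2l.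
Qed.

Lemma out_lv s : lo t <= s -> s < start -> lv s t <> j.
Proof.
move=> al s1 Ej; have st : s < t by have := expn_gt0 2 j.+1; lia.
have [_] := lv_active st al; rewrite Ej => E1; have := win_out jl s1.
by have := @lvl_q D t j (ltnW jl); rewrite !qS; lia.
Qed.

Notation Pb d b := (Pi d j (2 * w' + (b : bool))).

Definition lmA1 d (b : bool) : seq Cell :=
  lscatter b d j (Pb d b) ++ lcopy (V b d j) 0 (V b' d j.+1) (b * 2 ^ j) (2 ^ j) ++
  lcopy (P b' d j.+1) (b * 2 ^ j) (V b d j) 0 (2 ^ j) ++ lgather b d j (Pb d b).

Definition lmergeA d : seq Cell := flatten [seq lmA1 d b | b <- [:: false; true]].

Definition bad d : seq arr :=
  [:: V b' d j.+1; X false d j; X true d j; U false d j; U true d j; V false d j; V true d j].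

Lemma V_neq b d : (V b d j == V b' d j.+1) = false.
Proof. by apply/eqP => -[_ /eqP]; rewrite (ltn_eqF (ltnSn j)). Qed.

Lemma mA1_exec d (b : bool) u (m : mem) : permOK m (Pb d b) b d j -> tok (nn j) (Pb d b) ->
  let r := exec0 e (scatter Env D B b d j ++
    copy Env D B (V b d j) 0 (V b' d j.+1) (b * 2 ^ j) (2 ^ j) ++
    copy Env D B (P b' d j.+1) (b * 2 ^ j) (V b d j) 0 (2 ^ j) ++ gather Env D B b d j) (u, m) in
  [/\ r.2 = lmA1 d b,
     forall i, i < 2 ^ j -> r.1.2 (V b' d j.+1, b * 2 ^ j + i) = m (X b d j, posn (Pb d b) i),
     forall i, i < 2 ^ j -> r.1.2 (X b d j, posn (Pb d b) i) = m (P b' d j.+1, b * 2 ^ j + i) &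
     forall c : Cell, c.1 \notin [:: X b d j; U b d j; V b d j] ->
       (c.1 == V b' d j.+1) && (b * 2 ^ j <= c.2 < b * 2 ^ j + 2 ^ j) = false -> r.1.2 c = m c].
Proof.
move=> p0 tk r; rewrite {}/r exec0_cat /=.
have [-> A1 A2] := scatter_exec e u p0 tk.
case: (exec0 e (scatter _ _ _ _ _ _) _).1 A1 A2 => u1 m1 /= A1 A2; rewrite exec0_cat /=.
have [-> G1] := copy_exec e u1 m1 0 (b * 2 ^ j) (2 ^ j) (V_neq b d).
case: (exec0 e (copy _ _ _ _ _ _ _ _) _).1 G1 => u2 m2 /= G1; rewrite exec0_cat /=.
have PV : (P b' d j.+1 == V b d j) = false by [].
have [-> G2] := copy_exec e u2 m2 (b * 2 ^ j) 0 (2 ^ j) PV.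
case: (exec0 e (copy _ _ _ _ _ _ _ _) _).1 G2 => u3 m3 /= G2.
have V_neq' : (V b' d j.+1 == V b d j) = false by rewrite eq_sym V_neq.
have p3 : permOK m3 (Pb d b) b d j.
  apply: permOK_frame p0 => c; rewrite !inE => /or3P[] /eqP Ec;
    by rewrite G2 Ec /= G1 Ec /= A2 ?Ec.
have [-> G3 G4] := gather_exec e u3 p3 tk.
have ltn i : i < 2 ^ j -> i < nn j by rewrite /nn; lia.
split=> //.
- move=> i ilt; rewrite G4 //= G2 /= V_neq' /= G1 /= eqxx leq_addr ltn_add2l ilt /= add0n addKn.
  by rewrite A1 // ltn.
- move=> i ilt; rewrite G3 ?ltn // G2 /= eqxx /= add0n ilt subn0 G1 /= A2 //.
- move=> c; rewrite !inE !negb_or => /and3P[/eqP nX /eqP nU /eqP nV] nV'.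
  by rewrite G4 // G2 (introF eqP nV) /= G1 nV' A2.
Qed.

Definition stA (m0 m : mem) d : Prop :=
  [/\ forall (b : bool) i, i < 2 ^ j -> m (V b' d j.+1, b * 2 ^ j + i) = m0 (X b d j, posn (Pb d b) i) &
      forall (b : bool) i, i < 2 ^ j -> m (X b d j, posn (Pb d b) i) = m0 (P b' d j.+1, b * 2 ^ j + i)].

Lemma mergeA_htr (m0 : mem) :
  (forall d b, d < H -> permOK m0 (Pb d b) b d j /\ tok (nn j) (Pb d b)) ->
  htr e (fun _ m => forall c, m c = m0 c) (loop H (mergeA Env D B t.+1 j)) (loop H lmergeA)
    (fun _ m => (forall d, d < H -> stA m0 m d) /\
       forall c : Cell, (forall d, d < H -> c.1 \notin bad d) -> m c = m0 c).
Proof.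
move=> HP.
pose I n (_ : Tmp) (m : mem) := (forall d, d < n -> stA m0 m d) /\
  forall c : Cell, (forall d, d < n -> c.1 \notin bad d) -> m c = m0 c.
have Hl : htr e (I 0) (loop H (mergeA Env D B t.+1 j)) (loop H lmergeA) (I H).
  apply: htr_loop => d dH u m [IA IF].
  have Em0 (c : Cell) : c.1.1.2 = d -> m c = m0 c.
    move=> Ed; apply: IF => d' lt; rewrite !inE; apply/negP => Hc.
    have : c.1.1.2 = d' by do 6?case/orP: Hc => [/eqP -> //|Hc]; rewrite (eqP Hc).
    by rewrite Ed => Ed'; rewrite Ed' ltnn in lt.
  have [pf tf] := HP d false dH; have [pt tt] := HP d true dH.
  have pf1 : permOK m (Pb d false) false d j.
    by apply: permOK_frame pf => c; rewrite !inE => /or3P[] /eqP Ec; apply: Em0; rewrite Ec.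
  rewrite /mergeA /= cats0 exec0_cat /=.
  have [-> F1 F2 F3] := mA1_exec u pf1 tf.
  case: (exec0 e _ (u, m)).1 F1 F2 F3 => u1 m1 /= F1 F2 F3.
  have VT i : (V true d j, i).1 == V b' d j.+1 = false by apply: V_neq.
  have pt1 : permOK m1 (Pb d true) true d j.
    apply: permOK_frame pt => c; rewrite !inE => /or3P[] /eqP Ec;
      by rewrite F3 ?Ec //; apply: Em0; rewrite Ec.
  have [-> T1 T2 T3] := mA1_exec u1 pt1 tt.
  case: (exec0 e _ (u1, m1)).1 T1 T2 T3 => u2 m2 /= T1 T2 T3.
  split; first by rewrite /lmergeA /= cats0.
  split=> [d'|c Hc].
    rewrite ltnS leq_eqVlt => /orP[/eqP ->|lt].
      split=> -[] i ilt.
      - by rewrite T1 // F3 ?Em0.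
      - rewrite T3 /=; first by rewrite F1 // Em0.
          by rewrite !inE /= eq_sym V_neq.
        by rewrite eqxx /= mul0n add0n mul1n leqNgt ilt.
      - by rewrite T2 // F3 ?Em0.
      - by rewrite T3 // F2 // Em0.
    have nd A i tg bb jj : A = (tg, bb, d', jj) :> arr -> m2 (A, i) = m (A, i).
      move=> EA; have ne tg2 bb2 jj2 : A == (tg2, bb2, d, jj2) = false.
        by rewrite EA; apply/eqP => -[_ _ Ed]; rewrite Ed ltnn in lt.
      by rewrite T3 ?F3 //= ?inE ?ne.
    have [A1 A2] := IA d' lt.
    by split=> b i ilt; rewrite (nd _ _ _ _ _ erefl) ?A1 ?A2.
  have := Hc d (ltnSn d); rewrite !inE !negb_or => /and5P[/negbTE n1 n2 n3 n4 /and3P[n5 n6 n7]].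
  rewrite T3 ?F3 ?IF ?inE ?negb_or ?n1 ?n2 ?n3 ?n4 ?n5 ?n6 ?n7 //.
  by move=> d' lt; apply: Hc; apply: leqW.
by move=> u m Em; apply: Hl; split=> // c _; apply: Em.
Qed.

(** Access that created the child in slot [c] of entry [i]. A superseded entry has none, its word
    being empty, which matches the test made in [hitren]. *)
Definition target d i c : option nat :=
  let s := w' * 2 ^ j.+1 + i in
  if lastn t.+1 d (v s) == Some s then slotn t.+1 d (v s) c else None.

Definition ent lvf d i : Wd :=
  let s := w' * 2 ^ j.+1 + i in
  if lastn t.+1 d (v s) == Some s then node lvf t.+1 d (v s) else wnull.

Lemma ent_slot lvf d i c : d.+1 < H -> slot c (ent lvf d i) = omap (ptrc lvf d.+1) (target d i c).
Proof.
move=> d1; rewrite /ent /target; case: ifP => _; last by case: c.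
by rewrite /node /slotp d1; case: c.
Qed.

(** The list [l] holds the pairs (slot, parity of the window searched) already processed; each
    pointer is updated at the one pair that finds its target. *)
Definition renamed d i (l : seq (bool * bool)) c : bool :=
  if target d i c is Some s then (start <= s) && ((c, odd (q j s)) \in l) else false.

Definition renc d i l c : option ptr :=
  omap (ptrc (if renamed d i l c then LV j.+1 else LV j) d.+1) (target d i c).

Definition renw d i l : Wd :=
  (renc d i l false, renc d i l true, (ent (LV j) d i).1.2, ord0).

Lemma renw_eq d i l l' : (forall c, renc d i l c = renc d i l' c) -> renw d i l = renw d i l'.
Proof. by move=> Ec; rewrite /renw !Ec. Qed.

Lemma renw_set d i l l' c : (forall c0, c0 != c -> renc d i l c0 = renc d i l' c0) ->
  setslot c (renc d i l' c) (renw d i l) = renw d i l'.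
Proof. by case: c => Ec; rewrite /renw /setslot /= Ec. Qed.

Lemma slot_renw d i l c : slot c (renw d i l) =
  omap (ptrc (if renamed d i l c then LV j.+1 else LV j) d.+1) (target d i c).
Proof. by case: c. Qed.

Lemma target_lt d i c s : target d i c = Some s -> s < t.+1 /\ lo t.+1 <= s.
Proof.
by rewrite /target; case: ifP => // _ Hs; split; [apply: slot_lt Hs | apply: recent_slot Hs].
Qed.

Lemma renw_start d i : d.+1 < H -> renw d i [::] = ent (LV j) d i.
Proof.
move=> d1; have nr c : renamed d i [::] c = false.
  by rewrite /renamed; case: (target d i c) => [s|] //; rewrite andbF.
rewrite /renw /renc !nr -!ent_slot //; rewrite /ent; case: ifP => _ //.
Qed.

Lemma renw_end d i : d.+1 < H -> renw d i cbs = ent (LV j.+1) d i.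
Proof.
move=> d1; have Es c : omap (ptrc (if renamed d i cbs c then LV j.+1 else LV j) d.+1) (target d i c) =
    slot c (ent (LV j.+1) d i).
  rewrite ent_slot // /renamed; case Et : (target d i c) => [s|] //=.
  have [st al] := target_lt Et.
  have -> : (c, odd (q j s)) \in cbs by case: c {Et}; case: (odd _).
  rewrite andbT; case: leqP => // lt; congr Some; rewrite /ptrc.
  by have [-> ->] := LVout lt.
rewrite /renw /renc !Es /ent; case: ifP => _ //.
Qed.

Definition lren d i (cb : bool * bool) : seq Cell :=
  let: (c, b) := cb in let k := 2 ^ j + (2 * i + c) in
  [:: (P b d.+1 j, 2 ^ j + k); (X b d.+1 j, posn (Pb d.+1 b) (nm D v d.+1 j (2 * w' + b) k))].

(* The entry found by the lookup of the child [c] of entry [i] among the nodes of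
   the window [2 * w' + b]. *)
Definition moved d i (c b : bool) : option nat :=
  if target d i c is Some s then if (start <= s) && (odd (q j s) == b) then Some s else None
  else None.

Lemma movedP d i c b s : moved d i c b = Some s ->
  [/\ target d i c = Some s, start <= s & odd (q j s) = b].
Proof. by rewrite /moved; case: target => // s0; case: ifP => // /andP[? /eqP <-] [<-]. Qed.

Lemma hitren_moved d i (c b : bool) : i < 2 ^ j.+1 ->
  hit D v d.+1 j (2 * w' + b) (2 ^ j + (2 * i + c)) = moved d i c b.
Proof.
move=> ilt; rewrite /hit ltnNge leq_addr /= addKn /hitren mj_E /=.
have -> : q 1 (2 * w' + b) = w' by rewrite /q expn1; case: b; lia.
have -> : q 1 (2 * i + c) = i by rewrite /q expn1; case: c; lia.
have -> : odd (2 * i + c) = c by rewrite oddD oddM /=; case: c.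
rewrite -mw_t /moved /target; case: ifP => // _; case Es : (slotn _ _ _ _) => [s|] //.
have st := slot_lt Es; case: (leqP start s) => [s1|s1] /=; first by rewrite mwin_ge.
by rewrite mwin_lt.
Qed.

Lemma phit_ren d i l (c b : bool) : d.+1 < H ->
  (forall b0, tok (nn j) (Pb d.+1 b0)) -> (c, b) \notin l ->
  phit j b (slot c (renw d i l)) = omap (fun s => posn (Pb d.+1 b) (s %% 2 ^ j)) (moved d i c b).
Proof.
move=> d1 tk cbl; rewrite slot_renw /moved; case Et : (target d i c) => [s|] //=.
have [st al] := target_lt Et; have jE := ltnW mj_E.
case: (leqP start s) => [s1|s1] /=; last first.
  have -> : renamed d i l c = false by rewrite /renamed Et leqNgt s1.
  have [E1 _] := LVout s1; rewrite E1 inordK ?ltnS ?lv_le // ifF //.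
  apply/negP => /andP[/eqP Ej _]; apply: out_lv s1 Ej.
  exact: leq_trans (lo_next D t) al.
have [E1 E2] := LVwin s1 st; have := mwin_ge (odd (q j s)) s1 st; rewrite eqxx => /eqP Eq.
(* A pointer already updated carries level [j.+1] and misses at level [j], so the search in the
   second window does not touch it again. *)
case Hr : (renamed d i l c).
  rewrite E2 inordK; last by rewrite ltnS mj_E.
  rewrite (gtn_eqF (ltnSn j)) /=; case: eqP => // Eb.
  by move: Hr; rewrite /renamed Et s1 /= Eb (negbTE cbl).
rewrite E1 inordK ?ltnS // eqxx /=; case: eqP => // Eb.
rewrite Eq Eb inordK //.
have : posn (Pb d.+1 b) (s %% 2 ^ j) < nn j by rewrite posn_lt ?mod_name.
by move=> Hp; exact: leq_trans Hp (leqW (nn_le jE)).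
Qed.

Lemma ren_htr (m1 : mem) d i l c b : d.+1 < H -> i < 2 ^ j.+1 -> (c, b) \notin l ->
  (forall b0, tok (nn j) (Pb d.+1 b0)) ->
  (forall b0 k, k < nn j -> num (m1 (P b0 d.+1 j, k)) = posn (Pb d.+1 b0) k) ->
  (forall (b0 : bool) k, k < 2 ^ j -> num (m1 (X b0 d.+1 j, posn (Pb d.+1 b0) k)) =
     posn (Pi d.+1 j.+1 w') (b0 * 2 ^ j + k)) ->
  htr e (fun u m => twd u = renw d i l /\ forall x, m x = m1 x)
    (ren Env D B t.+1 j d i (c, b)) (lren d i (c, b))
    (fun u m => twd u = renw d i (rcons l (c, b)) /\ forall x, m x = m1 x).
Proof.
move=> d1 ilt cbl tk HP HX u m [Iwd Im].
set k := 2 ^ j + (2 * i + c).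
have kn : 2 ^ j + k < nn j.
  by move: ilt; rewrite /k /nn expnS; case: c {cbl k}; lia.
have rP : num (m (P b d.+1 j, 2 ^ j + k)) = posn (Pb d.+1 b) (2 ^ j + k) by rewrite Im HP.
rewrite /ren /= /tnum /= -/(num _) rP /lren -/k.
set u1 := settnum u _; have Iwd1 : twd u1 = renw d i l by exact: Iwd.
rewrite Iwd1 phit_ren //.
have Eidx : odflt (posn (Pb d.+1 b) (2 ^ j + k))
    (omap (fun s => posn (Pb d.+1 b) (s %% 2 ^ j)) (moved d i c b)) %% nn j =
    posn (Pb d.+1 b) (nm D v d.+1 j (2 * w' + b) k).
  rewrite /nm hitren_moved //; case: moved => [s|] /=; rewrite modn_small ?posn_lt ?mod_name //.
rewrite Eidx /nm hitren_moved //; split=> //; split; last by move=> x; rewrite /= !wbE Im.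
have Hr c0 : renamed d i (rcons l (c, b)) c0 =
    renamed d i l c0 || (c0 == c) && (moved d i c0 b != None).
  rewrite /renamed /moved; case: (target d i c0) => [s|]; last by rewrite andbF.
  rewrite mem_rcons inE xpair_eqE; case: (start <= s) => /=; last by rewrite andbF.
  by rewrite orbC; case: (odd _ == b).
have Hsame c0 : c0 != c \/ moved d i c b = None -> renc d i l c0 = renc d i (rcons l (c, b)) c0.
  rewrite /renc Hr => -[/negbTE ->|Em]; first by rewrite orbF.
  by case: eqP => [->|_]; rewrite ?Em orbF.
case Em : (moved d i c b) => [s|]; last by rewrite Iwd1; apply: renw_eq => c0; apply: Hsame; right.
have [Et s1 Eb] := movedP Em; have [st al] := target_lt Et.
have [E1 E2] := LVwin s1 st; have [Es1 Es2] := mname s1 st.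
rewrite twd_settwd Im.
have Ep : Some (inord j.+1, b', (m1 (X b d.+1 j, posn (Pb d.+1 b) (s %% 2 ^ j))).2) =
    omap (ptrc (LV j.+1) d.+1) (target d i c).
  rewrite Et /= /ptrc E2; have Ew := win_q jl st s1.
  have -> : q j.+1 s = w' by rewrite -Ew.
  congr (Some (_, _, _)); rewrite Es1 Eb -HX ?mod_lt //; exact/esym/inord_val.
rewrite Ep (_ : omap _ _ = renc d i (rcons l (c, b)) c); last by rewrite /renc Hr eqxx Em orbT.
by apply: renw_set => c0 ne; apply: Hsame; left.
Qed.

Definition lmergeB d : seq Cell :=
  if d.+1 < H then loop (2 ^ j.+1) (fun i =>
    (V b' d j.+1, i) :: flatten [seq lren d i cb | cb <- cbs] ++ [:: (V b' d j.+1, i)])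
  else [::].

Lemma mergeB_htr (m1 : mem) :
  (forall d i, d < H -> i < 2 ^ j.+1 -> m1 (V b' d j.+1, i) = ent (LV j) d i) ->
  (forall d b, d < H -> tok (nn j) (Pb d b)) ->
  (forall d b k, d < H -> k < nn j -> num (m1 (P b d j, k)) = posn (Pb d b) k) ->
  (forall d (b : bool) k, d < H -> k < 2 ^ j -> num (m1 (X b d j, posn (Pb d b) k)) =
     posn (Pi d j.+1 w') (b * 2 ^ j + k)) ->
  htr e (fun _ m => forall c, m c = m1 c) (loop H (mergeB Env D B H t.+1 j)) (loop H lmergeB)
    (fun _ m => (forall d i, d < H -> i < 2 ^ j.+1 -> m (V b' d j.+1, i) = ent (LV j.+1) d i) /\
       forall c : Cell, (forall d, d < H -> c.1 <> V b' d j.+1) -> m c = m1 c).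
Proof.
move=> HV tk HP HX.
pose I n (_ : Tmp) (m : mem) :=
  (forall d i, d < n -> i < 2 ^ j.+1 -> m (V b' d j.+1, i) = ent (LV j.+1) d i) /\
  forall c : Cell, (forall d, d < n -> c.1 <> V b' d j.+1) -> m c = m1 c.
have Vd d d' : d <> d' -> V b' d j.+1 <> V b' d' j.+1 by move=> ne [].
have Hl : htr e (I 0) (loop H (mergeB Env D B H t.+1 j)) (loop H lmergeB) (I H).
  apply: htr_loop => d dH u m [IV IF]; rewrite /mergeB /lmergeB.
  have Vm (c : Cell) : c.1 = V b' d j.+1 -> m c = m1 c.
    by move=> Ec; apply: IF => d' lt; rewrite Ec; apply: Vd => Ed; rewrite Ed ltnn in lt.
  have step (m' : mem) : (forall i, i < 2 ^ j.+1 -> m' (V b' d j.+1, i) = ent (LV j.+1) d i) ->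
      (forall c : Cell, c.1 <> V b' d j.+1 -> m' c = m c) -> I d.+1 u m'.
    move=> S1 S2; split=> [d' i|c Hc]; last first.
      rewrite S2 ?IF //; first by move=> d' lt; apply: Hc; apply: leqW.
      exact: Hc.
    rewrite ltnS leq_eqVlt => /orP[/eqP -> |lt] ilt; first exact: S1.
    by rewrite S2 ?IV //=; apply: Vd => Ed; rewrite Ed ltnn in lt.
  case: ifP => d1; last first.
    split=> //; apply: (step m) => // i ilt; rewrite Vm // HV // /ent; case: ifP => // _.
    by rewrite /node /slotp d1.
  pose J i (_ : Tmp) (m' : mem) :=
    (forall i', i' < i -> m' (V b' d j.+1, i') = ent (LV j.+1) d i') /\
    forall c : Cell, (c.1 == V b' d j.+1) && (c.2 < i) = false -> m' c = m c.
  suff HJ : htr e (J 0) (loop (2 ^ j.+1) (fun i =>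
      rd Env (V b' d j.+1) i (@settwd D B) :: flatten [seq ren Env D B t.+1 j d i cb | cb <- cbs] ++
      [:: wr Env (V b' d j.+1) (fun _ => i) (@twd D B)]))
      (loop (2 ^ j.+1) (fun i =>
        (V b' d j.+1, i) :: flatten [seq lren d i cb | cb <- cbs] ++ [:: (V b' d j.+1, i)]))
      (J (2 ^ j.+1)).
    have [|-> [J1 J2]] := HJ u m; first by split=> // c; rewrite ltn0 andbF.
    split=> //; apply: step => // c nc; apply: J2; apply/andP => -[/eqP //].
  apply: htr_loop => i ilt u0 m0 [J1 J2].
  have Em0 (c : Cell) : c.1.1.1.1 <> 1 -> m0 c = m1 c.
    move=> nt; rewrite J2 ?IF //; first by move=> d' _ Ec; rewrite Ec in nt.
    by apply/andP => -[/eqP Ec]; rewrite Ec in nt.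
  pose R l (u' : Tmp) (m' : mem) := twd u' = renw d i l /\ forall x, m' x = m0 x.
  have HR : htr e (R [::]) (flatten [seq ren Env D B t.+1 j d i cb | cb <- cbs])
      (flatten [seq lren d i cb | cb <- cbs]) (R cbs).
    apply: (htr_map (I := R)) => l1 [c b] l2 El.
    apply: ren_htr => //.
    - have : uniq cbs by []. rewrite El cat_uniq /= negb_or => /and3P[_ /andP[? _] _] //.
    - by move=> b0; apply: tk.
    - by move=> b0 k kn; rewrite Em0 // HP.
    - by move=> b0 k kn; rewrite Em0 // HX.
  move: HR; move: (flatten [seq ren _ _ _ _ _ _ _ _ | _ <- _]) (flatten [seq lren _ _ _ | _ <- _]) => ops lk HR.
  rewrite /= exec0_cat /=.
  have [u1 [m0' [-> Ew Em']]] : exists u1 m0',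
      [/\ ostep e (rd Env (V b' d j.+1) i (@settwd D B)) 0 (u0, m0) = (u1, m0'),
         twd u1 = m0 (V b' d j.+1, i) & forall x, m0' x = m0 x].
    by do 2!eexists; split; [reflexivity | reflexivity | move=> x /=; rewrite wbE].
  have [|E1 [Iw Im]] := HR u1 m0'.
    split=> //; rewrite Ew J2 ?ltnn ?andbF // Vm // HV //.
    by rewrite renw_start.
  move: E1 Iw Im; case: (exec0 e ops (u1, m0')) => -[u2 m2] l2 /= -> Iw Im.
  split=> //; split=> [i'|c nc]; last first.
    rewrite ifF; last by apply/eqP => Ec; rewrite Ec /= eqxx ltnS leqnn in nc.
    rewrite Im J2 //; move: nc; case: eqP => //= _; lia.
  rewrite ltnS leq_eqVlt xpair_eqE eqxx /=; case: eqP => [->|ne] /=.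
    by rewrite Iw renw_end.
  by move=> lt; rewrite Im J1.
by move=> u m Em; apply: Hl; split=> // c _; apply: Em.
Qed.

Definition lmerge : seq Cell :=
  loop H lmergeA ++ loop H lmergeB ++ loop H (fun d => lgather b' d j.+1 (Pi d j.+1 w')).

Lemma merge_htr : htr e (fun _ m => afterI j m) (merge Env D B H t.+1 j) lmerge
  (fun _ m => afterI j.+1 m).
Proof.
move=> u m0 [I0 N0 O0].
have repP d (b : bool) i : d < H -> i < 2 ^ j ->
   [/\ permOK m0 (Pb d b) b d j, tok (nn j) (Pb d b) &
      m0 (X b d j, posn (Pb d b) i) = ent (LV j) d (b * 2 ^ j + i)].
  move=> dH ilt; set s := w' * 2 ^ j.+1 + (b * 2 ^ j + i).
  have ib : b * 2 ^ j + i < 2 ^ j.+1 by rewrite expnS; case: b {s}; lia.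
  have s1 : start <= s by rewrite mstart leq_addr.
  have st : s < t.+1 by rewrite /s {2}mw_t mulSn addnC ltn_add2r.
  have Es : s = (2 * w' + b) * 2 ^ j + i by rewrite /s expnS; lia.
  have Eq : q j s = 2 * w' + b by rewrite Es qM.
  have Em : s %% 2 ^ j = i by rewrite Es modnMDl modn_small.
  have [E1 E2] := LVwin s1 st.
  have [] := I0 d s dH (leq_trans mlo s1) st.
  rewrite /cellc /sbuf /stp E1 Eq Em.
  have -> : odd (2 * w' + b) = b by rewrite oddD oddM /=; case: (b).
  by move=> p tk Hm; split.
have HPA d (b : bool) : d < H -> permOK m0 (Pb d b) b d j /\ tok (nn j) (Pb d b).
  by move=> dH; have [|//] := repP d b 0 dH; rewrite ?expn_gt0.
rewrite /merge exec0_cat /=; have [-> [SA FA]] := (mergeA_htr HPA : htr _ _ _ _ _) u m0 (fun c => erefl (m0 c)).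
case: (exec0 e (loop H (mergeA _ _ _ _ _)) _).1 SA FA => u1 m1 /= SA FA.
have tagA1 (c : Cell) : tagA c.1 \in [:: 0; 2; 3; 6] -> m1 c = m0 c.
  move=> Ht; apply: FA => d _; apply/negP => Hc; rewrite !inE in Hc.
  by do 6?case/orP: Hc => [/eqP Ec|Hc]; rewrite ?Ec ?(eqP Hc) in Ht.
have newj d : d < H -> permOK m0 (Pi d j.+1 w') b' d j.+1 /\ tok (nn j.+1) (Pi d j.+1 w').
  by move=> dH; apply: N0.
have HV1 d i : d < H -> i < 2 ^ j.+1 -> m1 (V b' d j.+1, i) = ent (LV j) d i.
  move=> dH ilt; have [S1 _] := SA d dH.
  have ij : i %% 2 ^ j < 2 ^ j by apply: mod_lt.
  have Ei : i = odd (q j i) * 2 ^ j + i %% 2 ^ j.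
    have q2 : q j i < 2 by rewrite q_lt -expnS.
    by rewrite {1}(q_eq j i); congr (_ * _ + _); case: (q j i) q2 => [|[|]].
  by rewrite Ei S1 //; have [_ _ ->] := repP d (odd (q j i)) _ dH ij.
have HP1 d b k : d < H -> k < nn j -> num (m1 (P b d j, k)) = posn (Pb d b) k.
  by move=> dH kn; have [[_ _ p3] _] := HPA d b dH; rewrite tagA1 // p3.
have HX1 d (b : bool) k : d < H -> k < 2 ^ j ->
    num (m1 (X b d j, posn (Pb d b) k)) = posn (Pi d j.+1 w') (b * 2 ^ j + k).
  move=> dH kn; have [_ S2] := SA d dH; rewrite S2 //.
  have [[_ _ p3] _] := newj d dH; rewrite p3 // /nn expnS.
  by case: b; lia.
have HT1 d b : d < H -> tok (nn j) (Pb d b) by move=> dH; have [] := HPA d b dH.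
rewrite exec0_cat /=; have [-> [SB FB]] := (mergeB_htr HV1 HT1 HP1 HX1 : htr _ _ _ _ _) u1 m1 (fun c => erefl (m1 c)).
case: (exec0 e (loop H (mergeB _ _ _ _ _ _)) _).1 SB FB => u2 m2 /= SB FB.
have tagA2 (c : Cell) : tagA c.1 \in [:: 0; 2; 3; 6] -> m2 c = m0 c.
  by move=> Ht; rewrite FB ?tagA1 // => d _ Ec; rewrite Ec in Ht.
have newj2 d : d < H -> permOK m2 (Pi d j.+1 w') b' d j.+1 /\ tok (nn j.+1) (Pi d j.+1 w').
  move=> dH; have [p tk] := newj d dH; split=> //; apply: permOK_tag p => c Ht.
  by apply: tagA2; move: Ht; rewrite !inE => /or3P[] ->; rewrite ?orbT.
have [-> [SC FC]] := (gathers_htr newj2 : htr _ _ _ _ _) u2 m2 (fun c => erefl (m2 c)).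
case: (exec0 e (loop H (fun d => gather _ _ _ _ _ _)) _).1 SC FC => u3 m3 /= SC FC.
have tagA3 (c : Cell) : tagA c.1 \in [:: 0; 2; 3; 6] -> m3 c = m0 c.
  by move=> Ht; rewrite FC ?tagA2 // => d _; split=> Ec; rewrite Ec in Ht.
have tag3 (c : Cell) : tagA c.1 \in [:: 0; 2; 3] -> m3 c = m0 c.
  by move=> Ht; apply: tagA3; move: Ht; rewrite !inE => /or3P[] ->; rewrite ?orbT.
split=> //; split; last by move=> lt; rewrite tagA3 // O0.
  move=> d s dH al st; case: (leqP start s) => [s1|s1].
    have [E1 E2] := LVwin s1 st; have [Es1 Es2] := mname s1 st.
    have Eq : q j.+1 s = w' by rewrite -(win_q jl st s1).
    rewrite /cellc /stp /sbuf E2 Eq; have [p tk] := newj d dH.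
    split=> //; first exact: permOK_tag tag3 p.
    have ilt := mod_lt j.+1 s.
    rewrite SC ?mod_name // SB // /ent -Es2 //.
  have [E1 E2] := LVout s1; have [p tk Hm] := I0 d s dH al st.
  have alt := leq_trans (lo_next D t) al.
  have stt : s < t by have := expn_gt0 2 j.+1; lia.
  move: p tk Hm; rewrite /cellc /stp /sbuf E1 E2 => p tk Hm.
  split=> //; first exact: permOK_tag tag3 p.
  have nj := out_lv alt s1.
  have nb : lv s t = j.+1 -> odd (q (lv s t) s) <> b'.
    by move=> Ej; rewrite Ej; apply: (buf_free jl stt alt Ej).
  rewrite FC; last first.
    by move=> d' _; split=> //= -[Eb Ed El]; apply: nb.
  rewrite FB; last by move=> d' _.
  rewrite FA ?Hm; last first.
    move=> d' _; rewrite !inE /=; apply/negP; rewrite !xpair_eqE /=.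
    by rewrite (introF eqP nj) !andbF.
  (* The node is older than the merged window, hence so are its children, and its pointers remain
     right. *)
  case: ifP => // /eqP Ls; apply: node_lvf => s' c Hs'.
  have lt : s' < start by apply: leq_ltn_trans (slotn_le Hs' Ls) s1.
  by have [-> ->] := LVout lt.
move=> d j' dH j'l; have [p tk] := N0 d j' dH j'l; split=> //; exact: permOK_tag tag3 p.
Qed.

End Merge.

Definition lbody : seq Cell :=
  lroot ++ loop H lwalk ++ loop H (fun d => lgather (odd t) d 0 (Pi d 0 t)) ++
  loop (lvl t.+1) lmerge.

Lemma body_htr :
  htr e (fun _ m => Inv lt0 (lo t) t m /\ newP m) (body D H sel t) lbody
    (fun _ m => Inv (fun s => lv s t.+1) (lo t.+1) t.+1 m /\
       (dd t < H -> wdat (m (O, 0)) = mm t (dd t) (v t))).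
Proof.
move=> u m [I0 N0]; rewrite /body exec0_cat /=.
have [-> R0] := (root_htr I0 : htr _ _ _ _ _) u m (fun c => erefl (m c)).
case: (exec0 e (root Env D B t) (u, m)).1 R0 => u1 m1 /= R0; rewrite exec0_cat /=.
have W : htr e (walkI m 0) (loop H (walkstep D H sel t)) (loop H lwalk) (walkI m H).
  apply: htr_loop => d dH; apply: walk_htr => // d1.
  by have := N0 d.+1 0 d1 (leq0n _); rewrite q0 /= => -[].
have [-> W1] := W u1 m1 R0.
case: (exec0 e (loop H (walkstep _ _ _ _)) _).1 W1 => u2 m2 /= W1; rewrite exec0_cat /=.
have HG d : d < H -> permOK m2 (Pi d 0 t) (odd t) d 0 /\ tok (nn 0) (Pi d 0 t).
  move=> dH; have := N0 d 0 dH (leq0n _); rewrite q0 /= => -[p tk]; split=> //.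
  apply: permOK_tag p => c Ht; have [_ _ F _] := W1; rewrite F //.
  by move: Ht; case: (tagA c.1) => [|[|[|[|]]]].
have [-> [G1 G2]] := (gathers_htr HG : htr _ _ _ _ _) u2 m2 (fun c => erefl (m2 c)).
case: (exec0 e (loop H (fun d => gather _ _ _ _ _ _)) _).1 G1 G2 => u3 m3 /= G1 G2.
have A0 := walk_after I0 N0 W1 G1 G2.
have M : htr e (fun _ m => afterI 0 m) (loop (lvl t.+1) (merge Env D B H t.+1)) (loop (lvl t.+1) lmerge)
    (fun _ m => afterI (lvl t.+1) m).
  apply: (htr_loop (I := fun i _ m => afterI i m)) => i; exact: merge_htr.
have [-> [If _ Of]] := M u3 m3 A0.
split=> //; split=> // d s dH al st.
have Elv s' : lo t.+1 <= s' -> s' < t.+1 -> LV (lvl t.+1) s' = lv s' t.+1.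
  by move=> al' st'; rewrite lv_next.
have [] := If d s dH al st; rewrite /cellc /stp /sbuf Elv // => p tk Hm; split=> //.
rewrite Hm; case: ifP => // _; apply: node_lvf => s' c Hs'; apply: Elv.
  exact: recent_slot Hs'.
exact: slot_lt Hs'.
Qed.

End Access.
End Layout.
End Logic.

(** * Obliviousness *)

Section Relational.
Variables (Env Tmp Wd : Type) (Cell : eqType) (vs : Cell -> option Cell).
Notation op := (op Env Tmp Wd Cell).
Notation astate := (astate Tmp Wd Cell).

(* Two runs of the same program are coupled so that the visible addresses agree. *)
Definition rtr (e0 e1 : Env) (ops : seq op) (Phi Psi : astate -> astate -> Prop) : Prop :=
  forall s0 s1, Phi s0 s1 -> forall F0 F1 : astate -> seq (option Cell) -> rat,
  (forall t0 t1 l, Psi t0 t1 -> F0 t0 l = F1 t1 l) ->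
  aex e0 ops s0 (fun s l => F0 s (map vs l)) = aex e1 ops s1 (fun s l => F1 s (map vs l)).

Lemma rtr_cat e0 e1 o1 o2 P Q R : rtr e0 e1 o1 P Q -> rtr e0 e1 o2 Q R ->
  rtr e0 e1 (o1 ++ o2) P R.
Proof.
move=> H1 H2 s0 s1 Hs F0 F1 HF; rewrite !aex_cat.
pose G e (F : astate -> seq (option Cell) -> rat) s l :=
  aex e o2 s (fun s' l' => F s' (l ++ map vs l')).
have EG e s F : aex e o1 s (fun st1 l1 => aex e o2 st1 (fun st2 l2 => F st2 (map vs (l1 ++ l2)))) =
    aex e o1 s (fun s l => G e F s (map vs l)).
  by apply: eq_aex => st l; apply: eq_aex => st' l'; rewrite map_cat.
rewrite !EG; apply: (H1 s0 s1 Hs (G e0 F0) (G e1 F1)) => t0 t1 l Ht.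
apply: (H2 t0 t1 Ht (fun s' l' => F0 s' (l ++ l')) (fun s' l' => F1 s' (l ++ l'))) => *.
exact: HF.
Qed.

Lemma rtr_nil e0 e1 P : rtr e0 e1 [::] P P.
Proof. by move=> s0 s1 Hs F0 F1 HF; apply: HF. Qed.

Lemma rtr_sub e0 e1 o (P P' Q Q' : astate -> astate -> Prop) :
  (forall s0 s1, P' s0 s1 -> P s0 s1) -> (forall s0 s1, Q s0 s1 -> Q' s0 s1) ->
  rtr e0 e1 o P Q -> rtr e0 e1 o P' Q'.
Proof. by move=> PP QQ H s0 s1 /PP Hs F0 F1 HF; apply: H => // t0 t1 l /QQ; apply: HF. Qed.

Lemma rtr_loop e0 e1 (I : nat -> astate -> astate -> Prop) n body :
  (forall i, i < n -> rtr e0 e1 (body i) (I i) (I i.+1)) ->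
  rtr e0 e1 (loop n body) (I 0) (I n).
Proof.
elim: n => [|n IH] H; first exact: rtr_nil.
rewrite loopS; apply: rtr_cat (H n (ltnSn n)); apply: IH => i lt; exact/H/leqW.
Qed.

Lemma rtr_det e0 e1 o (P Q : astate -> astate -> Prop) : det o ->
  (forall s0 s1, P s0 s1 ->
     map vs (exec0 e0 o s0).2 = map vs (exec0 e1 o s1).2 /\ Q (exec0 e0 o s0).1 (exec0 e1 o s1).1) ->
  rtr e0 e1 o P Q.
Proof.
move=> dt H s0 s1 Hs F0 F1 HF; rewrite !aex_det //.
by have [-> HQ] := H s0 s1 Hs; apply: HF.
Qed.

Lemma eq_lmap n (f g : nat -> seq Cell) : (forall i, i < n -> map vs (f i) = map vs (g i)) ->
  map vs (loop n f) = map vs (loop n g).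
Proof. by move=> fg; rewrite !map_loop; apply: eq_loop. Qed.

End Relational.

Section Leaks.
Variables (D B H : nat) (b : server).
Notation E := D.+1.
Notation vs := (@vis Cell colf b).
Notation tapes := (seq nat * seq nat)%type.
Notation lvl := (lvl D).

Lemma vs_cell A i i' : (colA A != b -> i = i') -> vs (A, i) = vs (A, i').
Proof. by rewrite /vis /colf /=; case: eqP => //= _ /(_ isT) ->. Qed.

Lemma vs_cat (l1 l2 l1' l2' : seq Cell) : map vs l1 = map vs l1' -> map vs l2 = map vs l2' ->
  map vs (l1 ++ l2) = map vs (l1' ++ l2').
Proof. by move=> E1 E2; rewrite !map_cat E1 E2. Qed.

Lemma vs_lput K Sr T f f' n : (colA T != b -> forall p, p < n -> f p = f' p) ->
  map vs (lput K Sr T f n) = map vs (lput K Sr T f' n).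
Proof.
move=> Hf; apply: eq_lmap => p pn /=; congr [:: _; _; _].
by apply: vs_cell => /Hf ->.
Qed.

Lemma vs_lget K Sr T f f' n : (colA Sr != b -> forall p, p < n -> f p = f' p) ->
  map vs (lget K Sr T f n) = map vs (lget K Sr T f' n).
Proof.
move=> Hf; apply: eq_lmap => p pn /=; congr [:: _; _; _].
by apply: vs_cell => /Hf ->.
Qed.

Lemma col0 A : tagA A \in [:: 0; 1; 2] -> colA A != b -> (b : nat) <> 0.
Proof.
by rewrite /colA !inE => /or3P[] /eqP -> /=; rewrite -val_eqE /= inordK // => /eqP ? ?; lia.
Qed.
Lemma col1 A : tagA A \in [:: 3; 4] -> colA A != b -> (b : nat) <> 1.
Proof.
by rewrite /colA !inE => /orP[] /eqP -> /=; rewrite -val_eqE /= inordK // => /eqP ? ?; lia.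
Qed.
Lemma col2 A : tagA A \in [:: 5; 6] -> colA A != b -> (b : nat) <> 2.
Proof.
by rewrite /colA !inE => /orP[] /eqP -> /=; rewrite -val_eqE /= inordK // => /eqP ? ?; lia.
Qed.

Lemma vs_lscatter bb d j r a a' t t' : tsim b r a a' t t' ->
  map vs (lscatter bb d j t) = map vs (lscatter bb d j t').
Proof.
move=> [h0 h1 _]; rewrite /lscatter !map_cat; congr (_ ++ _).
  by apply: vs_lput => cb p _; rewrite h1 //; apply: col1 cb.
by apply: vs_lput => cb p _; rewrite h0 //; apply: col0 cb.
Qed.

Lemma vs_lgather bb d j r a a' t t' : tsim b r a a' t t' ->
  map vs (lgather bb d j t) = map vs (lgather bb d j t').
Proof.
move=> [h0 h1 _]; rewrite /lgather !map_cat; congr (_ ++ _).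
  by apply: vs_lget => cb p _; rewrite h0 //; apply: col0 cb.
by apply: vs_lget => cb p _; rewrite h1 //; apply: col1 cb.
Qed.

Lemma vs_lfy K i ks ks' : (colA K != b -> ks = ks') -> size ks = size ks' ->
  map vs (lfy K i ks) = map vs (lfy K i ks').
Proof.
have [Ec|nc] := eqVneq (colA K) b; last by move=> ->.
move=> _; elim: ks ks' i => [|k ks IH] [|k' ks'] i //= [sk]; rewrite (IH ks') //.
by congr [:: _, _ & _]; apply: vs_cell; rewrite Ec eqxx.
Qed.

Lemma vs_lsetup bb d j r a a' t t' : tok (nn j) t -> tok (nn j) t' -> tsim b r a a' t t' ->
  map vs (lsetup bb d j t) = map vs (lsetup bb d j t').
Proof.
move=> /andP[/ftpP[s1 _] /ftpP[s2 _]] /andP[/ftpP[s1' _] /ftpP[s2' _]] [h0 h1 _].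
rewrite /lsetup !map_cat; congr (_ ++ (_ ++ (_ ++ (_ ++ _)))).
- by apply: vs_lfy => [cb|]; rewrite ?s1 ?s1' //; apply: h0; apply: col0 cb.
- by apply: vs_lfy => [cb|]; rewrite ?s2 ?s2' //; apply: h1; apply: col1 cb.
- by apply: vs_lput => cb p _; rewrite h1 //; apply: col1 cb.
- by apply: vs_lput => cb p _; rewrite h0 //; apply: col0 cb.
Qed.

Variables (v0 v1 : nat -> nat) (Pi0 Pi1 : nat -> nat -> nat -> tapes).
Notation tsims d j w := (tsim b (5 * 2 ^ j) (nm D v0 d j w) (nm D v1 d j w) (Pi0 d j w) (Pi1 d j w)).

(** A window enters this relation when it is complete, its structure being shuffled during its last
    access. The names compared are those of all its lookups, which are still to come. *)
Definition simPi t := forall d j w, d < H -> j <= E -> w.+1 * 2 ^ j <= t -> tsims d j w.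

Variable t : nat.
Hypothesis sim : simPi t.+1.

Lemma vs_posn d j w k : tsims d j w -> k < 5 * 2 ^ j -> forall bb,
  vs (X bb d j, posn (Pi0 d j w) (nm D v0 d j w k)) = vs (X bb d j, posn (Pi1 d j w) (nm D v1 d j w k)).
Proof. by move=> [_ _ h2] kj bb; apply: vs_cell => cb; apply: h2 => //; apply: col2 cb. Qed.

Lemma vs_lwalk d : d < H -> map vs (lwalk D v0 Pi0 t d) = map vs (lwalk D v1 Pi1 t d).
Proof.
move=> dH; rewrite /lwalk !map_cat; congr (_ ++ _); rewrite !map_flatten -!map_comp.
congr flatten; apply/eq_in_map => j; rewrite /act mem_filter mem_iota /= => /andP[ac jE].
congr [:: _; _]; apply: vs_posn; last by have := mod_lt j t; lia.
apply: sim => //; rewrite prednK ?(active_gt0 ac) //.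
by apply: leqW; rewrite -q_geq.
Qed.

Lemma vs_lmerge j : j < lvl t.+1 -> map vs (lmerge D H v0 Pi0 t j) = map vs (lmerge D H v1 Pi1 t j).
Proof.
move=> jl; have jE := leq_trans jl (lvl_le D t.+1); have Et := mw_t jl.
have sc d (bb : bool) : d < H -> tsims d j (2 * (q j.+1 t.+1).-1 + bb).
  move=> dH; apply: sim => //; first exact: ltnW.
  by rewrite {2}Et expnS; case: bb; nia.
have sp d : d < H -> tsims d j.+1 (q j.+1 t.+1).-1.
  by move=> dH; apply: sim => //; rewrite -Et.
rewrite /lmerge !map_cat; congr (_ ++ (_ ++ _)).
- apply: eq_lmap => d dH; rewrite /lmergeA !map_flatten -!map_comp.
  congr flatten; apply: eq_map => bb; apply: vs_cat; first exact: vs_lscatter (sc d bb dH).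
  by apply: vs_cat => //; apply: vs_cat => //; exact: vs_lgather (sc d bb dH).
- apply: eq_lmap => d dH; rewrite /lmergeB; case: ifP => // d1.
  apply: eq_lmap => i ilt; rewrite map_cons [RHS]map_cons; congr (_ :: _); apply: vs_cat => //.
  rewrite !map_flatten -!map_comp; congr flatten; apply: eq_map => -[c bb] /=.
  congr [:: _; _]; apply: vs_posn; first exact: sc.
  by move: ilt; rewrite expnS; case: c; lia.
- by apply: eq_lmap => d dH; apply: vs_lgather (sp d dH).
Qed.

Lemma vs_lbody : map vs (lbody D H v0 Pi0 t) = map vs (lbody D H v1 Pi1 t).
Proof.
rewrite /lbody !map_cat; congr (_ ++ (_ ++ (_ ++ _))).
- by apply: eq_lmap => d; apply: vs_lwalk.
- apply: eq_lmap => d dH; apply: vs_lgather; apply: (sim dH (leq0n _)).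
  by rewrite expn0 muln1.
- by apply: eq_lmap => j; apply: vs_lmerge.
Qed.

End Leaks.

(** * Fresh shuffles and the coupling of two runs *)

Section SetupStep.
Variables (Env : Type) (D B H : nat).
Notation E := D.+1.
Notation tapes := (seq nat * seq nat)%type.
Notation lvl := (lvl D).
Notation lo := (lo D).
Notation lv := (lv D).
Notation mem := (Cell -> Wd D B).
Variables (v dd : nat -> nat) (ww : nat -> option (block B)).
Hypothesis v_lt : forall t, v t < 2 ^ D.
Hypothesis sweep : forall p x, x < 2 ^ D -> exists s, [/\ p * 2 ^ E <= s, s < p.+1 * 2 ^ E & v s = x].
Notation Inv := (@Inv D B H v dd ww).

Definition upd (Pi : nat -> nat -> nat -> tapes) d j w tp d' j' w' :=
  if [&& d' == d, j' == j & w' == w] then tp else Pi d' j' w'.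

Definition prepared t (Pi : nat -> nat -> nat -> tapes) (m : mem) d j : Prop :=
  let w := (q j t.+1).-1 in permOK m (Pi d j w) (odd w) d j /\ tok (nn j) (Pi d j w).

Lemma setup_inv e t Pi d j tp s : d < H -> j <= lvl t.+1 -> tok (nn j) tp ->
  let w := (q j t.+1).-1 in
  let m' := (@setup_st Env D B e (odd w) d j tp s).2 in
  Inv Pi (lt0 D t) (lo t) t s.2 ->
  [/\ Inv (upd Pi d j w tp) (lt0 D t) (lo t) t m',
      prepared t (upd Pi d j w tp) m' d j &
      forall d' j', (d', j') != (d, j) -> prepared t Pi s.2 d' j' ->
        prepared t (upd Pi d j w tp) m' d' j'].
Proof.
move=> dH jl tk w m' I0; have jE := leq_trans jl (lvl_le D t.+1).
have [_ pOK fr] := setup_spec e (odd w) d s jE tk.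
rewrite -/(setup_st e (odd w) d j tp s) -/m' in pOK fr.
have Ew : w = q j t by rewrite /w (lvl_q jl).
have fresh d' s' : lo t <= s' -> s' < t -> upd Pi d j w tp d' (lv s' t) (q (lv s' t) s') =
    Pi d' (lv s' t) (q (lv s' t) s').
  move=> al st; rewrite /upd ifF //; apply/negP => /and3P[_ /eqP Ej /eqP Eq].
  have [_] := lv_active st al; rewrite Eq Ej Ew; lia.
split; first 1 last.
- by split; rewrite /upd !eqxx.
- move=> d' j' ne [p' tk']; have Eu : upd Pi d j w tp d' j' (q j' t.+1).-1 = Pi d' j' (q j' t.+1).-1.
    by rewrite /upd ifF //; apply/negP => /and3P[/eqP E1 /eqP E2 _]; rewrite E1 E2 eqxx in ne.
  rewrite /prepared Eu; split=> //; apply: permOK_frame p' => c Hc; apply: fr; right.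
  have [-> ->] : c.1.1.2 = d' /\ c.1.2 = j'.
    by move: Hc; rewrite !inE => /or3P[] /eqP ->.
  have [E1|E1] := eqVneq d' d; last by left; apply/eqP.
  by right; move=> E2; rewrite E1 E2 eqxx in ne.
- move=> d' s' dH' al st; have [p' tk' m'E] := I0 d' s' dH' al st.
  have ne : odd (q (lv s' t) s') <> odd w \/ lv s' t <> j.
    have [Ej|Ej] := eqVneq (lv s' t) j; last by right; apply/eqP.
    by left; rewrite Ej; apply: (buf_free jl st al Ej).
  have frc (c : Cell) : c.1.1.1.2 = odd (q (lv s' t) s') -> c.1.2 = lv s' t -> m' c = s.2 c.
    by move=> E1 E2; apply: fr; rewrite E1 E2; case: ne => ?; [left | right; right].
  rewrite /stp /sbuf /cellc /stp /lt0 /= fresh //; split=> //.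
    apply: permOK_frame p' => c; rewrite !inE => /or3P[] /eqP Ec; apply: frc; by rewrite Ec.
  rewrite frc // -/(lt0 D t s') m'E; case: ifP => // _.
  have Hs c x : slotp D H v (upd Pi d j w tp) (lt0 D t) t d' x c = slotp D H v Pi (lt0 D t) t d' x c.
    rewrite /slotp; case: ifP => // _; case Es : (slotn _ _ _ _ _) => [s1|] //=.
    by rewrite /ptrc /lt0 fresh //; [exact: (recent_slot v_lt sweep Es) | case/lstP: Es].
  by rewrite /node !Hs.
Qed.

End SetupStep.

Section BodyDet.
Variables (Env : Type) (D B H : nat).
Notation op := (op Env (Tmp D B) (Wd D B) Cell).

Lemma det_map T (l : seq T) (f : T -> seq op) : (forall x, det (f x)) -> det (flatten (map f l)).
Proof. by move=> Hf; elim: l => //= x l IH; rewrite det_cat Hf. Qed.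

Lemma body_det sel t : det (@body Env D B H sel t).
Proof.
rewrite /body !det_cat; apply/and4P; split.
- by rewrite /root; case: t.
- apply: loop_det => d; rewrite /walkstep det_cat andbT; exact: det_map.
- by apply: loop_det => d; exact: gather_det.
apply: loop_det => j; rewrite /merge !det_cat; apply/and3P; split; apply: loop_det => d.
- by apply: det_map => bb; rewrite det_cat scatter_det det_cat copy_det det_cat copy_det gather_det.
- rewrite /mergeB; case: ifP => // _; apply: loop_det => i.
  by rewrite -cat1s det_cat det_cat andbT.
- exact: gather_det.
Qed.

End BodyDet.

Section Coupled.
Variables (Env : Type) (D B H : nat) (b : server).
Notation E := D.+1.
Notation lvl := (lvl D).
Notation lo := (lo D).
Notation astate := (astate (Tmp D B) (Wd D B) Cell).
Notation vs := (@vis Cell colf b).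
Variables (v0 v1 dd0 dd1 : nat -> nat) (ww0 ww1 : nat -> option (block B)).
Hypothesis v0_lt : forall t, v0 t < 2 ^ D.
Hypothesis v1_lt : forall t, v1 t < 2 ^ D.
Hypothesis dd0_ge : forall t, D <= dd0 t.
Hypothesis dd1_ge : forall t, D <= dd1 t.
Hypothesis sweep0 : forall p x, x < 2 ^ D -> exists s, [/\ p * 2 ^ E <= s, s < p.+1 * 2 ^ E & v0 s = x].
Hypothesis sweep1 : forall p x, x < 2 ^ D -> exists s, [/\ p * 2 ^ E <= s, s < p.+1 * 2 ^ E & v1 s = x].
Hypothesis H_gt0 : 0 < H.
Variables (e0 e1 : Env).
Notation rtr := (rtr vs e0 e1).

(** The existential tapes stand for the shuffles drawn in the two runs. At time 0 no node and no
    complete window exists, so any two states are coupled. *)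
Definition coupled t (s0 s1 : astate) : Prop := exists Pi0 Pi1,
  [/\ Inv H v0 dd0 ww0 Pi0 (lt0 D t) (lo t) t s0.2,
      Inv H v1 dd1 ww1 Pi1 (lt0 D t) (lo t) t s1.2 & simPi D H b v0 v1 Pi0 Pi1 t].

(* The structures marked [done] have received their coupled shuffles. *)
Definition settled t (done : nat -> nat -> bool) (s0 s1 : astate) : Prop := exists Pi0 Pi1,
  [/\ Inv H v0 dd0 ww0 Pi0 (lt0 D t) (lo t) t s0.2,
      Inv H v1 dd1 ww1 Pi1 (lt0 D t) (lo t) t s1.2, simPi D H b v0 v1 Pi0 Pi1 t &
      forall d j, d < H -> j <= lvl t.+1 -> done d j ->
        let w := (q j t.+1).-1 in
        [/\ prepared t Pi0 s0.2 d j, prepared t Pi1 s1.2 d j &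
            tsim b (5 * 2 ^ j) (nm D v0 d j w) (nm D v1 d j w) (Pi0 d j w) (Pi1 d j w)]].

(** The only place where randomness is compared: the sum over the tapes of one run is reindexed by
    the bijection of [tape_coupling], taken for the names that the two request sequences will look
    up in this window. *)
Lemma setup_rtr t d j (done done' : nat -> nat -> bool) : d < H -> j <= lvl t.+1 ->
  (forall d' j', done' d' j' -> (d' == d) && (j' == j) || done d' j') ->
  rtr (setup Env D B (odd (q j t.+1).-1) d j) (settled t done) (settled t done').
Proof.
move=> dH jl Hd s0 s1 [Pi0 [Pi1 [I0 I1 sim Hdone]]] F0 F1 HF; set w := (q j t.+1).-1.
have jE := leq_trans jl (lvl_le D t.+1).
have nl v : forall k, k < 5 * 2 ^ j -> nm D v d j w k < nn j by move=> k; apply: nm_lt.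
have [h [hok hinj hsim]] := @tape_coupling b (5 * 2 ^ j) (nn j) (nm D v0 d j w) (nm D v1 d j w)
  (ltn_ord b) (nl v0) (nl v1) (@nm_inj D v0 d j w) (@nm_inj D v1 d j w).
rewrite !setup_aex //; congr (_ * _)%R; apply: (tpairs_sum hok hinj) => tp tk.
have tk' := hok tp tk; rewrite (vs_lsetup (odd w) d tk tk' (hsim tp tk)); apply: HF.
have [J0 P0 F0'] := setup_inv v0_lt sweep0 e0 dH jl tk I0.
have [J1 P1 F1'] := setup_inv v1_lt sweep1 e1 dH jl tk' I1.
have Ew : w.+1 * 2 ^ j = t.+1 by rewrite prednK ?(lvl_q jl) // -(lvl_q jl) -(lvl_mul jl).
exists (upd Pi0 d j w tp), (upd Pi1 d j w (h tp)); split=> //.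
  move=> d' j' w' dH' jE' tw; have Eu Pi x : upd Pi d j w x d' j' w' = Pi d' j' w'.
    rewrite /upd ifF //; apply/negP => /and3P[_ /eqP E1 /eqP E2].
    by move: tw; rewrite E1 E2 Ew ltnn.
  by rewrite !Eu; apply: sim.
move=> d' j' dH' jl' /Hd; case: eqP => [->|dd]; case: eqP => [->|jj] //=.
- by move=> _; split=> //; rewrite /upd !eqxx; apply: hsim.
- move=> D'; have [p0 p1 ts] := Hdone _ _ dH jl' D'; have ne : (d, j') != (d, j).
    by apply/eqP => -[].
  by split; [exact: F0' | exact: F1' |]; rewrite /upd (introF eqP jj) andbF.
- move=> D'; have [p0 p1 ts] := Hdone _ _ dH' jl D'; have ne : (d', j) != (d, j).
    by apply/eqP => -[].
  by split; [exact: F0' | exact: F1' |]; rewrite /upd (introF eqP dd).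
- move=> D'; have [p0 p1 ts] := Hdone _ _ dH' jl' D'; have ne : (d', j') != (d, j).
    by apply/eqP => -[].
  by split; [exact: F0' | exact: F1' |]; rewrite /upd (introF eqP dd).
Qed.

Lemma setups_rtr t : rtr (setups Env D B H t.+1) (coupled t) (settled t (fun _ _ => true)).
Proof.
apply: (@rtr_sub _ _ _ _ vs e0 e1 _ (settled t (fun _ j => j < 0)) _ (settled t (fun _ j => j < (lvl t.+1).+1))).
- by move=> s0 s1 [Pi0 [Pi1 [? ? ?]]]; exists Pi0, Pi1.
- by move=> s0 s1 [Pi0 [Pi1 [? ? ? Hd]]]; exists Pi0, Pi1; split=> // d j dH jl _; apply: Hd.
rewrite /setups; apply: (rtr_loop (I := fun j => settled t (fun _ j' => j' < j))) => j; rewrite ltnS => jl.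
apply: (@rtr_sub _ _ _ _ vs e0 e1 _ (settled t (fun d' j' => (j' < j) || (j' == j) && (d' < 0))) _
  (settled t (fun d' j' => (j' < j) || (j' == j) && (d' < H)))).
- move=> s0 s1 [Pi0 [Pi1 [? ? ? Hd]]]; exists Pi0, Pi1; split=> // d j' dH jl'.
  by rewrite andbF orbF; apply: Hd.
- move=> s0 s1 [Pi0 [Pi1 [? ? ? Hd]]]; exists Pi0, Pi1; split=> // d j' dH jl' j'j.
  by apply: Hd => //; rewrite dH andbT orbC -leq_eqVlt -ltnS.
apply: (rtr_loop (I := fun d => settled t (fun d' j' => (j' < j) || (j' == j) && (d' < d)))) => d dH.
apply: setup_rtr => // d' j' /orP[->|/andP[-> ]]; first by rewrite orbT.
by rewrite ltnS leq_eqVlt andbT => /orP[->|->] //; rewrite !orbT.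
Qed.

Definition answered t (s0 s1 : astate) : Prop :=
  [/\ coupled t.+1 s0 s1, dd0 t < H -> wdat (s0.2 (O, 0)) = mm v0 dd0 ww0 t (dd0 t) (v0 t) &
      dd1 t < H -> wdat (s1.2 (O, 0)) = mm v1 dd1 ww1 t (dd1 t) (v1 t)].

(** After the set-ups an access is deterministic, and its address list is an explicit function of
    paths and tapes. It remains to compare the visible parts of two such lists. *)
Lemma access_rtr (sel : Env -> nat * nat * option (block B)) t :
  sel e0 = (v0 t, dd0 t, ww0 t) -> sel e1 = (v1 t, dd1 t, ww1 t) ->
  rtr (accessp D H sel t) (coupled t) (answered t).
Proof.
move=> Es0 Es1; rewrite /accessp; apply: (rtr_cat (@setups_rtr t)); apply: rtr_det; first exact: body_det.
move=> [u0 m0] [u1 m1] [Pi0 [Pi1 [/= I0 I1 sim Hd]]].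
(* A window that becomes complete with access [t] is among those just settled, since its length
   divides [t.+1]. *)
have sim' : simPi D H b v0 v1 Pi0 Pi1 t.+1.
  move=> d j w dH jE; rewrite leq_eqVlt => /orP[/eqP Ew|]; last exact: sim.
  have jl : j <= lvl t.+1.
    rewrite leqNgt; apply/negP => lt; have /negP[] := lvl_ndvd (leq_trans lt jE).
    by rewrite -[X in _ %| X]Ew dvdn_mull // dvdn_exp2l.
  have -> : w = (q j t.+1).-1 by rewrite -Ew /q mulnK ?expn_gt0.
  by have [] := Hd d j dH jl isT.
have N0 : newP H Pi0 t m0 by move=> d j dH jl; have [] := Hd d j dH jl isT.
have N1 : newP H Pi1 t m1 by move=> d j dH jl; have [] := Hd d j dH jl isT.
have [-> [J0 O0]] := (body_htr v0_lt dd0_ge sweep0 Es0 H_gt0 : htr _ _ _ _ _) u0 m0 (conj I0 N0).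
have [-> [J1 O1]] := (body_htr v1_lt dd1_ge sweep1 Es1 H_gt0 : htr _ _ _ _ _) u1 m1 (conj I1 N1).
by split; [exact: vs_lbody | split=> //; exists Pi0, Pi1].
Qed.

End Coupled.

(** * Requests *)

Section Requests.
Variables (N B L D : nat).
Hypothesis L_gt0 : 0 < L.
Hypothesis LD : N %/ L < 2 ^ D.
Notation E := D.+1.
Notation H := (D + L).
Notation Env := ('I_N * option (block B))%type.
Notation mem := (Cell -> Wd D B).
Notation Tmp := (Tmp D B).
Notation op := (op Env Tmp (Wd D B) Cell).
Notation rtr b := (rtr (@vis Cell colf b)).

(* A request is served by two accesses. The first one visits the paths in turn and
   touches no data, as no node has depth [H]; it bounds the age of live nodes. The
   block [a] is the datum of depth [D + a %% L] on the path [a %/ L]. *)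
Definition sweepsel t : Env -> nat * nat * option (block B) := fun _ => (t %% 2 ^ D, H, None).
Definition usersel (e : Env) : nat * nat * option (block B) := (e.1 %/ L, D + e.1 %% L, e.2).

Definition answerop : op := rd Env O 0 (fun u w => (u.1, wdat w)).

Definition prog t : seq op :=
  accessp D H (sweepsel t) t.*2 ++ accessp D H usersel t.*2.+1 ++ [:: answerop].

Section Sequence.
Variables (a0 : 'I_N) (R : seq (request N B)).
Definition req t : request N B := nth (Read a0) R t.
Definition acc_path t : nat := if odd t then req_addr (req t./2) %/ L else t./2 %% 2 ^ D.
Definition acc_depth t : nat := if odd t then D + req_addr (req t./2) %% L else H.
Definition acc_data t : option (block B) := if odd t then (env (req t./2)).2 else None.

Lemma acc_path_lt t : acc_path t < 2 ^ D.
Proof.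
rewrite /acc_path; case: ifP => _; last by apply: mod_lt.
by apply: leq_ltn_trans LD; apply: leq_div2r; apply: ltnW.
Qed.

Lemma acc_depth_ge t : D <= acc_depth t.
Proof. by rewrite /acc_depth; case: ifP => _; apply: leq_addr. Qed.

Lemma acc_path_sweep p x : x < 2 ^ D -> exists s, [/\ p * 2 ^ E <= s, s < p.+1 * 2 ^ E & acc_path s = x].
Proof.
move=> xD; exists (p * 2 ^ D + x).*2; rewrite /acc_path odd_double doubleK modnMDl modn_small //.
by rewrite expnS; split=> //; lia.
Qed.

Lemma sel_sweep e t : sweepsel t e = (acc_path t.*2, acc_depth t.*2, acc_data t.*2).
Proof. by rewrite /acc_path /acc_depth /acc_data odd_double doubleK. Qed.

Lemma sel_user t : usersel (env (req t)) = (acc_path t.*2.+1, acc_depth t.*2.+1, acc_data t.*2.+1).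
Proof. by rewrite /acc_path /acc_depth /acc_data /= odd_double uphalf_double; case: (req t). Qed.

Definition memat t : memory N B := foldl (@update N B) (memory0 N B) (take t R).

Lemma mm_sweep t d x : d != H -> mm acc_path acc_depth acc_data t.*2.+1 d x = mm acc_path acc_depth acc_data t.*2 d x.
Proof.
by move=> dH; rewrite /= /acc_depth odd_double [H == d]eq_sym (negbTE dH) andbF.
Qed.

Lemma addr_eq (a a' : 'I_N) : (a' %/ L == a %/ L) && (D + a' %% L == D + a %% L) = (a' == a).
Proof.
apply/andP/eqP => [[/eqP E1 /eqP/addnI E2]|->//]; apply: val_inj.
by rewrite /= (divn_eq a' L) E1 E2 -divn_eq.
Qed.

Lemma mm_ideal t (a : 'I_N) : t <= size R ->
  mm acc_path acc_depth acc_data t.*2 (D + a %% L) (a %/ L) = memat t a.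
Proof.
elim: t => [|t IH] tR; first by rewrite /memat take0 /= ffunE.
have mmS s d x : mm acc_path acc_depth acc_data s.+1 d x = if (acc_path s == x) && (acc_depth s == d)
    then odflt (mm acc_path acc_depth acc_data s d x) (acc_data s) else mm acc_path acc_depth acc_data s d x by [].
rewrite doubleS mmS mm_sweep; last by rewrite eqn_add2l neq_ltn ltn_mod L_gt0.
rewrite IH 1?ltnW // /acc_path /acc_depth /acc_data /= odd_double uphalf_double /= addr_eq.
rewrite /memat (take_nth (Read a0)) // -cats1 foldl_cat /= -/(req t).
case: (req t) => [a'|a' x] /=; first by case: eqP.
by rewrite ffunE eq_sym.
Qed.

Lemma nth_ideal t : t < size R -> nth (block0 B) (ideal R) t = memat t (req_addr (req t)).
Proof.
rewrite /ideal /memat /req; elim: R (memory0 N B) t => [|r R' IH] m [|t] //= tR.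
by rewrite IH.
Qed.

Lemma size_ideal : size (ideal R) = size R.
Proof. by rewrite /ideal; elim: R (memory0 N B) => //= r R' IH m; rewrite IH. Qed.

End Sequence.

Section Runs.
Variables (a0 : 'I_N) (b : server) (R0 R1 : seq (request N B)).
Notation cpl t := (coupled H b (acc_path a0 R0) (acc_path a0 R1) (acc_depth a0 R0) (acc_depth a0 R1) (acc_data a0 R0) (acc_data a0 R1) t).

Lemma coupled0 (s0 s1 : astate Tmp (Wd D B) Cell) : cpl 0 s0 s1.
Proof.
exists (fun _ _ _ => ([::], [::])), (fun _ _ _ => ([::], [::])); split=> // d j w _ _.
by rewrite leqn0 muln_eq0 expn_eq0.
Qed.

Lemma prog_rtr t : t < size R0 -> t < size R1 ->
  rtr b (env (req a0 R0 t)) (env (req a0 R1 t)) (prog t) (cpl t.*2) (fun s0 s1 =>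
    [/\ cpl t.+1.*2 s0 s1, tout s0.1 = nth (block0 B) (ideal R0) t &
        tout s1.1 = nth (block0 B) (ideal R1) t]).
Proof.
move=> t0 t1; have H0 : 0 < H by rewrite addn_gt0 L_gt0 orbT.
have acc := @access_rtr Env D B H b _ _ _ _ (acc_data a0 R0) (acc_data a0 R1) (acc_path_lt a0 R0) (acc_path_lt a0 R1) (acc_depth_ge a0 R0) (acc_depth_ge a0 R1)
  (acc_path_sweep a0 R0) (acc_path_sweep a0 R1) H0 (env (req a0 R0 t)) (env (req a0 R1 t)).
rewrite /prog; apply: (@rtr_cat _ _ _ _ _ _ _ _ _ _ (cpl t.*2.+1)).
  apply: (rtr_sub _ _ (acc _ _ (sel_sweep a0 R0 _ t) (sel_sweep a0 R1 _ t))) => // s0 s1.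
  by case.
apply: rtr_cat (acc _ _ (sel_user a0 R0 t) (sel_user a0 R1 t)) _.
apply: rtr_det => // -[u0 m0] [u1 m1] [/= C O0 O1]; split=> //.
(* The cell [O] holds the datum as it was before the access, which is the value due for a read and
   for a write alike; the preceding sweep has not altered it. *)
have out R (m : mem) : t < size R ->
    (acc_depth a0 R t.*2.+1 < H -> wdat (m (O, 0)) =
       mm (acc_path a0 R) (acc_depth a0 R) (acc_data a0 R) t.*2.+1 (acc_depth a0 R t.*2.+1) (acc_path a0 R t.*2.+1)) ->
    wdat (m (O, 0)) = nth (block0 B) (ideal R) t.
  move=> tR ->; last first.
    by rewrite /acc_depth /= odd_double uphalf_double ltn_add2l ltn_mod.
  rewrite mm_sweep; last by rewrite /acc_depth /= odd_double uphalf_double /= eqn_add2l neq_ltn ltn_mod L_gt0.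
  rewrite /acc_depth /acc_path /= odd_double uphalf_double /=.
  by rewrite mm_ideal 1?ltnW // (nth_ideal a0).
split; [|exact: out|exact: out].
by have [Pi0 [Pi1 [I0 I1 sim]]] := C; exists Pi0, Pi1; split.
Qed.

End Runs.

End Requests.

(** * Bounded time index *)

Section Period.
Variables (Env : Type) (D B H : nat).
Notation E := D.+1.

Section Times.
Variables t t' : nat.
Hypothesis tt' : t = t' %[mod 2 ^ D.+2].

Lemma per_mod j : j <= D.+2 -> t %% 2 ^ j = t' %% 2 ^ j.
Proof. by move=> jD; rewrite -(modn_dvdm t (dvdn_exp2l 2 jD)) tt' modn_dvdm // dvdn_exp2l. Qed.

Lemma per_odd j : j <= E -> odd (q j t) = odd (q j t').
Proof.
move=> jE; have ev s : odd (q j s) = odd (q j (s %% 2 ^ j.+1)).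
  rewrite {1}(divn_eq s (2 ^ j.+1)) /q expnS mulnA divnMDl ?expn_gt0 //.
  by rewrite oddD oddM andbF.
by rewrite ev per_mod // -ev.
Qed.

Lemma per_dvd j : j <= E -> (2 ^ j.+1 %| t) = (2 ^ j.+1 %| t').
Proof. by move=> jE; rewrite /dvdn per_mod. Qed.

Lemma per_lvl : lvl D t = lvl D t'.
Proof.
by apply: eq_in_find => j; rewrite mem_iota => /andP[_ jE]; rewrite per_dvd // ltnW.
Qed.

End Times.

(** The parity of a predecessor is the opposite parity only for positive numbers. This is why the
    program becomes periodic only once [2 ^ E] accesses are over. *)
Lemma per_pred t t' j : t = t' %[mod 2 ^ D.+2] -> 2 ^ E <= t -> 2 ^ E <= t' -> j <= E ->
  odd (q j t).-1 = odd (q j t').-1.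
Proof.
move=> tt' tE tE' jE; have q0 s : 2 ^ E <= s -> 0 < q j s.
  by move=> sE; rewrite q_geq mul1n; apply: leq_trans sE; rewrite leq_exp2l.
have op n : 0 < n -> odd n.-1 = ~~ odd n by case: n => //= n; rewrite negbK.
by rewrite !op ?q0 // (per_odd tt').
Qed.

Lemma per_S t t' : t = t' %[mod 2 ^ D.+2] -> t.+1 = t'.+1 %[mod 2 ^ D.+2].
Proof. by move=> tt'; rewrite -addn1 -modnDml tt' modnDml addn1. Qed.

(** The period is twice the top window, because the parity of the top windows selects a buffer. A
    request makes two accesses, which halves the period in terms of requests. *)
Lemma per_accessp (sel : Env -> nat * nat * option (block B)) t t' :
  t = t' %[mod 2 ^ D.+2] -> 2 ^ E <= t -> 2 ^ E <= t' ->
  accessp D H sel t = accessp D H sel t'.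
Proof.
move=> tt' tE tE'; have TT := per_S tt'.
have pp1 j : j <= E -> odd (q j t.+1).-1 = odd (q j t'.+1).-1.
  by apply: per_pred => //; apply: leqW.
have pp j : j <= E -> odd (q j t).-1 = odd (q j t').-1 by apply: per_pred.
have lE := lvl_le D t'; have lE1 := lvl_le D t'.+1.
have Eodd : odd t = odd t' by have := per_odd tt' (leq0n _); rewrite !q0.
rewrite /accessp /setups /body (per_lvl TT); congr (_ ++ (_ ++ (_ ++ (_ ++ _)))).
- by apply: eq_loop => j; rewrite ltnS => jl; rewrite pp1 // (leq_trans jl).
- have El := per_lvl tt'; have e0 := expn_gt0 2 E; have pl := pp _ lE.
  move: El pl tE tE'; case: (t) (t') => [|s] [|s'] //=; rewrite ?leqn0 ?expn_eq0 //.
  by move=> -> ->.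
- apply: eq_loop => d _; rewrite /walkstep /newnode Eodd.
  have -> : act D t = act D t'.
    rewrite /act; apply: eq_in_filter => j; rewrite mem_iota ltnS => jE.
    by rewrite /active (per_odd tt') // tE tE'.
  congr (_ ++ _); congr flatten; apply/eq_in_map => j; rewrite mem_filter mem_iota ltnS => /andP[_ jE].
  by rewrite /look pp // (per_mod tt') // leqW.
- by rewrite Eodd.
apply: eq_loop => j jl; have jE := leq_trans jl lE1.
by have := pp1 j.+1 jE; rewrite /merge /mergeA /mergeB /ren => ->.
Qed.

End Period.

Section Index.
Variables (N B L D : nat).
Notation E := D.+1.
Notation prog := (@prog N B L D).

(* The program of request [t] only depends on [t] modulo [2 ^ E], once [2 ^ E <= t]. *)
Definition red t := if t < 2 ^ E then t else 2 ^ E + t %% 2 ^ E.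
Definition nxt t := if t.+1 < (2 ^ E).*2 then t.+1 else 2 ^ E.

Lemma red_le t : red t <= (2 ^ E).*2.
Proof. by rewrite /red; have := mod_lt E t; case: ifP; lia. Qed.

Lemma red0 : red 0 = 0.
Proof. by rewrite /red expn_gt0. Qed.

Lemma nxt_red t : nxt (red t) = red t.+1.
Proof.
rewrite /nxt /red; have e0 := expn_gt0 2 E; set e := 2 ^ E in e0 *.
have [lt|le] := ltnP t e.
  case: (ltnP t.+1 e) => [lt1|le1]; first by rewrite ifT //; lia.
  have -> : t.+1 = e by lia.
  by rewrite modnn addn0 if_same.
rewrite (ltnNge t.+1) (leqW le) /=.
have -> : t.+1 %% e = (t %% e + 1) %% e by rewrite modnDml addn1.
have := ltn_pmod t e0; move: (t %% e) => r re; rewrite -addnn -addnS ltn_add2l.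
case: (ltnP r.+1 e) => [lt|le1]; first by rewrite modn_small ?addn1.
have -> : r + 1 = e by lia.
by rewrite modnn addn0.
Qed.

Lemma prog_red t : prog (red t) = prog t.
Proof.
rewrite /red; case: ltnP => // le; set r := t %% 2 ^ E.
have Er : 2 ^ E + r = t %[mod 2 ^ E] by rewrite modnDl modn_mod.
have E2 : (2 ^ E + r).*2 = t.*2 %[mod 2 ^ D.+2].
  by rewrite -!muln2 [2 ^ D.+2]expnSr -!muln_modl Er.
have le2 x : 2 ^ E <= x -> 2 ^ E <= x.*2 by rewrite -addnn; lia.
have le' : 2 ^ E <= 2 ^ E + r by apply: leq_addr.
rewrite /prog (per_accessp _ _ E2) ?le2 //.
rewrite (per_accessp _ _ (per_S E2)) ?(leqW (le2 _ _)) //.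
rewrite /sweepsel.
have := congr1 (modn^~ (2 ^ D)) Er.
by rewrite !modn_dvdm ?dvdn_exp2l // => ->.
Qed.

End Index.

(** * Addresses, program lengths and block counts *)

Section WellFormed.
Variables (N B L D : nat).
Notation E := D.+1.
Notation H := (D + L).
Notation Env := ('I_N * option (block B))%type.
Notation Tmp := (Tmp D B).
Notation Wd := (Wd D B).
Notation op := (op Env Tmp Wd Cell).

(** Depth [H], which carries no node, is included: the last step of a walk still reads the position
    of a child. *)
Definition wfc (c : Cell) : bool :=
  [&& tagA c.1 < 7, c.1.1.2 <= H, c.1.2 <= E & c.2 < nn c.1.2].

Fixpoint wfs (ops : seq op) : Prop :=
  if ops is o :: ops' then wfop (Q D) colf wfc o /\ wfs ops' else True.

Lemma wfsP ops : wfs ops -> forall o, List.In o ops -> wfop (Q D) colf wfc o.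
Proof. by elim: ops => //= o ops IH [wo /IH ws] x [<-|/ws]. Qed.
Lemma wfs_cons o ops : wfop (Q D) colf wfc o -> wfs ops -> wfs (o :: ops).
Proof. by []. Qed.
Lemma wfs_cat o1 o2 : wfs o1 -> wfs o2 -> wfs (o1 ++ o2).
Proof. by move=> w1 w2; elim: o1 w1 => //= o o1 IH [? /IH]. Qed.
Lemma wfs_map (T : eqType) (l : seq T) (f : T -> seq op) :
  (forall x, x \in l -> wfs (f x)) -> wfs (flatten (map f l)).
Proof.
elim: l => //= x l IH Hf; apply: wfs_cat; first by apply: Hf; rewrite mem_head.
by apply: IH => y yl; apply: Hf; rewrite inE yl orbT.
Qed.
Lemma wfs_loop n f : (forall i, i < n -> wfs (f i)) -> wfs (loop n f).
Proof. by move=> Hf; apply: wfs_map => i; rewrite mem_iota add0n => /Hf. Qed.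

Definition wfA (A : arr) : bool := [&& tagA A < 7, A.1.2 <= H & A.2 <= E].

Lemma wf_mk A idx val upd : wfA A -> (forall t, idx t < nn A.2) -> wfop (Q D) colf wfc (@mk Env D B A idx val upd).
Proof. by move=> /and3P[a1 a2 a3] Hi; split=> // e t k _; rewrite /wfc /= a1 a2 a3 Hi. Qed.

Lemma wf_rd A i f : wfA A -> i < nn A.2 -> wfop (Q D) colf wfc (@rd Env D B A i f).
Proof. by move=> wA iA; apply: wf_mk. Qed.

Lemma mod_nn x j : x %% nn j < nn j.
Proof. by rewrite ltn_mod nn_gt0. Qed.

Lemma wfA_d tag (b : bool) d j : tag < 7 -> d <= H -> j <= E -> wfA (tag, b, d, j).
Proof. by move=> *; apply/and3P. Qed.

Lemma wfs_fyl K n : wfA K -> n <= nn K.2 -> wfs (fyl Env D B K 0 n).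
Proof.
move=> wK nK; apply: wfs_map => i; rewrite mem_iota add0n => iltn; have iK := leq_trans iltn nK.
have /and3P[a1 a2 a3] := wK.
apply: wfs_cons; last by apply: wfs_cons => //; apply: wf_mk.
split=> [|e t k ki] /=; first by rewrite ltnS ltnW // (leq_trans iK) // nn_le.
by rewrite /wfc /= a1 a2 a3 (leq_ltn_trans ki).
Qed.

Lemma wfs_put K S T j : wfA K -> wfA S -> wfA T -> K.2 = j -> S.2 = j -> T.2 = j ->
  wfs (put Env D B K S T (nn j)).
Proof.
move=> wK wS wT Kj Sj Tj; apply: wfs_loop => p pj; do 3?[apply: wfs_cons] => //; apply: wf_mk => // *;
  by rewrite ?Kj ?Sj ?Tj ?mod_nn.
Qed.

Lemma wfs_get K S T j : wfA K -> wfA S -> wfA T -> K.2 = j -> S.2 = j -> T.2 = j ->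
  wfs (get Env D B K S T (nn j)).
Proof.
move=> wK wS wT Kj Sj Tj; apply: wfs_loop => p pj; do 3?[apply: wfs_cons] => //; apply: wf_mk => // *;
  by rewrite ?Kj ?Sj ?Tj ?mod_nn.
Qed.

Lemma wfs_copy S o T o' n : wfA S -> wfA T -> o + n <= nn S.2 -> o' + n <= nn T.2 ->
  wfs (copy Env D B S o T o' n).
Proof.
move=> wS wT on o'n; apply: wfs_loop => p pn; do 2?[apply: wfs_cons] => //; apply: wf_mk => // *; lia.
Qed.

Lemma wfs_setup b d j : d <= H -> j <= E -> wfs (setup Env D B b d j).
Proof.
move=> dH jE; rewrite /setup /setup_tl; do 4?[apply: wfs_cat].
- by apply: wfs_fyl => //; apply: wfA_d.
- by apply: wfs_fyl => //; apply: wfA_d.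
- by apply: wfs_loop => i ij; apply: wfs_cons => //; apply: wf_mk => //; apply: wfA_d.
- by apply: wfs_put => //; apply: wfA_d.
- by apply: wfs_put => //; apply: wfA_d.
Qed.

Lemma wfs_scatter b d j : d <= H -> j <= E -> wfs (scatter Env D B b d j).
Proof. by move=> dH jE; apply: wfs_cat; apply: wfs_put => //; apply: wfA_d. Qed.

Lemma wfs_gather b d j : d <= H -> j <= E -> wfs (gather Env D B b d j).
Proof. by move=> dH jE; apply: wfs_cat; apply: wfs_get => //; apply: wfA_d. Qed.

Lemma wfs_merge t1 j : j < E -> wfs (merge Env D B H t1 j).
Proof.
move=> jE; have jE' := ltnW jE; have e0 := expn_gt0 2 j; have eS := expnS 2 j.
rewrite /merge; apply: wfs_cat; last apply: wfs_cat; apply: wfs_loop => d dH; have dH' := ltnW dH.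
- apply: wfs_map => b _; apply: wfs_cat; last apply: wfs_cat; last apply: wfs_cat.
  + exact: wfs_scatter.
  + by apply: wfs_copy; rewrite ?wfA_d // /nn /=; case: b; lia.
  + by apply: wfs_copy; rewrite ?wfA_d // /nn /=; case: b; lia.
  + exact: wfs_gather.
- rewrite /mergeB; case: ifP => // d1; apply: wfs_loop => i ilt.
  apply: wfs_cons; first by apply: wf_rd; rewrite ?wfA_d // /nn /=; lia.
  apply: wfs_cat; last by apply: wfs_cons => //; apply: wf_mk => [|u]; rewrite ?wfA_d // /nn /=; lia.
  apply: wfs_map => -[c b] _; apply: wfs_cons.
    by apply: wf_rd; rewrite ?wfA_d // /nn /=; case: c; lia.
  apply: wfs_cons => //; apply: wf_mk => [|u]; rewrite ?wfA_d //; exact: mod_nn.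
- exact: wfs_gather.
Qed.

Lemma wfs_accessp sel t : 0 < L -> wfs (@accessp Env D B H sel t).
Proof.
move=> L0; have H0 : 0 < H by rewrite addn_gt0 L0 orbT.
have lE := lvl_le D t.+1; rewrite /accessp; apply: wfs_cat; last first.
  rewrite /body; apply: wfs_cat; last apply: wfs_cat; last apply: wfs_cat.
- have lt := lvl_le D t; rewrite /root; case: (t) lt => [|t'] lt; apply: wfs_cons => //; apply: wf_rd => //.
  by rewrite /nn /=; have := expn_gt0 2 (lvl D t'.+1); lia.
- apply: wfs_loop => d dH; have dH' := ltnW dH; apply: wfs_cat.
    apply: wfs_map => j; rewrite mem_filter mem_iota ltnS => /andP[_ jE].
    apply: wfs_cons; first by apply: wf_rd; rewrite ?wfA_d // /nn /=; have := mod_lt j t; lia.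
    by apply: wfs_cons => //; apply: wf_mk => [|u]; rewrite ?wfA_d //; exact: mod_nn.
  by do 3?[apply: wfs_cons] => //; apply: wf_mk => // *; rewrite ?wfA_d.
- by apply: wfs_loop => d dH; apply: wfs_gather => //; apply: ltnW.
- by apply: wfs_loop => j jl; apply: wfs_merge; apply: leq_trans jl lE.
- apply: wfs_loop => j; rewrite ltnS => jl; apply: wfs_loop => d dH.
  by apply: wfs_setup; [exact: ltnW | exact: leq_trans jl lE].
Qed.

Lemma wfs_prog t : 0 < L -> wfs (@prog N B L D t).
Proof.
move=> L0; apply: wfs_cat; first exact: wfs_accessp.
by apply: wfs_cat; [exact: wfs_accessp | apply: wfs_cons => //; apply: wf_rd].
Qed.

End WellFormed.

Section Addresses.
Variables (D L : nat).
Notation H := (D + L).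

(** A mixed-radix code. Since [nn] doubles from one level to the next, the offsets from [nn j] up to
    [2 * nn j] are disjoint for distinct levels. The factor 14 of [ncells] is 7 kinds of arrays
    times 2 parities. *)
Definition adr (c : Cell) : nat :=
  ((c.1.1.1.1 * 2 + c.1.1.1.2) * H.+1 + c.1.1.2) * (2 * Q D) + (nn c.1.2 + c.2).
Definition ncells : nat := 14 * H.+1 * (2 * Q D).

Lemma divmod_inj n a b a' b' : b < n -> b' < n -> a * n + b = a' * n + b' -> a = a' /\ b = b'.
Proof.
move=> bn b'n Ea; have n0 : 0 < n by lia.
have := congr1 (divn^~ n) Ea; rewrite !divnMDl // !divn_small // !addn0 => Eq.
by split=> //; move: Ea; rewrite Eq => /addnI.
Qed.

Lemma adr_off c : wfc L D c -> nn c.1.2 + c.2 < 2 * Q D.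
Proof. by case/and4P => _ _ /nn_le jQ ij; rewrite mulSn mul1n; lia. Qed.

Lemma pack_lt a n b m : a < n -> b < m -> a * m + b < n * m.
Proof. by move=> an bm; apply: (@leq_trans (a.+1 * m)); [rewrite mulSn addnC ltn_add2r | rewrite leq_mul2r an orbT]. Qed.

Lemma adr_ltn c : wfc L D c -> adr c < ncells.
Proof.
move=> wc; have oQ := adr_off wc; apply: pack_lt => //; apply: pack_lt.
  by case/and4P: wc => t7 _ _ _; apply: (@pack_lt _ 7 _ 2); case: (c.1.1.1.2).
by case/and4P: wc.
Qed.

Lemma nn_off_inj j i j' i' : i < nn j -> i' < nn j' -> nn j + i = nn j' + i' -> j = j' /\ i = i'.
Proof.
move=> ij ij' Eq; have mono a b : a < b -> 2 * nn a <= nn b.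
  by move=> ab; rewrite /nn mulnCA -expnS leq_mul2l leq_exp2l.
suff Ej : j = j' by move: Eq; rewrite Ej => /addnI.
by case: (ltngtP j j') => // /mono; lia.
Qed.

Lemma adr_inj : {in wfc L D &, injective adr}.
Proof.
move=> [[[[t b] d] j] i] [[[[t' b'] d'] j'] i'] wx wy /(divmod_inj (adr_off wx) (adr_off wy))[].
case/and4P: wx wy => /= _ dH _ ij /and4P[/= _ dH' _ ij'] E1 /(nn_off_inj ij ij')[-> ->].
have [E2 ->] := divmod_inj (dH : d < H.+1) (dH' : d' < H.+1) E1.
have b2 (c : bool) : c < 2 by case: c.
by have [-> Eb] := divmod_inj (b2 b) (b2 b') E2; move: Eb; case: (b) (b') => [] [].
Qed.

End Addresses.

(** * Counting operations, worst case and amortized *)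

Section Sizes.
Variables (Env : Type) (D B H : nat).

Lemma size_loop_le A n (f : nat -> seq A) c : (forall i, i < n -> size (f i) <= c) ->
  size (loop n f) <= n * c.
Proof.
elim: n => // n IH Hf; rewrite loopS size_cat mulSn addnC leq_add ?Hf ?IH // => i ilt.
by apply: Hf; apply: leqW.
Qed.

Definition pw n := \sum_(j < n) 2 ^ j.

Lemma size_loop_pw A n (f : nat -> seq A) c : (forall j, j < n -> size (f j) <= c * 2 ^ j) ->
  size (loop n f) <= c * pw n.
Proof.
elim: n => // n IH Hf; rewrite loopS size_cat /pw big_ord_recr mulnDr leq_add ?Hf ?IH // => i ilt.
by apply: Hf; apply: leqW.
Qed.

Lemma size_flatten_le A T (l : seq T) (f : T -> seq A) c : (forall x, size (f x) <= c) ->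
  size (flatten (map f l)) <= size l * c.
Proof. by move=> Hf; elim: l => //= x l IH; rewrite size_cat mulSn leq_add. Qed.

Lemma size_put K S T n : size (put Env D B K S T n) <= n * 3. Proof. exact: size_loop_le. Qed.
Lemma size_get K S T n : size (get Env D B K S T n) <= n * 3. Proof. exact: size_loop_le. Qed.
Lemma size_copy S o T o' n : size (copy Env D B S o T o' n) <= n * 2. Proof. exact: size_loop_le. Qed.
Lemma size_fill T n : size (fill Env D B T n) <= n * 1. Proof. exact: size_loop_le. Qed.
Lemma size_fyl K n : size (fyl Env D B K 0 n) <= n * 2.
Proof. by rewrite -{2}(size_iota 0 n); apply: size_flatten_le. Qed.

Lemma size_setup b d j : size (setup Env D B b d j) <= 66 * 2 ^ j.
Proof.
have := (size_fyl (K1 b d j) (nn j), size_fyl (K2 b d j) (nn j), size_fill (X b d j) (nn j),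
  size_put (K2 b d j) (X b d j) (U b d j) (nn j), size_put (K1 b d j) (U b d j) (P b d j) (nn j)).
by rewrite /setup /setup_tl !size_cat; case => [[[[]]]]; rewrite /nn; lia.
Qed.

Lemma size_scatter b d j : size (scatter Env D B b d j) <= 36 * 2 ^ j.
Proof.
have := (size_put (K2 b d j) (X b d j) (U b d j) (nn j), size_put (K1 b d j) (U b d j) (V b d j) (nn j)).
by rewrite /scatter size_cat => -[]; rewrite /nn; lia.
Qed.

Lemma size_gather b d j : size (gather Env D B b d j) <= 36 * 2 ^ j.
Proof.
have := (size_get (K1 b d j) (V b d j) (U b d j) (nn j), size_get (K2 b d j) (U b d j) (X b d j) (nn j)).
by rewrite /gather size_cat => -[]; rewrite /nn; lia.
Qed.

Lemma size_merge t1 j : size (merge Env D B H t1 j) <= H * 244 * 2 ^ j.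
Proof.
have b1 : size (loop H (mergeA Env D B t1 j)) <= H * (152 * 2 ^ j).
  apply: size_loop_le => d _; apply: leq_trans (size_flatten_le (c := 76 * 2 ^ j) _ _) _ => [b|/=]; last by lia.
  rewrite size_cat size_cat size_cat.
  have := (size_scatter b d j, size_gather b d j).
  have := (size_copy (V b d j) 0 (V (odd (q j.+1 t1).-1) d j.+1) (b * 2 ^ j) (2 ^ j),
     size_copy (P (odd (q j.+1 t1).-1) d j.+1) (b * 2 ^ j) (V b d j) 0 (2 ^ j)).
  by case=> ? ? []; lia.
have b2 : size (loop H (mergeB Env D B H t1 j)) <= H * (20 * 2 ^ j).
  apply: size_loop_le => d _; rewrite /mergeB; case: ifP => // _.
  have -> : 20 * 2 ^ j = 2 ^ j.+1 * 10 by rewrite expnS; lia.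
  by apply: size_loop_le.
have b3 : size (loop H (fun d => gather Env D B (odd (q j.+1 t1).-1) d j.+1)) <= H * (72 * 2 ^ j).
  by apply: size_loop_le => d _; apply: leq_trans (size_gather _ _ _) _; rewrite expnS; lia.
rewrite /merge !size_cat -mulnA.
apply: leq_trans (leq_add b1 (leq_add b2 b3)) _.
by move: (2 ^ j) => x; lia.
Qed.

(** Per depth: two operations on each of at most [D + 2] levels, 3 for the new node and 36 to gather
    it, which makes [2 * D + 43]. Per unit of rebuilt size: 66 for the shuffles and 244 for the
    merge, which makes 310. *)
Lemma size_accessp sel t :
  size (@accessp Env D B H sel t) <= 1 + H * (2 * D + 43) + 310 * H * pw (lvl D t.+1).+1.
Proof.
have bs : size (setups Env D B H t.+1) <= H * 66 * pw (lvl D t.+1).+1.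
  apply: size_loop_pw => j _; rewrite -mulnA; apply: size_loop_le => d _; exact: size_setup.
have br : size (root Env D B t) <= 1 by case: (t).
have bw : size (loop H (walkstep D H sel t)) <= H * (2 * D + 7).
  apply: size_loop_le => d _; rewrite size_cat /=.
  apply: (@leq_trans (size (act D t) * 2 + 3)); first by rewrite leq_add2r; apply: size_flatten_le.
  have : size (act D t) <= D.+2 by rewrite -[D.+2](size_iota 0); apply: size_subseq; exact: filter_subseq.
  by lia.
have bg : size (loop H (fun d => gather Env D B (odd t) d 0)) <= H * 36.
  by apply: size_loop_le => d _; apply: leq_trans (size_gather _ _ _) _.
have bm : size (loop (lvl D t.+1) (merge Env D B H t.+1)) <= H * 244 * pw (lvl D t.+1).
  by apply: size_loop_pw => j _; apply: size_merge.
have pS : pw (lvl D t.+1) <= pw (lvl D t.+1).+1 by rewrite {2}/pw big_ord_recr leq_addr.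
rewrite /accessp /body size_cat size_cat size_cat size_cat.
have := leq_mul (leqnn (H * 244)) pS; move: (pw _) (pw _) bs br bw bg bm; lia.
Qed.

End Sizes.

Section Total.
Variables (N B L D : nat).
Notation E := D.+1.
Notation H := (D + L).
Notation prog := (@prog N B L D).

(* Potential paying for the merges: level [j] is rebuilt every [2 ^ j] accesses. *)
Definition phi t := \sum_(j < E.+1) 2 ^ j * q j t.

Lemma phi_le t : phi t <= E.+1 * t.
Proof.
apply: (@leq_trans (\sum_(j < E.+1) t)).
  by apply: leq_sum => j _; rewrite mulnC leq_trunc_div.
by rewrite sum_nat_const card_ord.
Qed.

(** Exactly the levels [j <= lvl t.+1] start a new window, and each of them raises the potential by
    [2 ^ j]. *)
Lemma phiS t : phi t + pw (lvl D t.+1).+1 <= phi t.+1.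
Proof.
have lE : (lvl D t.+1).+1 <= E.+1 by rewrite ltnS lvl_le.
rewrite /pw (big_ord_widen _ (fun j => 2 ^ j) lE) big_mkcond -big_split /=.
apply: leq_sum => j _; rewrite ltnS; case: (leqP j (lvl D t.+1)) => jl; last by rewrite addn0 leq_mul2l q_le ?orbT.
by rewrite (lvl_q jl) mulnS addnC.
Qed.

Definition base : nat := 2 * (1 + H * (2 * D + 43)) + 1.

Lemma size_prog t : size (prog t) <= base + 310 * H * (pw (lvl D t.*2.+1).+1 + pw (lvl D t.*2.+2).+1).
Proof.
rewrite /prog size_cat size_cat.
have := (@size_accessp _ D B H (@sweepsel N B L D t) t.*2).
have := (@size_accessp _ D B H (@usersel N B L D) t.*2.+1).
by rewrite /base [size [:: _]]/=; move: (pw _) (pw _) => x y; lia.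
Qed.

Lemma pw_lt n : pw n < 2 ^ n.
Proof. by elim: n => [|n IH]; [rewrite /pw big_ord0 | rewrite /pw big_ord_recr expnS /= -/(pw n); lia]. Qed.

Lemma size_prog_max t : size (prog t) <= base + 620 * H * 2 ^ D.+2.
Proof.
apply: leq_trans (size_prog t) _; rewrite leq_add2l.
have pl s : pw (lvl D s).+1 <= 2 ^ D.+2.
  by apply: ltnW; apply: leq_trans (pw_lt _) _; rewrite leq_exp2l // ltnS lvl_le.
have := (pl t.*2.+1, pl t.*2.+2) => -[]; move: (pw _) (pw _) => x y xl yl.
by rewrite (_ : 620 * H * 2 ^ D.+2 = 310 * H * (2 ^ D.+2 + 2 ^ D.+2)) ?leq_mul2l ?leq_add ?orbT //; lia.
Qed.

Lemma sum_size_prog n : \sum_(0 <= i < n) size (prog i) <= (base + 620 * H * D.+2) * n.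
Proof.
have : \sum_(0 <= i < n) size (prog i) <= base * n + 310 * H * phi n.*2.
  elim: n => [|n IH]; first by rewrite big_geq.
  rewrite big_nat_recr //=; apply: leq_trans (leq_add IH (size_prog n)) _.
  have := (phiS n.*2, phiS n.*2.+1) => -[h1 h2].
  rewrite mulnS doubleS; apply: (@leq_trans (base + base * n + 310 * H *
    (phi n.*2 + pw (lvl D n.*2.+1).+1 + pw (lvl D n.*2.+2).+1))); first by lia.
  by rewrite leq_add2l leq_mul2l; apply/orP; right; lia.
move=> h; apply: leq_trans h _; rewrite mulnDl leq_add2l.
have := leq_mul (leqnn (310 * H)) (phi_le n.*2); move: (phi _) => x; rewrite -muln2; lia.
Qed.

End Total.

(* [N] blocks are kept on about [N / log N] paths, [log N] blocks on each. *)
Definition rowlen N := up_log 2 N.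
Definition depth N := up_log 2 (N %/ rowlen N).+1.

Lemma rowlen_gt0 N : 1 < N -> 0 < rowlen N.
Proof. by rewrite /rowlen up_log_gt0. Qed.

Lemma depth_bound N : N %/ rowlen N < 2 ^ depth N.
Proof. exact: up_logP. Qed.

Lemma depth_le N : depth N <= (rowlen N).+1.
Proof.
apply: up_log_min => //; have := leq_div N (rowlen N); have := up_logP N (isT : 1 < 2).
by rewrite -/(rowlen N) expnS; lia.
Qed.

Lemma depth_size N : 1 < N -> 2 ^ depth N * rowlen N <= 2 * N.
Proof.
move=> N1; have L0 := rowlen_gt0 N1; have LN : rowlen N <= N.
  by apply: up_log_min => //; apply: ltnW; apply: ltn_expl.
have q1 : 0 < N %/ rowlen N by rewrite divn_gt0.
have /andP[lo _] := up_log_bounds (isT : 1 < 2) (q1 : 1 < (N %/ rowlen N).+1).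
have D0 : 0 < depth N by rewrite up_log_gt0.
rewrite -(prednK D0) expnS -mulnA leq_mul2l /=.
apply: leq_trans (leq_divM N (rowlen N)); rewrite leq_mul2r.
by move: lo; rewrite ltnS => ->; rewrite orbT.
Qed.

(** * Sizes of words, client states and addresses, measured in blocks *)

Section Cards.
Variables (c N B L D : nat).
Hypotheses (L_gt0 : 0 < L) (NL : N <= 2 ^ L) (DL : D <= L.+1) (LB : L <= c * B).
Notation E := D.+1.
Notation H := (D + L).

(* Since [L <= c * B], words and states of [O(L)] bits fit in [O(1)] blocks. *)
Definition wordlen : nat := 30 * c + 1.
Definition statelen : nat := 33 * c + 5 * wordlen + 20.
Definition proglen : nat := (3 * wordlen + 2) * (base L D + 620 * H * 2 ^ D.+2).
Notation K := wordlen.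

Lemma B_gt0 : 0 < B. Proof. by case: (B) LB => //; rewrite muln0; lia. Qed.

Lemma pow_mul x y a b : x <= 2 ^ a -> y <= 2 ^ b -> x * y <= 2 ^ (a + b).
Proof. by move=> xa yb; rewrite expnD leq_mul. Qed.

Lemma pow_le x a b : x <= 2 ^ a -> a <= b -> x <= 2 ^ b.
Proof. by move=> xa ab; apply: leq_trans xa _; rewrite leq_exp2l. Qed.

Lemma pow_self n : n <= 2 ^ n. Proof. exact: ltnW (ltn_expl n _). Qed.

Lemma card_block : #|{: block B}| = 2 ^ B.
Proof. by rewrite card_tuple card_bool. Qed.

Lemma card_num : (Q D).+1 <= 2 ^ (D + 4).
Proof. by rewrite /Q /nn addnC -[2 ^ (4 + D)]/(2 ^ (4 + D)) expnD !expnS; have := expn_gt0 2 D; lia. Qed.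

Lemma card_optr : #|{: option (ptr D)}| <= 2 ^ (2 * D + 8).
Proof.
rewrite card_option !card_prod !card_ord card_bool.
have h : D.+2 * 2 * (Q D).+1 <= 2 ^ (D.+2 + 1 + (D + 4)).
  by apply: pow_mul card_num; apply: pow_mul => //; apply: pow_self.
have -> : 2 * D + 8 = (D.+2 + 1 + (D + 4)).+1 by lia.
by rewrite expnS; have := expn_gt0 2 (D.+2 + 1 + (D + 4)); lia.
Qed.

(** Besides its datum of [B] bits, a word takes [5 * D + 20] bits. As [D <= L + 1] and
    [1 <= L <= c * B], this is at most [30 * L <= 30 * c * B]. *)
Lemma card_Wd : #|{: Wd D B}| <= 2 ^ (K * B).
Proof.
rewrite !card_prod card_ord card_block.
apply: pow_le (pow_mul (pow_mul (pow_mul card_optr card_optr) (leqnn _)) card_num) _.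
by rewrite /K; have := B_gt0; nia.
Qed.

Lemma card_word : #|{: Wd D B}| <= #|{: {ffun 'I_K -> block B}}|.
Proof. by rewrite card_ffun card_ord card_block -expnM mulnC; apply: card_Wd. Qed.

Lemma proglen_le : proglen.+1 <= 2 ^ (3 * K + 17 + 2 * L).
Proof.
have L2 := pow_self L; have e1 := expn_gt0 2 L.
have hD : 2 ^ D.+2 <= 8 * 2 ^ L by rewrite -[8]/(2 ^ 3) -expnD leq_exp2l; lia.
have hb : base L D + 620 * H * 2 ^ D.+2 < 2 ^ 14 * (2 ^ L * 2 ^ L).
  rewrite /base; move: (2 ^ L) (2 ^ D.+2) L2 e1 hD => x y Lx x0 yx.
  have h1 : H * (2 * D + 43) <= (3 * x) * (47 * x) by apply: leq_mul; lia.
  have h2 : H * y <= (3 * x) * (8 * x) by apply: leq_mul; lia.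
  have xx : 0 < x * x by rewrite muln_gt0 x0.
  lia.
apply: (@leq_trans ((3 * K + 3) * (2 ^ 14 * (2 ^ L * 2 ^ L)))); first by rewrite /proglen; nia.
rewrite -!expnD; apply: pow_le (pow_mul (pow_self _) (leqnn _)) _; lia.
Qed.

(** Time index and program counter are part of the client's memory, so the logarithms of the period
    and of the program length must be [O(B)] as well. *)
Lemma card_state : #|{: full (mst N B K (Q D) (Tmp D B)) (2 ^ E).*2 proglen}| <=
  #|{: statelen.-tuple (block B)}|.
Proof.
have hT : (2 ^ E).*2.+1 <= 2 ^ (D + 3).
  by rewrite -mul2n -expnS addn3 [2 ^ D.+3]expnS; have := expn_gt0 2 D.+2; lia.
have hEnv : #|{: 'I_N * option (block B)}| <= 2 ^ (L + (B + 1)).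
  rewrite card_prod card_ord card_option card_block; apply: pow_mul => //.
  by rewrite addn1 expnS; have := expn_gt0 2 B; lia.
have hTmp : #|{: Tmp D B}| <= 2 ^ (2 * D + 8 + (D + 4) + K * B + B).
  rewrite card_prod card_prod card_prod card_ord card_block.
  exact: pow_mul (pow_mul (pow_mul card_optr card_num) card_Wd) (leqnn _).
have hS : #|{: mst N B K (Q D) (Tmp D B)}| <=
    2 ^ (L + (B + 1) + (2 * D + 8 + (D + 4) + K * B + B) + (D + 4) + B * K + B).
  do 4!rewrite card_prod; rewrite card_ffun !card_ord card_block -expnM.
  exact: pow_mul (pow_mul (pow_mul (pow_mul hEnv hTmp) card_num) (leqnn _)) (leqnn _).
rewrite card_tuple card_block -expnM card_prod card_prod !card_ord.
apply: pow_le (pow_mul (pow_mul hT proglen_le) hS) _.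
rewrite /statelen; have := B_gt0; nia.
Qed.

(** An address has [O(L)] bits and [L <= c * B], so it is cut into boundedly many blocks. *)
Lemma slots_le (P : scheme N B) : server_blocks P <= 2 ^ (12 + 2 * L + K) ->
  slot_blocks P <= 13 + 2 * c + K.
Proof.
move=> h; have B0 := B_gt0; apply: (@leq_trans (12 + 2 * c + K).+1); last by lia.
have : up_log 2 (server_blocks P) <= (12 + 2 * c + K) * B.
  by apply: up_log_min => //; apply: pow_le h _; nia.
by move=> hu; rewrite /slot_blocks ltnS -ltnS /address_blocks ltn_divLR // mulSn; lia.
Qed.

End Cards.

Section Scheme.
Variables (c N B : nat).
Hypotheses (N_gt1 : 1 < N) (NB : up_log 2 N <= c * B).
Notation L := (rowlen N).
Notation D := (depth N).
Notation H := (D + L).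
Notation K := (wordlen c).
Notation Word := (Wd D B).
Notation State := (Tmp D B).

Let L_gt0 : 0 < L := rowlen_gt0 N_gt1.
Let L_cB : L <= c * B := NB.
Let N_L : N <= 2 ^ L. Proof. exact: up_logP. Qed.
Let word_card : #|{: Word}| <= #|{: {ffun 'I_K -> block B}}|.
Proof. exact: card_word L_gt0 N_L (depth_le N) L_cB. Qed.
Let state_card : #|{: full (mst N B K (Q D) State) (2 ^ D.+1).*2 (proglen c L D)}| <=
  #|{: (statelen c).-tuple (block B)}|.
Proof. exact: card_state L_gt0 N_L (depth_le N) L_cB. Qed.

Definition nblocks : nat := ncells D L * K.

Lemma nblocks_gt0 : 0 < nblocks.
Proof. by rewrite !muln_gt0 expn_gt0 /wordlen addn1. Qed.

(** Here [2 * Q D = 24 * 2 ^ D] and [H.+1 <= 4 * L], while [2 ^ D * L <= 2 * N]; so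
    [2688 = 14 * 24 * 8]. *)
Lemma nblocks_N : nblocks <= 2688 * K * N.
Proof.
have := depth_size N_gt1; have := depth_le N; have := L_gt0; have := expn_gt0 2 D.
rewrite /nblocks /ncells /Q /nn !expnS; move: (2 ^ D) => x x0 L0 DL h.
have : H.+1 * x <= 8 * N.
  apply: (@leq_trans ((4 * L) * x)); [rewrite leq_mul2r; lia | lia].
by move=> h'; nia.
Qed.

Lemma nblocks_pow : nblocks <= 2 ^ (12 + 2 * L + K).
Proof.
have L2 := pow_self L; have DL := depth_le N; have L0 := L_gt0.
have hD : 2 ^ D <= 2 * 2 ^ L by rewrite -expnS leq_exp2l.
apply: (@leq_trans (2 ^ 12 * (2 ^ L * 2 ^ L) * 2 ^ K)); last by rewrite -!expnD addnn mul2n.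
apply: leq_mul (pow_self K); rewrite /ncells /Q /nn !expnS.
move: (2 ^ L) (2 ^ D) L2 hD => x y Lx yx.
have h : H.+1 * y <= (4 * x) * (2 * x) by apply: leq_mul; lia.
by nia.
Qed.

Let a0 : 'I_N := Ordinal (ltnW N_gt1).
Let enc := embed word_card.
Let dec := unembed (wnull D B) word_card.
Let encK : cancel enc dec. Proof. exact: embedK. Qed.

Let cell_lt (x : Cell) i : wfc L D x -> i < K -> adr D L x * K + i < nblocks.-1.+1.
Proof.
move=> wx iK; rewrite (prednK nblocks_gt0); apply: pack_lt => //.
exact: adr_ltn.
Qed.

Let tmp0 : State := (None, ord0, wnull D B, block0 B).
Notation prog := (@prog N B L D).
Let prog_wf t o : List.In o (prog t) -> wfop (Q D) colf (wfc L D) o.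
Proof. exact: (wfsP (@wfs_prog N B L D t L_gt0)). Qed.
Let size_code t : size (code nblocks.-1 (Q D) enc dec (adr D L) prog t) <= proglen c L D.
Proof.
rewrite /code /proglen; apply: leq_trans (size_flatten_le (c := 3 * K + 2) _ _) _.
  move=> o; rewrite /micro /= !size_cat size_map size_iota /=.
  apply: leq_trans (_ : K + (K * 2 + 1) < _); last by lia.
  rewrite ltnS leq_add2l leq_add2r; apply: leq_trans (size_flatten_le (c := 2) _ _) _ => //.
  by rewrite size_iota.
by rewrite mulnC leq_mul2l size_prog_max orbT.
Qed.

Definition oram : scheme N B :=
  oscheme nblocks.-1 enc dec (adr D L) tmp0 (@tout D B) prog (nxt D) state_card a0.

Notation cpl b R0 R1 t m0 m1 := (coupled H b (acc_path L D a0 R0) (acc_path L D a0 R1) 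
  (acc_depth L D a0 R0) (acc_depth L D a0 R1) (acc_data a0 R0) (acc_data a0 R1) t (tmp0, m0) (tmp0, m1)).

Lemma oram_correct : perfectly_correct oram.
Proof.
apply: (oscheme_correct encK cell_lt (@adr_inj D L) (red_le D) (red0 D) (nxt_red D)
  (@prog_red N B L D) prog_wf size_code) => R.
apply: (ARun_correct nblocks.-1 (adr D L) (J := fun t m => exists m', cpl ord0 R R t.*2 m m')).
- exact: size_ideal.
- by exists (fun _ => wnull D B); apply: coupled0.
move=> t r m F x tR [m' C] HF; rewrite (set_nth_default (Read a0)) //.
(* Correctness is the diagonal case of the coupling: the request sequence is compared with itself,
   and on the second copy the integrand is the constant [x], whose expectation is [x]. *)
rewrite (prog_rtr L_gt0 (depth_bound N) tR tR C (F1 := fun _ _ => x)).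
  by apply: aex_const.
move=> s0 s1 l [C' E0 _]; apply: HF => //.
by exists s1.2.
Qed.

Lemma oram_secure : perfectly_secure oram.
Proof.
apply: (oscheme_secure encK cell_lt (@adr_inj D L) (red_le D) (red0 D) (nxt_red D)
  (@prog_red N B L D) prog_wf size_code) => b R0 R1 g sR.
apply: (ARun_rel (adr D L) (@tout D B) (Phi := fun t m0 m1 => cpl b R0 R1 t.*2 m0 m1)) => //.
  exact: coupled0.
move=> t r m0 m1 tR C F0 F1 HF; rewrite !(set_nth_default (Read a0)) -?sR //.
have tR1 : t < size R1 by rewrite -sR.
by apply: (prog_rtr L_gt0 (depth_bound N) tR tR1 C) => s0 s1 l [C' _ _]; apply: HF.
Qed.

(* [8 * 1000]: a literal above 5000 would not be evaluated. *)
Definition overhead : nat := (8 * 1000) * ((3 * K + 2) * (3 * (13 + 2 * c + K))).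

Lemma oram_bandwidth : amortized_bandwidth_le oram (overhead * L ^ 2).
Proof.
apply: (oscheme_bandwidth encK cell_lt (@adr_inj D L) (red_le D) (red0 D) (nxt_red D)
  (@prog_red N B L D) prog_wf size_code) => n.
rewrite -big_distrl /=.
have hs : slot_blocks oram <= 13 + 2 * c + K.
  by apply: (slots_le L_gt0 N_L (depth_le N) L_cB); rewrite /= (prednK nblocks_gt0) nblocks_pow.
(* With [H <= 3 * L], [2 * D + 43 <= 47 * L] and [D.+2 <= 4 * L], the left side is at most
   [3 + (2 * 141 + 620 * 12) * L ^ 2], and [3 + 282 + 7440 = 7725]. *)
have hp : base L D + 620 * H * D.+2 <= (8 * 1000) * L ^ 2.
  have DL := depth_le N; have L0 := L_gt0; rewrite /base expnS expn1.
  have h1 : H * (2 * D + 43) <= (3 * L) * (47 * L) by apply: leq_mul; lia.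
  have h2 : H * D.+2 <= (3 * L) * (4 * L) by apply: leq_mul; lia.
  have LL : 0 < L * L by rewrite muln_gt0 L0.
  lia.
apply: (@leq_trans ((8 * 1000) * L ^ 2 * n * ((3 * K + 2) * (3 * (13 + 2 * c + K))))).
  by apply: leq_mul; [apply: leq_trans (sum_size_prog _ _ _ _ _) _; rewrite leq_mul2r hp orbT |
    rewrite leq_mul2l leq_mul2l hs !orbT].
by rewrite /overhead; lia.
Qed.

End Scheme.

(** * The theorem *)

Section Tiny.
Variables (N B : nat).
Hypothesis N_le1 : N <= 1.

(** For [N <= 1] the logarithm vanishes: no communication is allowed, and even [B = 0] is possible.
    The client keeps the only block, together with a second one for the answer, because a write
    returns the old value. *)
Definition tiny_receive (y : 2.-tuple (block B)) (r : request N B) : 2.-tuple (block B) :=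
  let cur := tnth y ord0 in
  match r with Read _ => [tuple cur; cur] | Write _ x => [tuple x; cur] end.

Definition tiny : scheme N B := {|
  client_blocks := 2; server_blocks := 0; sample_bound := 0; step_bound := 1;
  start := [tuple block0 B; block0 B]; receive := tiny_receive;
  step := fun y => @Output B 2 0 0 (tnth y ord_max) y |}.

Lemma Ex_tiny (c : config tiny) (m : memory N B) R f : (forall a, m a = tnth (client c) ord0) ->
  Ex (run_from c R) f = f (slots c, map Some (ideal_from m R)).
Proof.
elim: R c m f => [|r R IH] c m f Em /=; first by rewrite Ex_ret.
rewrite Ex_bind Ex_ret Ex_map /=.
rewrite (IH _ (update m r)) => [|a] /=; first by congr (f (_, Some _ :: _)); rewrite Em; case: r.
case: r => [a'|a' x] /=; first by rewrite Em.
by rewrite ffunE ifT //; apply/eqP/val_inj; have := ltn_ord a; have := ltn_ord a'; rewrite /=; lia.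
Qed.

Lemma Ex_tiny_run R f : Ex (run tiny R) f = f ([::], map Some (ideal R)).
Proof. by rewrite (Ex_tiny (m := memory0 N B)) // => a; rewrite ffunE. Qed.

Lemma tiny_correct : perfectly_correct tiny.
Proof. by move=> R; rewrite /almost_surely PrE Ex_tiny_run eqxx. Qed.

Lemma tiny_secure : perfectly_secure tiny.
Proof. by move=> b R0 R1 _ ev; rewrite !PrE /view !Ex_map !Ex_tiny_run. Qed.

Lemma tiny_bandwidth w : amortized_bandwidth_le tiny w.
Proof. by move=> R; rewrite /almost_surely PrE Ex_tiny_run /transferred big_nil. Qed.

End Tiny.

(* B = Omega(log N) is taken with an arbitrary implied constant c (c = 1: a
   block can store an address); the O-constants K and C depend on c only. *)
Theorem theorem1 :
  forall c : nat, exists K C : nat, forall N B : nat,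
  up_log 2 N <= c * B ->
  exists P : scheme N B,
    client_blocks P <= K /\
    server_blocks P <= K * N /\
    sample_bound P <= K * N /\
    perfectly_correct P /\
    perfectly_secure P /\
    amortized_bandwidth_le P (C * up_log 2 N ^ 2).
Proof.
move=> c; exists (statelen c + 2688 * wordlen c + 28), (overhead c) => N B NB.
have [N1|N1] := leqP N 1.
  exists (tiny N B); split; first by rewrite [client_blocks _]/= /statelen; lia.
  by do !split=> //; [exact: tiny_correct | exact: tiny_secure | exact: tiny_bandwidth].
exists (oram N1 NB); split; first by rewrite [client_blocks _]/=; lia.
split; first by rewrite /= (prednK (nblocks_gt0 c N)) (leq_trans (nblocks_N N1 NB)) // leq_mul2r; lia.
split; last by split; [exact: oram_correct | split; [exact: oram_secure | exact: oram_bandwidth]].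
(* What remains is the sampling bound [(Q D).+1 = 12 * 2 ^ D + 1], and [2 ^ D <= 2 * N] by
   [depth_size]. *)
have := depth_size N1; have := rowlen_gt0 N1; rewrite /= /Q /nn expnS; have := expn_gt0 2 (depth N).
move: (2 ^ depth N) => x x0 L0 h; apply: (@leq_trans (28 * N)); last by rewrite leq_mul2r; lia.
by nia.
Qed.
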